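(* Let $\Sigma$ be a two-dimensional surface equipped with a $C^3$-smooth Riemannian metric, let $\gamma\subset\Sigma$ be a germ of $C^3$-smooth curve with positive geodesic curvature $\kappa$, and let $\widehat\gamma\Subset\gamma$ be a compact subarc. For every small $p>0$ let $\mathcal T_p:\gamma\to\gamma$ denote the corresponding string diffeomorphism. Then $$\kappa^{\frac23}(A)\,\lambda(A,\mathcal T_p(A))\simeq\kappa^{\frac23}(\mathcal T_p^m(A))\,\lambda(\mathcal T_p^m(A),\mathcal T_p^{m+1}(A)),\quad\text{as } p\to0,$$ uniformly in $A\in\widehat\gamma$ and those $m\in\mathbb N$ for which $\mathcal T_p^m(A)\in\widehat\gamma$.
   Context: $\lambda(A,B)$ is the length of the arc $AB$ of $\gamma$; $f\simeq g$ means that $f/g\to1$. For $A,B\in\gamma$ close enough let $C_{AB}$ be the unique nearby intersection point of the geodesics tangent to $\gamma$ at $A$ and at $B$, and $L(A,B)=|AC_{AB}|+|BC_{AB}|-\lambda(A,B)$, where $|XY|$ is the length of the small geodesic segment $XY$. For small $p>0$ the $p$-th string curve is $\Gamma_p=\{C_{AB}\ |\ L(A,B)=p\}$. The billiard reflection from $\Gamma_p$ sends oriented geodesics tangent to $\gamma$ to geodesics tangent to $\gamma$. The string diffeomorphism $\mathcal T_p$ is the induced map on the tangency points: fixing an orientation of $\gamma$ and orienting the tangent geodesics accordingly, $\mathcal T_p(A)=B$, where $B$ is the point of $\gamma$ following $A$ such that $L(A,B)=p$ (so that the geodesic tangent to $\gamma$ at $A$ is reflected from $\Gamma_p$ at $C_{AB}$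 to the geodesic tangent to $\gamma$ at $B$). $\mathcal T_p^m$ is the $m$-th iterate. *)

(* Defs.v *)
From Stdlib Require Export Reals.
From Coquelicot Require Export Coquelicot.
Open Scope R_scope.
Set Implicit Arguments.

(** * Surfaces *)

(** A Hausdorff surface with a C^4 atlas: the least regularity for which a C^3
    metric tensor makes sense (smooth surfaces are included).  The chart [i] is
    [P |-> (cx i P, cy i P)] on [cdom i], with inverse [cinv i].  [chart_at]
    picks one chart around each point.  Second countability is not required. *)

Definition in_image (pt : Type) (dom : pt -> Prop) (x y : pt -> R)
    (inv : R -> R -> pt) (u v : R) : Prop :=
  dom (inv u v) /\ x (inv u v) = u /\ y (inv u v) = v.

Record surface := Surface {
  point : Type;
  chart : Type;
  cdom : chart -> point -> Prop;
  cx : chart -> point -> R;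
  cy : chart -> point -> R;
  cinv : chart -> R -> R -> point;
  chart_at : point -> chart;
  chart_atP : forall P, cdom (chart_at P) P;
  cinvK : forall i P, cdom i P -> cinv i (cx i P) (cy i P) = P;
  (* for [i = j]: the image of a chart is open in the plane *)
  overlap_open : forall i j u v,
    in_image (cdom i) (cx i) (cy i) (cinv i) u v -> cdom j (cinv i u v) ->
    locally_2d (fun u' v' =>
      in_image (cdom i) (cx i) (cy i) (cinv i) u' v' /\ cdom j (cinv i u' v'))
      u v;
  transition_C4 : forall i j u v,
    in_image (cdom i) (cx i) (cy i) (cinv i) u v -> cdom j (cinv i u v) ->
    ex_diff_n (fun u' v' => cx j (cinv i u' v')) 4 u v /\
    ex_diff_n (fun u' v' => cy j (cinv i u' v')) 4 u v;
  hausdorff : forall P Q i j, cdom i P -> cdom j Q -> P <> Q ->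
    exists e : posreal, forall X,
      cdom i X -> Rabs (cx i X - cx i P) < e -> Rabs (cy i X - cy i P) < e ->
      cdom j X -> Rabs (cx j X - cx j Q) < e -> Rabs (cy j X - cy j Q) < e ->
      False
}.

Definition cimg (S : surface) (i : chart S) : R -> R -> Prop :=
  in_image (cdom S i) (cx S i) (cy S i) (cinv S i).

Arguments cdom {s} _ _.
Arguments cx {s} _ _.
Arguments cy {s} _ _.
Arguments cinv {s} _ _ _.
Arguments chart_at {s} _.

(** * C^3 Riemannian metrics *)

Definition du (f : R -> R -> R) (u v : R) : R := Derive (fun z => f z v) u.
Definition dv (f : R -> R -> R) (u v : R) : R := Derive (fun z => f u z) v.

Definition quad (E F G a b : R) : R := E * a ^ 2 + 2 * F * a * b + G * b ^ 2.

(** In the chart [i] the metric is E du^2 + 2 F du dv + G dv^2. *)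
Record metric (S : surface) := Metric {
  gE : chart S -> R -> R -> R;
  gF : chart S -> R -> R -> R;
  gG : chart S -> R -> R -> R;
  metric_C3 : forall i u v, cimg S i u v ->
    ex_diff_n (gE i) 3 u v /\ ex_diff_n (gF i) 3 u v /\ ex_diff_n (gG i) 3 u v;
  metric_pos : forall i u v, cimg S i u v ->
    0 < gE i u v /\ 0 < gE i u v * gG i u v - gF i u v ^ 2;
  metric_compat : forall i j u v, cimg S i u v -> cdom j (cinv i u v) ->
    let X := fun u' v' => cx j (cinv i u' v') in
    let Y := fun u' v' => cy j (cinv i u' v') in
    forall a b,
      quad (gE i u v) (gF i u v) (gG i u v) a b =
      quad (gE j (X u v) (Y u v)) (gF j (X u v) (Y u v)) (gG j (X u v) (Y u v))
        (du X u v * a + dv X u v * b) (du Y u v * a + dv Y u v * b)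
}.

(** * Christoffel symbols, with [chrK_IJ] for Gamma^K_IJ *)

Section Christoffel.
Variables E F G : R -> R -> R.

Definition detg (u v : R) : R := E u v * G u v - F u v ^ 2.

Definition chr1_11 u v : R :=
  (G u v * du E u v - 2 * F u v * du F u v + F u v * dv E u v)
  / (2 * detg u v).
Definition chr1_12 u v : R :=
  (G u v * dv E u v - F u v * du G u v) / (2 * detg u v).
Definition chr1_22 u v : R :=
  (2 * G u v * dv F u v - G u v * du G u v - F u v * dv G u v)
  / (2 * detg u v).
Definition chr2_11 u v : R :=
  (2 * E u v * du F u v - E u v * dv E u v - F u v * du E u v)
  / (2 * detg u v).
Definition chr2_12 u v : R :=
  (E u v * du G u v - F u v * dv E u v) / (2 * detg u v).
Definition chr2_22 u v : R :=
  (E u v * dv G u v - 2 * F u v * dv F u v + F u v * du G u v)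
  / (2 * detg u v).

End Christoffel.

(** * Curves *)

Section Curves.
Variables (S : surface) (g : metric S).

(** [c] is of class C^n on the open interval ]a, b[. *)
Definition curve_Cn (n : nat) (a b : R) (c : R -> point S) : Prop :=
  forall t, a < t < b -> forall i, cdom i (c t) ->
    locally t (fun s => cdom i (c s)) /\
    forall f, f = (fun s => cx i (c s)) \/ f = (fun s => cy i (c s)) ->
      (forall k, (k <= n)%nat -> ex_derive_n f k t) /\
      continuous (Derive_n f n) t.

Definition velx (i : chart S) (c : R -> point S) (t : R) : R :=
  Derive (fun s => cx i (c s)) t.
Definition vely (i : chart S) (c : R -> point S) (t : R) : R :=
  Derive (fun s => cy i (c s)) t.

(** Norm of the vector with coordinates (a, b) in the chart [i], based at [P]. *)
Definition norm_in (i : chart S) (P : point S) (a b : R) : R :=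
  sqrt (quad (gE g i (cx i P) (cy i P)) (gF g i (cx i P) (cy i P))
             (gG g i (cx i P) (cy i P)) a b).

Definition speed_in (i : chart S) (c : R -> point S) (t : R) : R :=
  norm_in i (c t) (velx i c t) (vely i c t).

(** By [metric_compat] the value does not depend on the chart. *)
Definition speed (c : R -> point S) (t : R) : R :=
  speed_in (chart_at (c t)) c t.

Definition arclength (c : R -> point S) (s t : R) : R :=
  Rabs (RInt (speed c) s t).

(** Coordinates, in the chart [i], of the covariant derivative along [c] of the
    vector field with coordinates [(V, W)]. *)
Definition cov1 (i : chart S) (c : R -> point S) (V W : R -> R) (t : R) : R :=
  let u := cx i (c t) in let v := cy i (c t) in
  let x' := velx i c t in let y' := vely i c t in
  Derive V t
  + chr1_11 (gE g i) (gF g i) (gG g i) u v * (x' * V t)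
  + chr1_12 (gE g i) (gF g i) (gG g i) u v * (x' * W t + y' * V t)
  + chr1_22 (gE g i) (gF g i) (gG g i) u v * (y' * W t).
Definition cov2 (i : chart S) (c : R -> point S) (V W : R -> R) (t : R) : R :=
  let u := cx i (c t) in let v := cy i (c t) in
  let x' := velx i c t in let y' := vely i c t in
  Derive W t
  + chr2_11 (gE g i) (gF g i) (gG g i) u v * (x' * V t)
  + chr2_12 (gE g i) (gF g i) (gG g i) u v * (x' * W t + y' * V t)
  + chr2_22 (gE g i) (gF g i) (gG g i) u v * (y' * W t).

(** Affinely parametrized geodesic; constant curves are not excluded here. *)
Definition geodesic (a b : R) (c : R -> point S) : Prop :=
  curve_Cn 2 a b c /\
  forall t, a < t < b -> forall i, cdom i (c t) ->
    cov1 i c (velx i c) (vely i c) t = 0 /\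
    cov2 i c (velx i c) (vely i c) t = 0.

Definition regular_curve (n : nat) (a b : R) (c : R -> point S) : Prop :=
  curve_Cn n a b c /\ forall t, a < t < b -> 0 < speed c t.

(** |nabla_T T| for the unit tangent field T = c' / |c'|, computed in the
    chart [i]. *)
Definition curvature_in (i : chart S) (c : R -> point S) (t : R) : R :=
  let T1 := fun s => velx i c s / speed_in i c s in
  let T2 := fun s => vely i c s / speed_in i c s in
  norm_in i (c t) (cov1 i c T1 T2 t) (cov2 i c T1 T2 t) / speed_in i c t.

(** [kappa t] is the geodesic curvature of [c] at [c t].  It is the unsigned
    curvature: positivity means that the curve is nowhere geodesic up to second
    order, i.e. that the signed curvature is positive for one choice of the
    normal. *)
Definition geodesic_curvature (a b : R) (c : R -> point S) (kappa : R -> R)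
    : Prop :=
  forall t, a < t < b -> forall i, cdom i (c t) ->
    kappa t = curvature_in i c t.

(** * The string construction

    Points of the curve [gam] are given by their parameters in ]a, b[, and
    [gam] is oriented by increasing parameter. *)

(** [C] lies on the geodesic tangent to [gam] at [gam s], at distance [d] from
    [gam s] along that geodesic (on either side of the tangency point). *)
Definition on_tangent_geodesic (gam : R -> point S) (s : R) (C : point S)
    (d : R) : Prop :=
  exists (c : R -> point S) (l r w : R),
    l < 0 < r /\ l < w < r /\ geodesic l r c /\
    c 0 = gam s /\
    (exists k, k <> 0 /\ forall i, cdom i (gam s) ->
       velx i c 0 = k * velx i gam s /\ vely i c 0 = k * vely i gam s) /\
    c w = C /\ d = arclength c 0 w.

(** L(A, B) = q for A = [gam s], B = [gam t]: the tangent geodesics at A and B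
    meet at a point C, and |AC| + |BC| - lambda(A, B) = q.  The number [delta]
    makes "close" and "nearby" precise; C is unique once [delta] is small. *)
Definition string_L (delta : R) (gam : R -> point S) (s t q : R) : Prop :=
  arclength gam s t < delta /\
  exists (C : point S) (d1 d2 : R),
    on_tangent_geodesic gam s C d1 /\ d1 < delta /\
    on_tangent_geodesic gam t C d2 /\ d2 < delta /\
    q = d1 + d2 - arclength gam s t.

(** [T p] is the p-th string map of the germ [gam].  Near the ends of ]a, b[
    the point following A may fail to exist, so that [T p A] is prescribed on
    every compact subarc, for all [p] small enough depending on the subarc. *)
Definition string_family (delta a b : R) (gam : R -> point S)
    (T : R -> R -> R) : Prop :=
  forall c d, a < c -> c <= d -> d < b ->
  exists p1, 0 < p1 /\
  forall p, 0 < p < p1 -> forall s, c <= s <= d ->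
    s < T p s < b /\ string_L delta gam s (T p s) p.

End Curves.

(* Main.v *)
From Stdlib Require Import Lra Lia Psatz Classical.
Require Import Defs.

(** All steps of the orbit have the same defect [L = p], so it is enough to
    show that [L(A, B) = kappa(A)^2 lambda^3 / 12 + o(lambda^3)] uniformly:
    both sides of the claim are then equivalent to [(12 p)^(1/3)].

    In a chart put [D = X - A] and [Y = D + Gamma_A(D, D) / 2], so that a
    geodesic close to [A] satisfies [Y'' = O(|D|)], with an explicit Lipschitz
    right-hand side.  Rescale the tangent geodesics at [A] and [B] to [[0, 1]],
    with signed lengths [w1] and [w2], so that both arrive at [C] at time 1.
    Their difference solves a second-order equation close to [Z'' = 0] with
    [Z(1) = 0]; this forces [w1 T_A - w2 T_B = Y(B)] up to a small error, whence
    the uniqueness of [C] and [w1 ~ lambda / 2 ~ - w2].  Since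
    [L = w1 - w2 - lambda] has order [lambda^3], its principal part is then read
    off a second-order expansion of the height [<T_A, Y>] along the arc and
    along the two geodesics: up to [O(lambda^2)] all three second derivatives
    contain the same function of the abscissa, which cancels, and the arc has
    the additional term [- kappa^2 r].  Only bounds on given solutions are used,
    never the dependence of solutions on parameters. *)

(** The coordinates Y are normal at A only to second order, so the height has a second derivative of
    order [lam] on each of the three paths. The equation that closes the triangle is vectorial.
    Paired with the tangent it determines w1 - w2; paired with the acceleration, whose squared norm
    kappa^2 is bounded below, it determines w2. The coefficient 1/12 is 1/4 - 1/6: the loss of slope
    of the height at B, acting over the length lam / 2, against the loss of height. Two
    circularities shape the rest. The tangent segments are known in advance to be short, but not to
    be of order [lam], so the closing estimates are run twice. And the closeness [delta] is fixed
    before the precision [eps], so a crude estimate must first show that a small p forces a short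
    arc. Finally a tangent geodesic is only a map to an abstract surface: before any computation it
    has to be shown to stay in one chart. *)

Lemma Rabs_plus_le (x y a b : R) :
  Rabs x <= a -> Rabs y <= b -> Rabs (x + y) <= a + b.
Proof. intros; pose proof (Rabs_triang x y); lra. Qed.

Lemma Rabs_minus_le (x y a b : R) :
  Rabs x <= a -> Rabs y <= b -> Rabs (x - y) <= a + b.
Proof. intros; apply Rabs_plus_le; rewrite ?Rabs_Ropp; assumption. Qed.

Lemma Rabs_mult_le (x y a b : R) :
  Rabs x <= a -> Rabs y <= b -> Rabs (x * y) <= a * b.
Proof.
intros; rewrite Rabs_mult; apply Rmult_le_compat; auto using Rabs_pos.
Qed.

Lemma Rabs_nonneg_bound (x a : R) : Rabs x <= a -> 0 <= a.
Proof. pose proof (Rabs_pos x); lra. Qed.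

(** [auto_derive] leaves terms [Derive f r] in the value; they are replaced by the derivatives
    available as [is_derive] hypotheses before [ring] is tried. *)
Ltac solve_derive :=
  auto_derive;
  [ repeat split; try exact I; try (eexists; eassumption)
  | repeat match goal with
    | H : is_derive ?f ?r ?l |- context [Derive ?g ?r'] =>
        replace (Derive g r') with l
          by (symmetry; exact (is_derive_unique f r l H))
    end; try ring ].

Lemma is_derive_Rminus (f g : R -> R) (x l m : R) :
  is_derive f x l -> is_derive g x m ->
  is_derive (fun x => f x - g x) x (l - m).
Proof. intros; solve_derive. Qed.

(** * Mean value estimates *)

Lemma le_of_derive (f g f' g' : R -> R) (a b : R) : a <= b ->
  (forall x, a <= x <= b -> is_derive f x (f' x)) ->
  (forall x, a <= x <= b -> is_derive g x (g' x)) ->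
  (forall x, a <= x <= b -> f' x <= g' x) ->
  f b - f a <= g b - g a.
Proof.
intros Hab Hf Hg Hle.
assert (Hd : forall x, a <= x <= b ->
  is_derive (fun x => g x - f x) x (g' x - f' x)).
{ intros x Hx; pose proof (Hf x Hx); pose proof (Hg x Hx); solve_derive. }
destruct (MVT_gen (fun x => g x - f x) a b (fun x => g' x - f' x))
  as [c [Hc Heq]].
- rewrite Rmin_left, Rmax_right by lra; intros x Hx; apply Hd; lra.
- rewrite Rmin_left, Rmax_right by lra; intros x Hx.
  apply continuity_pt_filterlim.
  apply (ex_derive_continuous (V := R_NormedModule) (fun x => g x - f x)).
  eexists; apply Hd; lra.
- rewrite Rmin_left, Rmax_right in Hc by lra; specialize (Hle c Hc); nra.
Qed.

(** [sg] will be the speed of the arc and [rho] its arc length, so that [F1] in F' = sg F1 is the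
    derivative of [F] with respect to arc length. Estimates in arc length are thus obtained without
    reparametrizing the curve. *)
Section TimeChange.
Variables (s t : R) (sg rho : R -> R).
Hypothesis sg_ge0 : forall r, s <= r <= t -> 0 <= sg r.
Hypothesis rho_derive : forall r, s <= r <= t -> is_derive rho r (sg r).

Lemma rho_mono (r r' : R) : s <= r -> r <= r' -> r' <= t -> rho r <= rho r'.
Proof.
intros; enough (0 - 0 <= rho r' - rho r) by lra.
apply (le_of_derive (fun _ => 0) rho (fun _ => 0) sg r r'); auto.
- intros; apply (is_derive_const (K := R_AbsRing) (V := R_NormedModule)).
- intros; apply rho_derive; lra.
- intros; apply sg_ge0; lra.
Qed.

Lemma taylor1 (F F1 : R -> R) (eps : R) :
  (forall r, s <= r <= t -> is_derive F r (sg r * F1 r)) ->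
  (forall r, s <= r <= t -> Rabs (F1 r) <= eps) ->
  forall r, s <= r <= t -> Rabs (F r - F s) <= eps * (rho r - rho s).
Proof.
intros HF Heps r Hr.
assert (H1 : F r - F s <= eps * rho r - eps * rho s).
{ apply (le_of_derive F (fun r => eps * rho r) (fun r => sg r * F1 r)
    (fun r => eps * sg r) s r).
  - lra.
  - intros x Hx; apply HF; lra.
  - intros x Hx; assert (H := rho_derive x ltac:(lra)); solve_derive.
  - intros x Hx.
    pose proof (Heps x ltac:(lra)); pose proof (Rle_abs (F1 x)).
    pose proof (sg_ge0 x ltac:(lra)); nra. }
assert (H2 : - eps * rho r - - eps * rho s <= F r - F s).
{ apply (le_of_derive (fun r => - eps * rho r) F (fun r => - eps * sg r)
    (fun r => sg r * F1 r) s r).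
  - lra.
  - intros x Hx; assert (H := rho_derive x ltac:(lra)); solve_derive.
  - intros x Hx; apply HF; lra.
  - intros x Hx.
    pose proof (Heps x ltac:(lra)) as He; apply Rabs_le_between in He.
    pose proof (sg_ge0 x ltac:(lra)); nra. }
apply Rabs_le; lra.
Qed.

Lemma taylor2 (F F1 F2 : R -> R) (eps : R) :
  (forall r, s <= r <= t -> is_derive F r (sg r * F1 r)) ->
  (forall r, s <= r <= t -> is_derive F1 r (sg r * F2 r)) ->
  (forall r, s <= r <= t -> Rabs (F2 r) <= eps) ->
  forall r, s <= r <= t ->
  Rabs (F r - F s - (rho r - rho s) * F1 s) <= eps * (rho r - rho s) ^ 2.
Proof.
intros HF HF1 Heps r Hr.
assert (H1 := taylor1 F1 F2 eps HF1 Heps).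
assert (H0 : 0 <= eps) by (eapply Rabs_nonneg_bound, (Heps s); lra).
assert (Hmono : rho s <= rho r) by (apply rho_mono; lra).
assert (Hr' : s <= r) by lra.
set (G := fun x => F x - rho x * F1 s).
assert (HG : forall x, s <= x <= r ->
  is_derive G x (sg x * (F1 x - F1 s))).
{ intros x Hx; unfold G.
  pose proof (HF x ltac:(lra)); pose proof (rho_derive x ltac:(lra)).
  solve_derive. }
(* On [s, r] the first-order bound is replaced by its largest value, a constant; this costs the
   factor 1/2 of Taylor's formula. *)
assert (HB : forall x, s <= x <= r ->
  Rabs (F1 x - F1 s) <= eps * (rho r - rho s)).
{ intros x Hx; eapply Rle_trans; [apply H1; lra|].
  apply Rmult_le_compat_l; [lra|].
  assert (rho x <= rho r) by (apply rho_mono; lra); lra. }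
assert (Hb : forall r', s <= r' <= r -> 0 <= sg r').
{ intros; apply sg_ge0; lra. }
enough (Rabs (G r - G s) <= eps * (rho r - rho s) * (rho r - rho s)).
{ unfold G in *. replace (F r - F s - (rho r - rho s) * F1 s) with
    (F r - rho r * F1 s - (F s - rho s * F1 s)) by ring; lra. }
clear HF HF1 Heps H1.
assert (HU : G r - G s <= eps * (rho r - rho s) * rho r
  - eps * (rho r - rho s) * rho s).
{ apply (le_of_derive G (fun x => eps * (rho r - rho s) * rho x)
    (fun x => sg x * (F1 x - F1 s))
    (fun x => eps * (rho r - rho s) * sg x)); auto.
  - intros x Hx; pose proof (rho_derive x ltac:(lra)); solve_derive.
  - intros x Hx; pose proof (HB x Hx) as Hx'; apply Rabs_le_between in Hx'.
    pose proof (Hb x Hx); nra. }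
assert (HL : - (eps * (rho r - rho s)) * rho r
  - - (eps * (rho r - rho s)) * rho s <= G r - G s).
{ apply (le_of_derive (fun x => - (eps * (rho r - rho s)) * rho x) G
    (fun x => - (eps * (rho r - rho s)) * sg x)
    (fun x => sg x * (F1 x - F1 s))); auto.
  - intros x Hx; pose proof (rho_derive x ltac:(lra)); solve_derive.
  - intros x Hx; pose proof (HB x Hx) as Hx'; apply Rabs_le_between in Hx'.
    pose proof (Hb x Hx); nra. }
apply Rabs_le; lra.
Qed.

End TimeChange.

(** * Connection components as fields of quadratic forms, and the residue *)

Record qfield := QField { qa : R -> R -> R; qb : R -> R -> R; qc : R -> R -> R }.

(** A [qfield] is a field of symmetric bilinear forms on the plane. It represents one component
    Gamma^k of a connection, and [ev] is Gamma^k(v, w) at the point (x, y). *)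
Definition ev (B : qfield) (x y v1 v2 w1 w2 : R) : R :=
  qa B x y * (v1 * w1) + qb B x y * (v1 * w2 + v2 * w1) + qc B x y * (v2 * w2).

(** One constant serves as bound and as Lipschitz constant, on the whole plane, so that the
    estimates carry no domain condition; [clamp2] below makes this possible. *)
Definition bounded_lip (M : R) (f : R -> R -> R) : Prop :=
  (forall x y, Rabs (f x y) <= M) /\
  forall x y x' y',
    Rabs (f x y - f x' y') <= M * (Rabs (x - x') + Rabs (y - y')).

Definition qbounded_lip (M : R) (B : qfield) : Prop :=
  bounded_lip M (qa B) /\ bounded_lip M (qb B) /\ bounded_lip M (qc B).

(** Second derivative of the coordinate [D_k + B(A; D, D) / 2], where
    [D = X - A] and [B] is the [k]-th of [B1] and [B2], along a geodesic of the
    connection [(B1, B2)] with position [X] and velocity [V]. *)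
Definition residue (B1 B2 B : qfield) (xA yA x y v1 v2 : R) : R :=
  ev B xA yA v1 v2 v1 v2 - ev B x y v1 v2 v1 v2
  - ev B xA yA (x - xA) (y - yA)
      (ev B1 x y v1 v2 v1 v2) (ev B2 x y v1 v2 v1 v2).

Lemma form_bound (a b c v1 v2 w1 w2 al om om' : R) :
  Rabs a <= al -> Rabs b <= al -> Rabs c <= al ->
  Rabs v1 <= om -> Rabs v2 <= om -> Rabs w1 <= om' -> Rabs w2 <= om' ->
  Rabs (a * (v1 * w1) + b * (v1 * w2 + v2 * w1) + c * (v2 * w2))
  <= 4 * al * om * om'.
Proof.
intros; replace (4 * al * om * om') with
  (al * (om * om') + al * (om * om' + om * om') + al * (om * om')) by ring.
repeat first [apply Rabs_plus_le | apply Rabs_mult_le]; assumption.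
Qed.

Lemma ev_bound (M : R) (B : qfield) (x y v1 v2 w1 w2 om om' : R) :
  qbounded_lip M B ->
  Rabs v1 <= om -> Rabs v2 <= om -> Rabs w1 <= om' -> Rabs w2 <= om' ->
  Rabs (ev B x y v1 v2 w1 w2) <= 4 * M * om * om'.
Proof. intros [[Ha _] [[Hb _] [Hc _]]] **; apply form_bound; auto. Qed.

Lemma ev_diff_bound (M : R) (B : qfield) (x y x' y' v1 v2 w1 w2 e om om' : R) :
  0 <= M -> qbounded_lip M B ->
  Rabs (x - x') <= e -> Rabs (y - y') <= e ->
  Rabs v1 <= om -> Rabs v2 <= om -> Rabs w1 <= om' -> Rabs w2 <= om' ->
  Rabs (ev B x y v1 v2 w1 w2 - ev B x' y' v1 v2 w1 w2) <= 8 * M * e * om * om'.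
Proof.
intros HM [[_ Ha] [[_ Hb] [_ Hc]]] **.
replace (ev B x y v1 v2 w1 w2 - ev B x' y' v1 v2 w1 w2) with
  ((qa B x y - qa B x' y') * (v1 * w1)
   + (qb B x y - qb B x' y') * (v1 * w2 + v2 * w1)
   + (qc B x y - qc B x' y') * (v2 * w2)) by (unfold ev; ring).
replace (8 * M * e * om * om') with (4 * (M * (e + e)) * om * om') by ring.
assert (M * (Rabs (x - x') + Rabs (y - y')) <= M * (e + e))
  by (apply Rmult_le_compat_l; lra).
apply form_bound; auto; eapply Rle_trans; eauto.
Qed.

Lemma ev_vel_diff_bound (M : R) (B : qfield)
    (x y x' y' v1 v2 v1' v2' e e' om : R) :
  0 <= M -> qbounded_lip M B ->
  Rabs (x - x') <= e -> Rabs (y - y') <= e ->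
  Rabs (v1 - v1') <= e' -> Rabs (v2 - v2') <= e' ->
  Rabs v1 <= om -> Rabs v2 <= om -> Rabs v1' <= om -> Rabs v2' <= om ->
  Rabs (ev B x y v1 v2 v1 v2 - ev B x' y' v1' v2' v1' v2')
  <= 8 * M * (e * om ^ 2 + om * e').
Proof.
intros.
(* After the change of base point, polarization: Gamma(v, v) - Gamma(v', v') = Gamma(v, v - v') +
   Gamma(v', v - v'). *)
replace (ev B x y v1 v2 v1 v2 - ev B x' y' v1' v2' v1' v2') with
  ((ev B x y v1 v2 v1 v2 - ev B x' y' v1 v2 v1 v2)
   + (ev B x' y' v1 v2 (v1 - v1') (v2 - v2')
      + ev B x' y' v1' v2' (v1 - v1') (v2 - v2'))) by (unfold ev; ring).
replace (8 * M * (e * om ^ 2 + om * e')) with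
  (8 * M * e * om * om + (4 * M * om * e' + 4 * M * om * e')) by ring.
repeat apply Rabs_plus_le;
  first [apply ev_diff_bound | apply ev_bound]; assumption.
Qed.

(** The residue vanishes at A for every velocity, so a change of velocity costs a factor [d], the
    distance to A; without this factor the remainder in [closing_gap] would lose an order. The
    constant 56 = 8 + 16 + 32 collects the coefficients of e om^2. *)
Lemma residue_diff_bound (M : R) (B1 B2 B : qfield)
    (xA yA x y x' y' v1 v2 v1' v2' d e e' om : R) :
  1 <= M -> d <= 1 ->
  qbounded_lip M B1 -> qbounded_lip M B2 -> qbounded_lip M B ->
  Rabs (x - xA) <= d -> Rabs (y - yA) <= d ->
  Rabs (x' - xA) <= d -> Rabs (y' - yA) <= d ->
  Rabs (x - x') <= e -> Rabs (y - y') <= e ->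
  Rabs (v1 - v1') <= e' -> Rabs (v2 - v2') <= e' ->
  Rabs v1 <= om -> Rabs v2 <= om -> Rabs v1' <= om -> Rabs v2' <= om ->
  Rabs (residue B1 B2 B xA yA x y v1 v2
        - residue B1 B2 B xA yA x' y' v1' v2')
  <= 56 * M ^ 2 * (om ^ 2 * e + d * om * e').
Proof.
intros.
assert (Hd : 0 <= d) by (eapply Rabs_nonneg_bound; eassumption).
assert (He : 0 <= e) by (eapply Rabs_nonneg_bound; eassumption).
assert (He' : 0 <= e') by (eapply Rabs_nonneg_bound; eassumption).
assert (Hom : 0 <= om) by (eapply Rabs_nonneg_bound; eassumption).
assert (Hx : Rabs (xA - x') <= d) by (rewrite Rabs_minus_sym; assumption).
assert (Hy : Rabs (yA - y') <= d) by (rewrite Rabs_minus_sym; assumption).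
assert (Hx' : Rabs (x' - x) <= e) by (rewrite Rabs_minus_sym; assumption).
assert (Hy' : Rabs (y' - y) <= e) by (rewrite Rabs_minus_sym; assumption).
set (S1 := ev B1 x y v1 v2 v1 v2); set (S2 := ev B2 x y v1 v2 v1 v2).
set (S1' := ev B1 x' y' v1' v2' v1' v2').
set (S2' := ev B2 x' y' v1' v2' v1' v2').
assert (HS1 : Rabs S1 <= 4 * M * om * om) by (apply ev_bound; assumption).
assert (HS2 : Rabs S2 <= 4 * M * om * om) by (apply ev_bound; assumption).
assert (HD1 : Rabs (S1 - S1') <= 8 * M * (e * om ^ 2 + om * e'))
  by (apply ev_vel_diff_bound; lra || assumption).
assert (HD2 : Rabs (S2 - S2') <= 8 * M * (e * om ^ 2 + om * e'))
  by (apply ev_vel_diff_bound; lra || assumption).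
replace (residue B1 B2 B xA yA x y v1 v2
         - residue B1 B2 B xA yA x' y' v1' v2') with
  ((ev B x' y' v1 v2 v1 v2 - ev B x y v1 v2 v1 v2)
   + ((ev B xA yA v1 v2 (v1 - v1') (v2 - v2')
       - ev B x' y' v1 v2 (v1 - v1') (v2 - v2'))
      + (ev B xA yA v1' v2' (v1 - v1') (v2 - v2')
         - ev B x' y' v1' v2' (v1 - v1') (v2 - v2')))
   - (ev B xA yA (x - x') (y - y') S1 S2
      + ev B xA yA (x' - xA) (y' - yA) (S1 - S1') (S2 - S2')))
  by (unfold residue; fold S1 S2 S1' S2'; unfold ev; ring).
apply Rle_trans with
  (8 * M * e * om * om
   + (8 * M * d * om * e' + 8 * M * d * om * e')
   + (4 * M * e * (4 * M * om * om)
      + 4 * M * d * (8 * M * (e * om ^ 2 + om * e')))).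
{ apply Rabs_minus_le; [apply Rabs_plus_le; [|apply Rabs_plus_le]
  |apply Rabs_plus_le];
  first [apply ev_diff_bound | apply ev_bound]; lra || assumption. }
assert (0 <= e * om ^ 2) by (apply Rmult_le_pos; nra).
assert (0 <= d * om * e') by (repeat apply Rmult_le_pos; lra).
assert (0 <= om * e') by nra.
assert (HM2 : M <= M ^ 2) by nra.
assert (E1 : M * (e * om ^ 2) <= M ^ 2 * (e * om ^ 2)) by nra.
assert (E2 : M * (d * om * e') <= M ^ 2 * (d * om * e')) by nra.
assert (E3 : M ^ 2 * (d * (e * om ^ 2)) <= M ^ 2 * (1 * (e * om ^ 2)))
  by (apply Rmult_le_compat_l; nra).
assert (0 <= M ^ 2 * (d * om * e')) by nra.
nra.
Qed.

Lemma residue_bound (M : R) (B1 B2 B : qfield) (xA yA x y v1 v2 d om : R) :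
  1 <= M -> d <= 1 ->
  qbounded_lip M B1 -> qbounded_lip M B2 -> qbounded_lip M B ->
  Rabs (x - xA) <= d -> Rabs (y - yA) <= d -> Rabs v1 <= om -> Rabs v2 <= om ->
  Rabs (residue B1 B2 B xA yA x y v1 v2) <= 56 * M ^ 2 * (om ^ 2 * d).
Proof.
intros.
assert (Hd : 0 <= d) by (eapply Rabs_nonneg_bound; eassumption).
replace (residue B1 B2 B xA yA x y v1 v2) with
  (residue B1 B2 B xA yA x y v1 v2 - residue B1 B2 B xA yA xA yA v1 v2)
  by (unfold residue, ev; ring).
replace (om ^ 2 * d) with (om ^ 2 * d + d * om * 0) by ring.
apply residue_diff_bound; auto; unfold Rminus; rewrite ?Rplus_opp_r, ?Rabs_R0;
  lra.
Qed.

Lemma residue_scal (B1 B2 B : qfield) (xA yA x y v1 v2 w : R) :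
  residue B1 B2 B xA yA x y (w * v1) (w * v2)
  = w ^ 2 * residue B1 B2 B xA yA x y v1 v2.
Proof. unfold residue, ev; ring. Qed.

(** The initial velocities are unknown; only the end value 0 is prescribed. By the mean value
    theorem each velocity takes the value - z(0) somewhere, so velocity and position are at most
    |z(0)| plus [eps] times the maximum S of the sum. Adding the four bounds gives S <= 2 (|z1(0)| +
    |z2(0)|) + 4 eps S, and eps <= 1/8 absorbs the last term. *)
Lemma boundary_bound (z1 z2 u1 u2 f1 f2 : R -> R) (eps : R) :
  0 <= eps <= / 8 ->
  (forall r, 0 <= r <= 1 -> is_derive z1 r (u1 r)) ->
  (forall r, 0 <= r <= 1 -> is_derive z2 r (u2 r)) ->
  (forall r, 0 <= r <= 1 -> is_derive u1 r (f1 r)) ->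
  (forall r, 0 <= r <= 1 -> is_derive u2 r (f2 r)) ->
  (forall r, 0 <= r <= 1 -> Rabs (f1 r) <=
     eps * (Rabs (z1 r) + Rabs (z2 r) + Rabs (u1 r) + Rabs (u2 r))) ->
  (forall r, 0 <= r <= 1 -> Rabs (f2 r) <=
     eps * (Rabs (z1 r) + Rabs (z2 r) + Rabs (u1 r) + Rabs (u2 r))) ->
  z1 1 = 0 -> z2 1 = 0 ->
  forall r, 0 <= r <= 1 ->
  Rabs (z1 r) + Rabs (z2 r) + Rabs (u1 r) + Rabs (u2 r)
  <= 4 * (Rabs (z1 0) + Rabs (z2 0)).
Proof.
intros Heps Hz1 Hz2 Hu1 Hu2 Hf1 Hf2 E1 E2.
set (S := fun r => Rabs (z1 r) + Rabs (z2 r) + Rabs (u1 r) + Rabs (u2 r)).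
assert (Hc : forall f f' : R -> R,
  (forall r, 0 <= r <= 1 -> is_derive f r (f' r)) ->
  forall r, 0 <= r <= 1 -> continuity_pt f r).
{ intros f f' Hf r Hr; apply continuity_pt_filterlim.
  apply (ex_derive_continuous (V := R_NormedModule) f).
  eexists; apply Hf, Hr. }
assert (Ha : forall f f' : R -> R,
  (forall r, 0 <= r <= 1 -> is_derive f r (f' r)) ->
  forall r, 0 <= r <= 1 -> continuity_pt (fun r => Rabs (f r)) r).
{ intros f f' Hf r Hr; apply (continuity_pt_comp f Rabs).
  - eapply Hc; eauto.
  - apply Rcontinuity_abs. }
destruct (continuity_ab_maj S 0 1) as [m [Hm Hm01]]; [lra| |].
{ intros r Hr; unfold S.
  repeat apply continuity_pt_plus; eapply Ha; eauto. }
assert (key : forall z u f : R -> R,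
  (forall r, 0 <= r <= 1 -> is_derive z r (u r)) ->
  (forall r, 0 <= r <= 1 -> is_derive u r (f r)) ->
  (forall r, 0 <= r <= 1 -> Rabs (f r) <= eps * S r) -> z 1 = 0 ->
  forall r, 0 <= r <= 1 ->
  Rabs (u r) <= Rabs (z 0) + eps * S m /\ Rabs (z r) <= Rabs (z 0) + eps * S m).
{ intros z u f Hz Hu Hf Hz1'.
  assert (Hfm : forall r, 0 <= r <= 1 -> Rabs (f r) <= eps * S m).
  { intros r Hr; eapply Rle_trans; [apply Hf, Hr|].
    apply Rmult_le_compat_l; [lra|]; auto. }
  assert (Hdu : forall r r', 0 <= r <= 1 -> 0 <= r' <= 1 ->
    Rabs (u r - u r') <= eps * S m).
  { intros r r' Hr Hr'.
    destruct (MVT_gen u r' r f) as [c [Hc' Heq]].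
    - intros x Hx; apply Hu.
      unfold Rmin, Rmax in Hx; destruct (Rle_dec r' r); lra.
    - intros x Hx; eapply Hc; eauto.
      unfold Rmin, Rmax in Hx; destruct (Rle_dec r' r); lra.
    - rewrite Heq.
      assert (0 <= c <= 1)
        by (unfold Rmin, Rmax in Hc'; destruct (Rle_dec r' r); lra).
      replace (eps * S m) with (eps * S m * 1) by ring.
      apply Rabs_mult_le; auto; apply Rabs_le; lra. }
  destruct (MVT_gen z 0 1 u) as [c [Hc' Heq]].
  { intros x; rewrite Rmin_left, Rmax_right by lra; intros; apply Hz; lra. }
  { intros x; rewrite Rmin_left, Rmax_right by lra; intros; eapply Hc; eauto. }
  rewrite Rmin_left, Rmax_right in Hc' by lra.
  assert (Huc : u c = - z 0) by lra.
  assert (Hu' : forall r, 0 <= r <= 1 -> Rabs (u r) <= Rabs (z 0) + eps * S m).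
  { intros r Hr; replace (u r) with (- z 0 + (u r - u c)) by lra.
    apply Rabs_plus_le; [rewrite Rabs_Ropp; lra | auto]. }
  intros r Hr; split; [auto|].
  destruct (MVT_gen z r 1 u) as [c' [Hc'' Heq']].
  { intros x; rewrite Rmin_left, Rmax_right by lra; intros; apply Hz; lra. }
  { intros x; rewrite Rmin_left, Rmax_right by lra; intros; eapply Hc; eauto.
    lra. }
  rewrite Rmin_left, Rmax_right in Hc'' by lra.
  replace (z r) with (- (u c' * (1 - r))) by lra.
  rewrite Rabs_Ropp.
  replace (Rabs (z 0) + eps * S m) with ((Rabs (z 0) + eps * S m) * 1) by ring.
  apply Rabs_mult_le; [apply Hu'; lra | apply Rabs_le; lra]. }
assert (K1 := key z1 u1 f1 Hz1 Hu1 Hf1 E1).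
assert (K2 := key z2 u2 f2 Hz2 Hu2 Hf2 E2).
assert (HS : S m <= 2 * (Rabs (z1 0) + Rabs (z2 0)) + 4 * eps * S m).
{ destruct (K1 m Hm01), (K2 m Hm01); unfold S at 1; lra. }
assert (0 <= S m).
{ unfold S; repeat apply Rplus_le_le_0_compat; apply Rabs_pos. }
intros r Hr; apply Rle_trans with (S m); [apply (Hm r Hr)|]; nra.
Qed.

Lemma twice_primitive (h : R -> R) :
  (forall r, continuous h r) ->
  exists phi phi1 : R -> R,
    (forall r, is_derive phi r (phi1 r)) /\
    (forall r, is_derive phi1 r (h r)) /\ phi 0 = 0 /\ phi1 0 = 0.
Proof.
intros Hh.
assert (prim : forall f : R -> R, (forall r, continuous f r) ->
  forall r, is_derive (fun r => RInt f 0 r) r (f r)).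
{ intros f Hf r; apply is_derive_RInt with (a := 0); [|apply Hf].
  apply filter_forall; intros x.
  apply (RInt_correct (V := R_CompleteNormedModule)).
  apply (ex_RInt_continuous (V := R_CompleteNormedModule)); auto. }
assert (H1 := prim h Hh); set (phi1 := fun r => RInt h 0 r) in *.
assert (H2 : forall r, continuous phi1 r).
{ intros r; apply (ex_derive_continuous (V := R_NormedModule) phi1).
  eexists; apply H1. }
exists (fun r => RInt phi1 0 r), phi1; split; [apply prim, H2|].
split; [exact H1|]; unfold phi1; rewrite !RInt_point; auto.
Qed.

(** * Coordinates that are normal to second order at a point *)

Section Coordinates.
Variables (B1 B2 B : qfield) (xA yA zA : R).

(** [z] is the coordinate, x or y, whose Christoffel component is [B], and [zA] is its value at A.
    The formula is the second-order expansion at A of geodesic normal coordinates. *)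
Definition coord (x y z : R) : R :=
  z - zA + ev B xA yA (x - xA) (y - yA) (x - xA) (y - yA) / 2.
Definition coord' (x y v1 v2 w : R) : R :=
  w + ev B xA yA (x - xA) (y - yA) v1 v2.

Variables (x y z v1 v2 w : R -> R) (r sg a1 a2 az : R).
Hypotheses (Hx : is_derive x r (sg * v1 r)) (Hy : is_derive y r (sg * v2 r))
  (Hz : is_derive z r (sg * w r)).

Lemma coord_derive :
  is_derive (fun r => coord (x r) (y r) (z r)) r
    (sg * coord' (x r) (y r) (v1 r) (v2 r) (w r)).
Proof. unfold coord, coord', ev; solve_derive; field. Qed.

Let acc (C : qfield) := ev C (x r) (y r) (v1 r) (v2 r) (v1 r) (v2 r).
Hypotheses (Hv1 : is_derive v1 r (sg * (- acc B1 + a1)))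
  (Hv2 : is_derive v2 r (sg * (- acc B2 + a2)))
  (Hw : is_derive w r (sg * (- acc B + az))).

(** [a1], [a2], [az] are components of the covariant acceleration. They vanish along a geodesic,
    where only the residue remains; along the arc they enter through the differential of the
    coordinate, az + Gamma_A(D, a). *)
Lemma coord'_derive :
  is_derive (fun r => coord' (x r) (y r) (v1 r) (v2 r) (w r)) r
    (sg * (residue B1 B2 B xA yA (x r) (y r) (v1 r) (v2 r) + az
           + ev B xA yA (x r - xA) (y r - yA) a1 a2)).
Proof. unfold coord', residue, acc, ev in *; solve_derive. Qed.

End Coordinates.

(** The parametrization by [[0, 1]] is affine: the speed is the length. *)
Definition unit_geodesic (B1 B2 : qfield) (X Y U V : R -> R) : Prop :=
  forall r, 0 <= r <= 1 ->
    is_derive X r (U r) /\ is_derive Y r (V r) /\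
    is_derive U r (- ev B1 (X r) (Y r) (U r) (V r) (U r) (V r)) /\
    is_derive V r (- ev B2 (X r) (Y r) (U r) (V r) (U r) (V r)).

(** * A priori bounds along geodesics *)

Lemma unit_taylor1 (F F1 : R -> R) (eps : R) :
  (forall r, 0 <= r <= 1 -> is_derive F r (F1 r)) ->
  (forall r, 0 <= r <= 1 -> Rabs (F1 r) <= eps) ->
  forall r, 0 <= r <= 1 -> Rabs (F r - F 0) <= eps.
Proof.
intros HF Heps r Hr.
assert (0 <= eps) by (eapply Rabs_nonneg_bound, (Heps 0); lra).
eapply Rle_trans;
  [apply (taylor1 0 1 (fun _ => 1) (fun r => r)) with (F1 := F1) (eps := eps)|];
  auto.
- intros; lra.
- intros; apply (is_derive_id (K := R_AbsRing)).
- intros; rewrite Rmult_1_l; auto.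
- cbv beta; nra.
Qed.

Lemma unit_taylor2 (F F1 F2 : R -> R) (eps : R) :
  (forall r, 0 <= r <= 1 -> is_derive F r (F1 r)) ->
  (forall r, 0 <= r <= 1 -> is_derive F1 r (F2 r)) ->
  (forall r, 0 <= r <= 1 -> Rabs (F2 r) <= eps) ->
  forall r, 0 <= r <= 1 -> Rabs (F r - F 0 - r * F1 0) <= eps.
Proof.
intros HF HF1 Heps r Hr.
assert (0 <= eps) by (eapply Rabs_nonneg_bound, (Heps 0); lra).
replace (r * F1 0) with ((r - 0) * F1 0) by ring.
eapply Rle_trans;
  [apply (taylor2 0 1 (fun _ => 1) (fun r => r)) with (F2 := F2) (eps := eps)|];
  auto.
- intros; lra.
- intros; apply (is_derive_id (K := R_AbsRing)).
- intros; rewrite Rmult_1_l; auto.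
- intros; rewrite Rmult_1_l; auto.
- assert (r ^ 2 <= 1) by nra; rewrite Rminus_0_r; nra.
Qed.

Section Geodesic.
Variables (M : R) (B1 B2 : qfield).
Hypotheses (HM : 1 <= M) (HB1 : qbounded_lip M B1) (HB2 : qbounded_lip M B2).
Variables (X Y U V : R -> R) (om : R).
Hypotheses (Hgeo : unit_geodesic B1 B2 X Y U V)
  (HU : forall r, 0 <= r <= 1 -> Rabs (U r) <= om)
  (HV : forall r, 0 <= r <= 1 -> Rabs (V r) <= om).

Lemma geodesic_C0 r : 0 <= r <= 1 ->
  Rabs (X r - X 0) <= om /\ Rabs (Y r - Y 0) <= om.
Proof.
intros Hr; split.
- apply (unit_taylor1 X U om (fun r Hr => proj1 (Hgeo r Hr)) HU); auto.
- apply (unit_taylor1 Y V om (fun r Hr => proj1 (proj2 (Hgeo r Hr))) HV); auto.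
Qed.

Lemma geodesic_C1 r : 0 <= r <= 1 ->
  Rabs (U r - U 0) <= 4 * M * om * om /\ Rabs (V r - V 0) <= 4 * M * om * om.
Proof.
intros Hr; split.
- apply (unit_taylor1 U _ (4 * M * om * om)
    (fun r Hr => proj1 (proj2 (proj2 (Hgeo r Hr))))); auto.
  intros; rewrite Rabs_Ropp; apply ev_bound; auto.
- apply (unit_taylor1 V _ (4 * M * om * om)
    (fun r Hr => proj2 (proj2 (proj2 (Hgeo r Hr))))); auto.
  intros; rewrite Rabs_Ropp; apply ev_bound; auto.
Qed.

Lemma geodesic_C2 r : 0 <= r <= 1 ->
  Rabs (X r - X 0 - r * U 0) <= 4 * M * om * om /\
  Rabs (Y r - Y 0 - r * V 0) <= 4 * M * om * om.
Proof.
intros Hr; split.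
- apply (unit_taylor2 X U _ (4 * M * om * om) (fun r Hr => proj1 (Hgeo r Hr))
    (fun r Hr => proj1 (proj2 (proj2 (Hgeo r Hr))))); auto.
  intros; rewrite Rabs_Ropp; apply ev_bound; auto.
- apply (unit_taylor2 Y V _ (4 * M * om * om)
    (fun r Hr => proj1 (proj2 (Hgeo r Hr)))
    (fun r Hr => proj2 (proj2 (proj2 (Hgeo r Hr))))); auto.
  intros; rewrite Rabs_Ropp; apply ev_bound; auto.
Qed.

Lemma geodesic_coord (B : qfield) (xA yA zA : R) (Z W : R -> R) :
  (forall r, 0 <= r <= 1 -> is_derive Z r (W r)) ->
  (forall r, 0 <= r <= 1 ->
     is_derive W r (- ev B (X r) (Y r) (U r) (V r) (U r) (V r))) ->
  forall r, 0 <= r <= 1 ->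
  is_derive (fun r => coord B xA yA zA (X r) (Y r) (Z r)) r
    (coord' B xA yA (X r) (Y r) (U r) (V r) (W r)) /\
  is_derive (fun r => coord' B xA yA (X r) (Y r) (U r) (V r) (W r)) r
    (residue B1 B2 B xA yA (X r) (Y r) (U r) (V r)).
Proof.
intros HZ HW r Hr; destruct (Hgeo r Hr) as [D1 [D2 [D3 D4]]].
specialize (HZ r Hr); specialize (HW r Hr).
assert (E : forall a b, is_derive a r b -> is_derive a r (1 * b)).
{ intros a b; rewrite Rmult_1_l; auto. }
assert (E0 : forall a b, is_derive a r (- b) -> is_derive a r (1 * (- b + 0))).
{ intros a b; rewrite Rmult_1_l, Rplus_0_r; auto. }
split.
- rewrite <- (Rmult_1_l (coord' _ _ _ _ _ _ _ _)).
  apply coord_derive; auto.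
- replace (residue B1 B2 B xA yA (X r) (Y r) (U r) (V r)) with
    (1 * (residue B1 B2 B xA yA (X r) (Y r) (U r) (V r) + 0
          + ev B xA yA (X r - xA) (Y r - yA) 0 0)) by (unfold ev; ring).
  apply coord'_derive; auto.
Qed.

End Geodesic.

(** * The arc from A to B in a chart *)

Section Arc.
Variables (M : R) (B1 B2 : qfield).
Hypotheses (HM : 1 <= M) (HB1 : qbounded_lip M B1) (HB2 : qbounded_lip M B2).
(** [(x, y)] is the arc, [sg] its speed and [rho] its arc length; [(p, q)] is the unit tangent T and
    [(a1, a2)] the covariant acceleration a; [(P, Q)] and [(b1, b2)] are the covectors dual to T and
    a. The metric is present only through these covectors and the relations <T, T> = 1, <T, a> = 0,
    <a, a> = [k2]. [eta] bounds the oscillation of a and of its dual. *)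
Variables (s t : R) (sg rho x y p q P Q a1 a2 b1 b2 : R -> R) (k2 eta : R).
Hypotheses (Hst : s <= t)
  (Hsg : forall r, s <= r <= t -> 0 <= sg r)
  (Hrho : forall r, s <= r <= t -> is_derive rho r (sg r))
  (Hrho0 : rho s = 0).
Hypotheses
  (Hx : forall r, s <= r <= t -> is_derive x r (sg r * p r))
  (Hy : forall r, s <= r <= t -> is_derive y r (sg r * q r))
  (Hp : forall r, s <= r <= t -> is_derive p r
     (sg r * (- ev B1 (x r) (y r) (p r) (q r) (p r) (q r) + a1 r)))
  (Hq : forall r, s <= r <= t -> is_derive q r
     (sg r * (- ev B2 (x r) (y r) (p r) (q r) (p r) (q r) + a2 r)))
  (HP : forall r, s <= r <= t -> is_derive P r
     (sg r * (P r * ev B1 (x r) (y r) (p r) (q r) 1 0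
              + Q r * ev B2 (x r) (y r) (p r) (q r) 1 0 + b1 r)))
  (HQ : forall r, s <= r <= t -> is_derive Q r
     (sg r * (P r * ev B1 (x r) (y r) (p r) (q r) 0 1
              + Q r * ev B2 (x r) (y r) (p r) (q r) 0 1 + b2 r))).
Hypotheses
  (Mp : forall r, s <= r <= t -> Rabs (p r) <= M)
  (Mq : forall r, s <= r <= t -> Rabs (q r) <= M)
  (MP : forall r, s <= r <= t -> Rabs (P r) <= M)
  (MQ : forall r, s <= r <= t -> Rabs (Q r) <= M)
  (Ma1 : forall r, s <= r <= t -> Rabs (a1 r) <= M)
  (Ma2 : forall r, s <= r <= t -> Rabs (a2 r) <= M)
  (Mb1 : forall r, s <= r <= t -> Rabs (b1 r) <= M)
  (Mb2 : forall r, s <= r <= t -> Rabs (b2 r) <= M).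
Hypotheses
  (Oa1 : forall r, s <= r <= t -> Rabs (a1 r - a1 s) <= eta)
  (Oa2 : forall r, s <= r <= t -> Rabs (a2 r - a2 s) <= eta)
  (Ob1 : forall r, s <= r <= t -> Rabs (b1 r - b1 s) <= eta)
  (Ob2 : forall r, s <= r <= t -> Rabs (b2 r - b2 s) <= eta).
Hypotheses
  (Pa : forall r, s <= r <= t -> P r * a1 r + Q r * a2 r = 0)
  (Pp : P s * p s + Q s * q s = 1)
  (bp : b1 s * p s + b2 s * q s = 0)
  (ba : b1 s * a1 s + b2 s * a2 s = k2)
  (Hk2 : 1 <= M * k2).

Let lam := rho t.

Lemma eta_ge0 : 0 <= eta.
Proof. eapply Rabs_nonneg_bound, (Oa1 s); lra. Qed.

Lemma rho_bounds r : s <= r <= t -> 0 <= rho r <= lam.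
Proof.
intros Hr; rewrite <- Hrho0 at 1; split;
  eapply rho_mono with (1 := Hsg) (2 := Hrho); lra.
Qed.

Lemma lam_ge0 : 0 <= lam.
Proof. apply rho_bounds; lra. Qed.

Lemma arc_taylor1 (F F1 : R -> R) (eps : R) :
  (forall r, s <= r <= t -> is_derive F r (sg r * F1 r)) ->
  (forall r, s <= r <= t -> Rabs (F1 r) <= eps) ->
  forall r, s <= r <= t -> Rabs (F r - F s) <= eps * lam.
Proof.
intros HF He r Hr.
assert (0 <= eps) by (eapply Rabs_nonneg_bound, (He s); lra).
eapply Rle_trans; [eapply (taylor1 s t sg rho); eauto|].
rewrite Hrho0; pose proof (rho_bounds r Hr); nra.
Qed.

Lemma arc_taylor2 (F F1 F2 : R -> R) (eps : R) :
  (forall r, s <= r <= t -> is_derive F r (sg r * F1 r)) ->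
  (forall r, s <= r <= t -> is_derive F1 r (sg r * F2 r)) ->
  (forall r, s <= r <= t -> Rabs (F2 r) <= eps) ->
  forall r, s <= r <= t -> Rabs (F r - F s - rho r * F1 s) <= eps * lam ^ 2.
Proof.
intros HF HF1 He r Hr.
assert (0 <= eps) by (eapply Rabs_nonneg_bound, (He s); lra).
replace (rho r * F1 s) with ((rho r - rho s) * F1 s) by (rewrite Hrho0; ring).
eapply Rle_trans; [eapply (taylor2 s t sg rho); eauto|].
rewrite Hrho0; pose proof (rho_bounds r Hr).
apply Rmult_le_compat_l; [lra|]; apply pow_incr; lra.
Qed.

Lemma arc_C0 r : s <= r <= t ->
  Rabs (x r - x s) <= M * lam /\ Rabs (y r - y s) <= M * lam.
Proof. intros Hr; split; eapply arc_taylor1; eauto. Qed.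

Lemma acc_bound (B : qfield) r a : s <= r <= t -> qbounded_lip M B ->
  Rabs a <= M ->
  Rabs (- ev B (x r) (y r) (p r) (q r) (p r) (q r) + a) <= 5 * M ^ 3.
Proof.
intros Hr HB Ha; apply Rle_trans with (4 * M * M * M + M).
- apply Rabs_plus_le; [rewrite Rabs_Ropp; apply ev_bound|]; auto.
- assert (M ^ 1 <= M ^ 3) by (apply Rle_pow; auto; lia); lra.
Qed.

Lemma arc_C1 r : s <= r <= t ->
  Rabs (p r - p s) <= 5 * M ^ 3 * lam /\ Rabs (q r - q s) <= 5 * M ^ 3 * lam.
Proof.
intros Hr; split.
- apply (arc_taylor1 p _ _ Hp); auto; intros; apply acc_bound; auto.
- apply (arc_taylor1 q _ _ Hq); auto; intros; apply acc_bound; auto.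
Qed.

Lemma arc_C2 r : s <= r <= t ->
  Rabs (x r - x s - rho r * p s) <= 5 * M ^ 3 * lam ^ 2 /\
  Rabs (y r - y s - rho r * q s) <= 5 * M ^ 3 * lam ^ 2.
Proof.
intros Hr; split.
- apply (arc_taylor2 x p _ _ Hx Hp); auto; intros; apply acc_bound; auto.
- apply (arc_taylor2 y q _ _ Hy Hq); auto; intros; apply acc_bound; auto.
Qed.

Hypothesis Hsmall : M * lam <= 1.

Lemma lam_le1 : lam <= 1.
Proof. pose proof lam_ge0; nra. Qed.

(** Taylor's formula in arc length with the acceleration frozen at A: its variation costs [eta], and
    the residue and the term Gamma_A(D, a) are of order [lam]. *)
Lemma arc_coord (B : qfield) (z w az : R -> R) : qbounded_lip M B ->
  (forall r, s <= r <= t -> is_derive z r (sg r * w r)) ->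
  (forall r, s <= r <= t -> is_derive w r
     (sg r * (- ev B (x r) (y r) (p r) (q r) (p r) (q r) + az r))) ->
  (forall r, s <= r <= t -> Rabs (az r - az s) <= eta) ->
  Rabs (coord B (x s) (y s) (z s) (x t) (y t) (z t)
        - lam * w s - lam ^ 2 / 2 * az s)
  <= 60 * M ^ 5 * (lam + eta) * lam ^ 2 /\
  Rabs (coord' B (x s) (y s) (x t) (y t) (p t) (q t) (w t)
        - w s - lam * az s) <= 60 * M ^ 5 * (lam + eta) * lam.
Proof.
intros HB Hz Hw Oz.
set (F := fun r => coord B (x s) (y s) (z s) (x r) (y r) (z r)
  - rho r ^ 2 / 2 * az s).
set (F1 := fun r => coord' B (x s) (y s) (x r) (y r) (p r) (q r) (w r)
  - rho r * az s).
set (F2 := fun r => residue B1 B2 B (x s) (y s) (x r) (y r) (p r) (q r)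
  + (az r - az s)
  + ev B (x s) (y s) (x r - x s) (y r - y s) (a1 r) (a2 r)).
assert (HF : forall r, s <= r <= t -> is_derive F r (sg r * F1 r)).
{ intros r Hr.
  assert (H := coord_derive B (x s) (y s) (z s) x y z p q w r (sg r)
    (Hx r Hr) (Hy r Hr) (Hz r Hr)); cbv beta in H.
  pose proof (Hrho r Hr).
  unfold F, F1.
  set (C := fun r => coord B (x s) (y s) (z s) (x r) (y r) (z r)) in *.
  change (is_derive (fun r => C r - rho r ^ 2 / 2 * az s) r
    (sg r * (coord' B (x s) (y s) (x r) (y r) (p r) (q r) (w r)
             - rho r * az s))).
  solve_derive; field. }
assert (HF1 : forall r, s <= r <= t -> is_derive F1 r (sg r * F2 r)).
{ intros r Hr.
  assert (H := coord'_derive B1 B2 B (x s) (y s) x y p q w r (sg r)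
    (a1 r) (a2 r) (az r) (Hx r Hr) (Hy r Hr) (Hp r Hr) (Hq r Hr) (Hw r Hr));
    cbv beta in H.
  pose proof (Hrho r Hr).
  unfold F1, F2.
  set (C := fun r => coord' B (x s) (y s) (x r) (y r) (p r) (q r) (w r)) in *.
  change (is_derive (fun r => C r - rho r * az s) r
    (sg r * F2 r)).
  unfold F2; solve_derive. }
pose proof lam_ge0 as Hl; pose proof eta_ge0 as He.
assert (HF2 : forall r, s <= r <= t ->
  Rabs (F2 r) <= 60 * M ^ 5 * (lam + eta)).
{ intros r Hr; destruct (arc_C0 r Hr); unfold F2.
  apply Rle_trans with
    (56 * M ^ 2 * (M ^ 2 * (M * lam)) + eta + 4 * M * (M * lam) * M).
  - repeat apply Rabs_plus_le; auto.
    + apply residue_bound; auto.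
    + apply ev_bound; auto.
  - assert (M ^ 3 <= M ^ 5) by (apply Rle_pow; auto; lia).
    assert (M ^ 0 <= M ^ 5) by (apply Rle_pow; auto; lia); simpl (M ^ 0) in *.
    assert (M ^ 3 * lam <= M ^ 5 * lam) by (apply Rmult_le_compat_r; lra).
    assert (1 * eta <= M ^ 5 * eta) by (apply Rmult_le_compat_r; lra).
    lra. }
assert (Fs : F s = 0) by (unfold F, coord, ev; rewrite Hrho0; field).
assert (F1s : F1 s = w s) by (unfold F1, coord', ev; rewrite Hrho0; ring).
split.
- assert (H := arc_taylor2 F F1 F2 _ HF HF1 HF2 t ltac:(lra)).
  rewrite Fs, F1s in H; unfold F in H; fold lam in H.
  eapply Rle_trans; [|exact H]; right; f_equal; ring.
- assert (H := arc_taylor1 F1 F2 _ HF1 HF2 t ltac:(lra)).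
  rewrite F1s in H; unfold F1 in H; fold lam in H.
  eapply Rle_trans; [|exact H]; right; f_equal; ring.
Qed.

(** ** The height function *)

Let height (X Y : R) : R :=
  P s * coord B1 (x s) (y s) (x s) X Y X + Q s * coord B2 (x s) (y s) (y s) X Y Y.
Let height' (X Y U V : R) : R :=
  P s * coord' B1 (x s) (y s) X Y U V U + Q s * coord' B2 (x s) (y s) X Y U V V.
Let height'' (X Y U V : R) : R :=
  P s * residue B1 B2 B1 (x s) (y s) X Y U V
  + Q s * residue B1 B2 B2 (x s) (y s) X Y U V.
(** Along the arc and along both geodesics the second derivative of the height
    is [ref_acc], evaluated at the abscissa along the initial tangent line, up
    to the curvature term and [O(lam^2)]; [phi] below is its second primitive. *)
Let ref_acc (r : R) : R :=
  height'' (x s + r * p s) (y s + r * q s) (p s) (q s).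

Lemma height''_diff (X Y X' Y' U V U' V' d e e' om : R) : d <= 1 ->
  Rabs (X - x s) <= d -> Rabs (Y - y s) <= d ->
  Rabs (X' - x s) <= d -> Rabs (Y' - y s) <= d ->
  Rabs (X - X') <= e -> Rabs (Y - Y') <= e ->
  Rabs (U - U') <= e' -> Rabs (V - V') <= e' ->
  Rabs U <= om -> Rabs V <= om -> Rabs U' <= om -> Rabs V' <= om ->
  Rabs (height'' X Y U V - height'' X' Y' U' V')
  <= 112 * M ^ 3 * (om ^ 2 * e + d * om * e').
Proof.
intros; unfold height''.
match goal with |- Rabs (P s * ?u + Q s * ?v - (P s * ?u' + Q s * ?v')) <= _ =>
  replace (P s * u + Q s * v - (P s * u' + Q s * v')) with
    (P s * (u - u') + Q s * (v - v')) by ring end.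
replace (112 * M ^ 3 * (om ^ 2 * e + d * om * e')) with
  (M * (56 * M ^ 2 * (om ^ 2 * e + d * om * e'))
   + M * (56 * M ^ 2 * (om ^ 2 * e + d * om * e'))) by ring.
apply Rabs_plus_le; apply Rabs_mult_le;
  first [apply residue_diff_bound; assumption | apply MP; lra | apply MQ; lra].
Qed.

Lemma continuous_on_line (f : R -> R -> R) (x0 y0 u v r : R) :
  bounded_lip M f -> continuous (fun r => f (x0 + r * u) (y0 + r * v)) r.
Proof.
intros [_ Hf].
assert (HK : 0 < M * (Rabs u + Rabs v + 1)).
{ pose proof (Rabs_pos u); pose proof (Rabs_pos v); nra. }
apply continuity_pt_filterlim; intros e He.
exists (e / (M * (Rabs u + Rabs v + 1))); split.
{ apply Rdiv_lt_0_compat; lra. }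
intros r' [_ Hr']; simpl in *; unfold R_dist in *.
eapply Rle_lt_trans; [apply Hf|].
replace (x0 + r' * u - (x0 + r * u)) with ((r' - r) * u) by ring.
replace (y0 + r' * v - (y0 + r * v)) with ((r' - r) * v) by ring.
rewrite !Rabs_mult.
apply Rle_lt_trans with (Rabs (r' - r) * (M * (Rabs u + Rabs v + 1))).
- pose proof (Rabs_pos (r' - r)); nra.
- apply Rmult_lt_reg_r with (/ (M * (Rabs u + Rabs v + 1))).
  + apply Rinv_0_lt_compat; lra.
  + rewrite Rmult_assoc, Rinv_r, Rmult_1_r by lra; exact Hr'.
Qed.

Lemma ref_acc_continuous r : continuous ref_acc r.
Proof.
assert (Hline : forall x0 u r, continuous (fun r => x0 + r * u) r).
{ intros x0 u r'; apply (ex_derive_continuous (V := R_NormedModule)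
    (fun r => x0 + r * u)); auto_derive; auto. }
assert (Hcst : forall (c : R) r, continuous (fun _ : R => c) r).
{ intros; apply continuous_const. }
assert (Hp' : forall (f g : R -> R) r, continuous f r -> continuous g r ->
  continuous (fun r => f r + g r) r).
{ intros; apply (continuous_plus (V := R_NormedModule)); auto. }
assert (Hm : forall (f g : R -> R) r, continuous f r -> continuous g r ->
  continuous (fun r => f r - g r) r).
{ intros; apply (continuous_minus (V := R_NormedModule)); auto. }
assert (Ht : forall (f g : R -> R) r, continuous f r -> continuous g r ->
  continuous (fun r => f r * g r) r).
{ intros; apply (continuous_mult (K := R_AbsRing)); auto. }
assert (Hf : forall f r, bounded_lip M f ->
  continuous (fun r => f (x s + r * p s) (y s + r * q s)) r).
{ intros; apply continuous_on_line; auto. }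
destruct HB1 as [? [? ?]], HB2 as [? [? ?]].
unfold ref_acc, height'', residue, ev.
repeat match goal with
| |- continuous (fun _ => ?c) _ => apply Hcst
| |- continuous (fun r => r * _) _ => idtac
| |- continuous (fun r => @?f r - @?g r) _ => apply (Hm f g)
| |- continuous (fun r => x s + r * p s) _ => apply Hline
| |- continuous (fun r => y s + r * q s) _ => apply Hline
| |- continuous (fun r => @?f r + @?g r) _ => apply (Hp' f g)
| |- continuous (fun r => @?f r * @?g r) _ => apply (Ht f g)
| |- continuous (fun r => ?f (x s + r * p s) (y s + r * q s)) _ =>
    apply (Hf f); assumption
end.
Qed.

Section Reference.
Variables phi phi1 : R -> R.
Hypotheses (Hphi : forall r, is_derive phi r (phi1 r))
  (Hphi1 : forall r, is_derive phi1 r (ref_acc r))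
  (phi0 : phi 0 = 0) (phi10 : phi1 0 = 0).

(** [height''] vanishes at the base point, so [ref_acc] is O(lam) at abscissas up to [lam], and its
    integral is O(lam^2). *)
Lemma phi1_bound r : Rabs r <= lam -> Rabs (phi1 r) <= 112 * M ^ 6 * lam ^ 2.
Proof.
intros Hr.
pose proof lam_ge0.
destruct (MVT_gen phi1 0 r ref_acc) as [c [Hc Heq]].
- intros; apply Hphi1.
- intros; apply continuity_pt_filterlim.
  apply (ex_derive_continuous (V := R_NormedModule) phi1); eexists; apply Hphi1.
- rewrite phi10 in Heq; replace (phi1 r) with (ref_acc c * (r - 0)) by lra.
  replace (112 * M ^ 6 * lam ^ 2) with (112 * M ^ 6 * lam * lam) by ring.
  assert (Hcl : Rabs c <= lam).
  { apply Rabs_le_between in Hr.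
    unfold Rmin, Rmax in Hc; destruct (Rle_dec 0 r); apply Rabs_le; lra. }
  apply Rabs_mult_le; [|rewrite Rminus_0_r; lra].
  replace (ref_acc c) with (ref_acc c - height'' (x s) (y s) (p s) (q s))
    by (unfold height'', residue, ev; ring).
  assert (E1 : Rabs (c * p s) <= lam * M)
    by (apply Rabs_mult_le; [lra|apply Mp; lra]).
  assert (E2 : Rabs (c * q s) <= lam * M)
    by (apply Rabs_mult_le; [lra|apply Mq; lra]).
  assert (Mps := Mp s ltac:(lra)); assert (Mqs := Mq s ltac:(lra)).
  assert (0 <= lam * M) by nra.
  apply Rle_trans with (112 * M ^ 3 * (M ^ 2 * (lam * M) + lam * M * M * 0)).
  + apply height''_diff; auto; try lra;
      repeat match goal with |- context [?u + ?v - ?u] =>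
        replace (u + v - u) with v by ring end;
      rewrite ?Rminus_diag, ?Rabs_R0; lra.
  + right; ring.
Qed.

Lemma phi_lip u v : Rabs u <= lam -> Rabs v <= lam ->
  Rabs (phi u - phi v) <= 112 * M ^ 6 * lam ^ 2 * Rabs (u - v).
Proof.
intros Hu Hv.
destruct (MVT_gen phi v u phi1) as [c [Hc Heq]].
- intros; apply Hphi.
- intros; apply continuity_pt_filterlim.
  apply (ex_derive_continuous (V := R_NormedModule) phi); eexists; apply Hphi.
- rewrite Heq, Rabs_mult; apply Rmult_le_compat_r; [apply Rabs_pos|].
  apply phi1_bound; apply Rabs_le_between in Hu; apply Rabs_le_between in Hv.
  unfold Rmin, Rmax in Hc; destruct (Rle_dec v u); apply Rabs_le; lra.
Qed.

Lemma covector_drift (e1 e2 : R) (Pi bi : R -> R) :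
  (forall r, s <= r <= t -> is_derive Pi r
     (sg r * (P r * ev B1 (x r) (y r) (p r) (q r) e1 e2
              + Q r * ev B2 (x r) (y r) (p r) (q r) e1 e2 + bi r))) ->
  Rabs e1 <= 1 -> Rabs e2 <= 1 ->
  (forall r, s <= r <= t -> Rabs (bi r) <= M) ->
  forall r, s <= r <= t -> Rabs (Pi r - Pi s) <= 9 * M ^ 3 * lam.
Proof.
intros HPi He1 He2 Mbi; apply (arc_taylor1 _ _ _ HPi); intros r Hr.
apply Rle_trans with (M * (4 * M * M * 1) + M * (4 * M * M * 1) + M).
- apply Rabs_plus_le; [apply Rabs_plus_le; apply Rabs_mult_le|]; auto;
    apply ev_bound; auto.
- assert (M ^ 1 <= M ^ 3) by (apply Rle_pow; auto; lia); lra.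
Qed.

(** [dY] being parallel to first order at the initial point, the covector
    [d height - <tangent, .>] moves only because of the curvature of the arc. *)
Lemma covector_gap (e1 e2 : R) (Pi bi : R -> R) :
  (forall r, s <= r <= t -> is_derive Pi r
     (sg r * (P r * ev B1 (x r) (y r) (p r) (q r) e1 e2
              + Q r * ev B2 (x r) (y r) (p r) (q r) e1 e2 + bi r))) ->
  Rabs e1 <= 1 -> Rabs e2 <= 1 ->
  (forall r, s <= r <= t -> Rabs (bi r - bi s) <= eta) ->
  forall r, s <= r <= t ->
  Rabs (Pi s + P s * ev B1 (x s) (y s) (x r - x s) (y r - y s) e1 e2
        + Q s * ev B2 (x s) (y s) (x r - x s) (y r - y s) e1 e2
        - Pi r + rho r * bi s) <= 88 * M ^ 5 * (lam + eta) * lam.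
Proof.
intros HPi He1 He2 Obi r Hr.
set (F := fun r => P s * ev B1 (x s) (y s) (x r - x s) (y r - y s) e1 e2
        + Q s * ev B2 (x s) (y s) (x r - x s) (y r - y s) e1 e2
        - Pi r + rho r * bi s).
set (F1 := fun r =>
  P s * (ev B1 (x s) (y s) (p r) (q r) e1 e2
         - ev B1 (x r) (y r) (p r) (q r) e1 e2)
  - (P r - P s) * ev B1 (x r) (y r) (p r) (q r) e1 e2
  + (Q s * (ev B2 (x s) (y s) (p r) (q r) e1 e2
            - ev B2 (x r) (y r) (p r) (q r) e1 e2)
     - (Q r - Q s) * ev B2 (x r) (y r) (p r) (q r) e1 e2)
  - (bi r - bi s)).
assert (HF : forall r, s <= r <= t -> is_derive F r (sg r * F1 r)).
{ intros r' Hr'; pose proof (Hx r' Hr'); pose proof (Hy r' Hr').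
  pose proof (Hrho r' Hr'); pose proof (HPi r' Hr').
  unfold F, F1.
  set (L1 := ev B1 (x r') (y r')) in *; set (L2 := ev B2 (x r') (y r')) in *.
  unfold ev; solve_derive. }
pose proof lam_ge0; pose proof eta_ge0.
assert (HF1 : forall r, s <= r <= t ->
  Rabs (F1 r) <= 88 * M ^ 5 * (lam + eta)).
{ intros r' Hr'; destruct (arc_C0 r' Hr') as [C1 C2].
  rewrite Rabs_minus_sym in C1, C2.
  assert (D1 := covector_drift 1 0 P b1 HP ltac:(rewrite Rabs_R1; lra)
    ltac:(rewrite Rabs_R0; lra) Mb1 r' Hr').
  assert (D2 := covector_drift 0 1 Q b2 HQ ltac:(rewrite Rabs_R0; lra)
    ltac:(rewrite Rabs_R1; lra) Mb2 r' Hr').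
  unfold F1.
  apply Rle_trans with
    (M * (8 * M * (M * lam) * M * 1) + 9 * M ^ 3 * lam * (4 * M * M * 1)
     + (M * (8 * M * (M * lam) * M * 1) + 9 * M ^ 3 * lam * (4 * M * M * 1))
     + eta).
  - apply Rabs_minus_le; [apply Rabs_plus_le; apply Rabs_minus_le|]; auto;
      apply Rabs_mult_le; auto;
      first [apply ev_diff_bound | apply ev_bound | apply MP | apply MQ];
      auto; lra.
  - assert (M ^ 4 <= M ^ 5) by (apply Rle_pow; auto; lia).
    assert (M ^ 0 <= M ^ 5) by (apply Rle_pow; auto; lia); simpl (M ^ 0) in *.
    assert (M ^ 4 * lam <= M ^ 5 * lam) by (apply Rmult_le_compat_r; lra).
    assert (1 * eta <= M ^ 5 * eta) by (apply Rmult_le_compat_r; lra).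
    lra. }
assert (HT := arc_taylor1 F F1 _ HF HF1 r Hr).
replace (Pi s + P s * ev B1 (x s) (y s) (x r - x s) (y r - y s) e1 e2
        + Q s * ev B2 (x s) (y s) (x r - x s) (y r - y s) e1 e2
        - Pi r + rho r * bi s) with (F r - F s); auto.
unfold F; rewrite Hrho0; unfold ev; ring.
Qed.

(** The acceleration contributes d height(a) to the second derivative of the height. By
    [covector_gap], d height at abscissa rho is <T, .> - rho <a(A), .> up to small terms. Since a is
    normal to T, the contribution is - k2 rho, which integrates to - k2 lam^2 / 2 and then to - k2
    lam^3 / 6. *)
Lemma arc_height :
  Rabs (height (x t) (y t) - phi lam + k2 * lam ^ 3 / 6 - lam)
  <= 1300 * M ^ 8 * (lam * (lam + eta)) * lam ^ 2 /\
  Rabs (height' (x t) (y t) (p t) (q t) - phi1 lam + k2 * lam ^ 2 / 2 - 1)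
  <= 1300 * M ^ 8 * (lam * (lam + eta)) * lam.
Proof.
set (c1 := fun r => coord B1 (x s) (y s) (x s) (x r) (y r) (x r)).
set (c2 := fun r => coord B2 (x s) (y s) (y s) (x r) (y r) (y r)).
set (c1' := fun r => coord' B1 (x s) (y s) (x r) (y r) (p r) (q r) (p r)).
set (c2' := fun r => coord' B2 (x s) (y s) (x r) (y r) (p r) (q r) (q r)).
set (F := fun r => P s * c1 r + Q s * c2 r - phi (rho r) + k2 * rho r ^ 3 / 6).
set (F1 := fun r => P s * c1' r + Q s * c2' r - phi1 (rho r)
  + k2 * rho r ^ 2 / 2).
set (push := fun r =>
  P s * (a1 r + ev B1 (x s) (y s) (x r - x s) (y r - y s) (a1 r) (a2 r))
  + Q s * (a2 r + ev B2 (x s) (y s) (x r - x s) (y r - y s) (a1 r) (a2 r))).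
set (F2 := fun r => height'' (x r) (y r) (p r) (q r) - ref_acc (rho r)
  + (push r + k2 * rho r)).
assert (HF : forall r, s <= r <= t -> is_derive F r (sg r * F1 r)).
{ intros r Hr; pose proof (Hrho r Hr); pose proof (Hphi (rho r)).
  assert (D1 : is_derive c1 r (sg r * c1' r))
    by (apply coord_derive; auto).
  assert (D2 : is_derive c2 r (sg r * c2' r))
    by (apply coord_derive; auto).
  unfold F, F1; solve_derive; field. }
assert (HF1 : forall r, s <= r <= t -> is_derive F1 r (sg r * F2 r)).
{ intros r Hr; pose proof (Hrho r Hr); pose proof (Hphi1 (rho r)).
  assert (D1 := coord'_derive B1 B2 B1 (x s) (y s) x y p q p r (sg r)
    (a1 r) (a2 r) (a1 r) (Hx r Hr) (Hy r Hr) (Hp r Hr) (Hq r Hr) (Hp r Hr)).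
  assert (D2 := coord'_derive B1 B2 B2 (x s) (y s) x y p q q r (sg r)
    (a1 r) (a2 r) (a2 r) (Hx r Hr) (Hy r Hr) (Hp r Hr) (Hq r Hr) (Hq r Hr)).
  fold c1' in D1; fold c2' in D2.
  unfold F1, F2, push, height''; solve_derive; field. }
pose proof lam_ge0; pose proof eta_ge0; pose proof lam_le1.
assert (Mps := Mp s ltac:(lra)); assert (Mqs := Mq s ltac:(lra)).
assert (HF2 : forall r, s <= r <= t ->
  Rabs (F2 r) <= 1300 * M ^ 8 * (lam * (lam + eta))).
{ intros r Hr.
  assert (Hrl : Rabs (rho r) <= lam)
    by (pose proof (rho_bounds r Hr); apply Rabs_le; lra).
  assert (Mpr := Mp r Hr); assert (Mqr := Mq r Hr).
  assert (E1 : Rabs (height'' (x r) (y r) (p r) (q r) - ref_acc (rho r))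
    <= 112 * M ^ 3 * (M ^ 2 * (5 * M ^ 3 * lam ^ 2)
                      + M * lam * M * (5 * M ^ 3 * lam))).
  { destruct (arc_C0 r Hr), (arc_C1 r Hr), (arc_C2 r Hr) as [C1 C2].
    apply height''_diff; auto.
    - replace (x s + rho r * p s - x s) with (p s * rho r) by ring.
      apply Rabs_mult_le; auto.
    - replace (y s + rho r * q s - y s) with (q s * rho r) by ring.
      apply Rabs_mult_le; auto.
    - eapply Rle_trans; [|exact C1]; right; f_equal; ring.
    - eapply Rle_trans; [|exact C2]; right; f_equal; ring. }
  assert (E2 : Rabs (push r + k2 * rho r)
    <= 88 * M ^ 5 * (lam + eta) * lam * M + 88 * M ^ 5 * (lam + eta) * lam * M
       + lam * (M * eta + M * eta)).
  { assert (D1 := covector_gap 1 0 P b1 HP ltac:(rewrite Rabs_R1; lra)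
      ltac:(rewrite Rabs_R0; lra) Ob1 r Hr).
    assert (D2 := covector_gap 0 1 Q b2 HQ ltac:(rewrite Rabs_R0; lra)
      ltac:(rewrite Rabs_R1; lra) Ob2 r Hr).
    match type of D1 with Rabs ?u <= _ => set (o1 := u) in * end.
    match type of D2 with Rabs ?u <= _ => set (o2 := u) in * end.
    (* Three terms: the covector gaps [o1], [o2] applied to a, the product <T, a>, which is zero,
       and the variation of a since A, because [k2] is <a(A), a(A)>. *)
    replace (push r + k2 * rho r) with
      (o1 * a1 r + o2 * a2 r + (P r * a1 r + Q r * a2 r)
       - rho r * (b1 s * (a1 r - a1 s) + b2 s * (a2 r - a2 s)))
      by (rewrite <- ba; unfold push, o1, o2, ev; ring).
    rewrite (Pa r Hr), Rplus_0_r.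
    apply Rabs_minus_le; [apply Rabs_plus_le; apply Rabs_mult_le|
      apply Rabs_mult_le; [|apply Rabs_plus_le; apply Rabs_mult_le]]; auto;
      first [apply Mb1 | apply Mb2]; lra. }
  (* For the terms in lam^2, 1300 majorizes 112 (5 + 5) + 2 * 88. *)
  eapply Rle_trans; [apply Rabs_plus_le; eassumption|].
  assert (L1 : 0 <= lam * lam) by nra; assert (L2 : 0 <= lam * eta) by nra.
  assert (M8 : 0 <= M ^ 8) by (apply pow_le; lra).
  assert (Q6 : M ^ 6 <= M ^ 8) by (apply Rle_pow; auto; lia).
  assert (Q1 : M ^ 1 <= M ^ 8) by (apply Rle_pow; auto; lia).
  simpl (M ^ 1) in Q1.
  assert (T1 := Rmult_le_compat_r _ _ _ L1 Q6).
  assert (T2 := Rmult_le_compat_r _ _ _ L2 Q6).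
  assert (T3 := Rmult_le_compat_r _ _ _ L2 Q1).
  assert (T4 := Rmult_le_pos _ _ M8 L1).
  assert (T5 := Rmult_le_pos _ _ M8 L2).
  lra. }
assert (Fs : F s = 0).
{ unfold F, c1, c2, coord, ev; rewrite Hrho0, phi0; field. }
assert (F1s : F1 s = 1).
{ unfold F1, c1', c2', coord', ev; rewrite Hrho0, phi10, <- Pp; field. }
split.
- assert (HT := arc_taylor2 F F1 F2 _ HF HF1 HF2 t ltac:(lra)).
  rewrite Fs, F1s in HT; unfold F in HT; fold lam in HT.
  eapply Rle_trans; [|exact HT]; right; f_equal; unfold height, c1, c2; ring.
- assert (HT := arc_taylor1 F1 F2 _ HF1 HF2 t ltac:(lra)).
  rewrite F1s in HT; unfold F1 in HT; fold lam in HT.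
  eapply Rle_trans; [|exact HT]; right; f_equal; unfold height', c1', c2'; ring.
Qed.

(** [l] is the abscissa of the starting point, 0 at A and [lam] at B, and [w] is the signed length,
    so that time r corresponds to the abscissa l + r w. The geodesic is O(lam^2)-close to this
    uniform motion on the tangent line at A, and since the residue is quadratic in the velocity, the
    reference acceleration in time r is w^2 [ref_acc]. *)
Lemma geodesic_height (X Y U V : R -> R) (l w : R) :
  unit_geodesic B1 B2 X Y U V ->
  2 * (M * lam) <= 1 -> 0 <= l <= lam -> Rabs w <= lam ->
  (forall r, 0 <= r <= 1 -> Rabs (U r) <= M * lam) ->
  (forall r, 0 <= r <= 1 -> Rabs (V r) <= M * lam) ->
  (forall r, 0 <= r <= 1 -> Rabs (X r - x s) <= 2 * (M * lam)) ->
  (forall r, 0 <= r <= 1 -> Rabs (Y r - y s) <= 2 * (M * lam)) ->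
  Rabs (X 0 - x s - l * p s) <= 5 * M ^ 3 * lam ^ 2 ->
  Rabs (Y 0 - y s - l * q s) <= 5 * M ^ 3 * lam ^ 2 ->
  Rabs (U 0 - w * p s) <= 5 * M ^ 3 * lam ^ 2 ->
  Rabs (V 0 - w * q s) <= 5 * M ^ 3 * lam ^ 2 ->
  Rabs (height (X 1) (Y 1) - phi (l + w) - (height (X 0) (Y 0) - phi l)
        - (height' (X 0) (Y 0) (U 0) (V 0) - w * phi1 l))
  <= 4704 * M ^ 8 * lam ^ 4.
Proof.
intros HG Hs Hl Hw MU MV DX DY X0 Y0 U0 V0.
pose proof lam_ge0.
assert (Mps := Mp s ltac:(lra)); assert (Mqs := Mq s ltac:(lra)).
set (c1 := fun r => coord B1 (x s) (y s) (x s) (X r) (Y r) (X r)).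
set (c2 := fun r => coord B2 (x s) (y s) (y s) (X r) (Y r) (Y r)).
set (c1' := fun r => coord' B1 (x s) (y s) (X r) (Y r) (U r) (V r) (U r)).
set (c2' := fun r => coord' B2 (x s) (y s) (X r) (Y r) (U r) (V r) (V r)).
set (F := fun r => P s * c1 r + Q s * c2 r - phi (l + r * w)).
set (F1 := fun r => P s * c1' r + Q s * c2' r - w * phi1 (l + r * w)).
set (F2 := fun r => height'' (X r) (Y r) (U r) (V r)
  - w ^ 2 * ref_acc (l + r * w)).
assert (D1 : forall r, 0 <= r <= 1 -> is_derive c1 r (c1' r) /\
  is_derive c1' r (residue B1 B2 B1 (x s) (y s) (X r) (Y r) (U r) (V r))).
{ apply geodesic_coord; auto; intros; apply HG; auto. }
assert (D2 : forall r, 0 <= r <= 1 -> is_derive c2 r (c2' r) /\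
  is_derive c2' r (residue B1 B2 B2 (x s) (y s) (X r) (Y r) (U r) (V r))).
{ apply geodesic_coord; auto; intros; apply HG; auto. }
assert (HT := unit_taylor2 F F1 F2 (4704 * M ^ 8 * lam ^ 4)).
assert (HF : Rabs (F 1 - F 0 - 1 * F1 0) <= 4704 * M ^ 8 * lam ^ 4).
{ apply HT; try lra.
  - intros r Hr; destruct (D1 r Hr), (D2 r Hr).
    unfold F, F1; pose proof (Hphi (l + r * w)); solve_derive.
  - intros r Hr; destruct (D1 r Hr), (D2 r Hr).
    unfold F1, F2, height''; pose proof (Hphi1 (l + r * w)); solve_derive.
  - intros r Hr; unfold F2.
    assert (HM3 : 0 <= M ^ 3) by (apply pow_le; lra).
    assert (HM3l : 0 <= M ^ 3 * lam ^ 2) by (apply Rmult_le_pos; nra).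
    assert (Hr1 : Rabs r <= 1) by (apply Rabs_le; lra).
    assert (Hlw : Rabs (l + r * w) <= 2 * lam).
    { replace (2 * lam) with (lam + 1 * lam) by ring.
      apply Rabs_plus_le; [apply Rabs_le; lra|apply Rabs_mult_le; auto]. }
    destruct (geodesic_C1 M B1 B2 HB1 HB2 X Y U V (M * lam) HG MU MV r Hr)
      as [C1 C2].
    destruct (geodesic_C2 M B1 B2 HB1 HB2 X Y U V (M * lam) HG MU MV r Hr)
      as [C3 C4].
    replace (w ^ 2 * ref_acc (l + r * w)) with
      (height'' (x s + (l + r * w) * p s) (y s + (l + r * w) * q s)
         (w * p s) (w * q s))
      by (unfold ref_acc, height''; rewrite !residue_scal; ring).
    assert (Hwp : Rabs (w * p s) <= M * lam)
      by (rewrite Rmult_comm; apply Rabs_mult_le; auto).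
    assert (Hwq : Rabs (w * q s) <= M * lam)
      by (rewrite Rmult_comm; apply Rabs_mult_le; auto).
    (* 4704 = 112 (14 + 2 * 14), where 14 = 4 + 5 + 5 adds the bending of the geodesic and the
       errors on its initial position and velocity. *)
    apply Rle_trans with
      (112 * M ^ 3 * ((M * lam) ^ 2 * (14 * (M ^ 3 * lam ^ 2))
        + 2 * (M * lam) * (M * lam) * (14 * (M ^ 3 * lam ^ 2)))).
    2: { right; ring. }
    apply height''_diff; auto.
    + replace (x s + (l + r * w) * p s - x s) with (p s * (l + r * w)) by ring.
      replace (2 * (M * lam)) with (M * (2 * lam)) by ring.
      apply Rabs_mult_le; auto.
    + replace (y s + (l + r * w) * q s - y s) with (q s * (l + r * w)) by ring.
      replace (2 * (M * lam)) with (M * (2 * lam)) by ring.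
      apply Rabs_mult_le; auto.
    + replace (X r - (x s + (l + r * w) * p s)) with
        ((X r - X 0 - r * U 0) + (X 0 - x s - l * p s) + r * (U 0 - w * p s))
        by ring.
      replace (14 * (M ^ 3 * lam ^ 2)) with (4 * M * (M * lam) * (M * lam)
        + 5 * M ^ 3 * lam ^ 2 + 1 * (5 * M ^ 3 * lam ^ 2)) by ring.
      apply Rabs_plus_le; [apply Rabs_plus_le; auto|apply Rabs_mult_le; auto].
    + replace (Y r - (y s + (l + r * w) * q s)) with
        ((Y r - Y 0 - r * V 0) + (Y 0 - y s - l * q s) + r * (V 0 - w * q s))
        by ring.
      replace (14 * (M ^ 3 * lam ^ 2)) with (4 * M * (M * lam) * (M * lam)
        + 5 * M ^ 3 * lam ^ 2 + 1 * (5 * M ^ 3 * lam ^ 2)) by ring.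
      apply Rabs_plus_le; [apply Rabs_plus_le; auto|apply Rabs_mult_le; auto].
    + replace (U r - w * p s) with ((U r - U 0) + (U 0 - w * p s)) by ring.
      apply Rle_trans with (4 * M * (M * lam) * (M * lam) + 5 * M ^ 3 * lam ^ 2);
        [apply Rabs_plus_le; auto | lra].
    + replace (V r - w * q s) with ((V r - V 0) + (V 0 - w * q s)) by ring.
      apply Rle_trans with (4 * M * (M * lam) * (M * lam) + 5 * M ^ 3 * lam ^ 2);
        [apply Rabs_plus_le; auto | lra]. }
eapply Rle_trans; [|exact HF]; right; f_equal.
unfold F, F1, height, height', c1, c2, c1', c2'.
rewrite Rmult_0_l, Rplus_0_r, Rmult_1_l; ring.
Qed.

End Reference.

(** ** Tangent geodesics meeting at time 1 *)

Variables (X1 Y1 U1 V1 X2 Y2 U2 V2 : R -> R) (w1 w2 : R).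
Hypotheses
  (G1 : unit_geodesic B1 B2 X1 Y1 U1 V1) (G2 : unit_geodesic B1 B2 X2 Y2 U2 V2)
  (X10 : X1 0 = x s) (Y10 : Y1 0 = y s)
  (U10 : U1 0 = w1 * p s) (V10 : V1 0 = w1 * q s)
  (X20 : X2 0 = x t) (Y20 : Y2 0 = y t)
  (U20 : U2 0 = w2 * p t) (V20 : V2 0 = w2 * q t)
  (MU1 : forall r, 0 <= r <= 1 -> Rabs (U1 r) <= M * Rabs w1)
  (MV1 : forall r, 0 <= r <= 1 -> Rabs (V1 r) <= M * Rabs w1)
  (MU2 : forall r, 0 <= r <= 1 -> Rabs (U2 r) <= M * Rabs w2)
  (MV2 : forall r, 0 <= r <= 1 -> Rabs (V2 r) <= M * Rabs w2)
  (X12 : X1 1 = X2 1) (Y12 : Y1 1 = Y2 1).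

(** At first [w1] and [w2] are only known to be small, not to be of order [lam]. All bounds are
    therefore expressed by a common majorant [wb], which is the maximum of the three lengths in
    [meeting_times_bound] and then [lam] in [string_defect]. *)
Section Closing.
Variable wb : R.
Hypotheses (Hlwb : lam <= wb) (Hw1 : Rabs w1 <= wb) (Hw2 : Rabs w2 <= wb)
  (Hwb : 64 * M ^ 3 * wb <= 1).

Lemma wb_ge0 : 0 <= wb.
Proof. eapply Rabs_nonneg_bound, Hw1. Qed.

Lemma Mwb_small : 2 * (M * wb) <= 1.
Proof.
pose proof wb_ge0; assert (M ^ 1 <= M ^ 3) by (apply Rle_pow; auto; lia).
simpl (M ^ 1) in *; nra.
Qed.

Lemma speed_wb w v : Rabs w <= wb -> Rabs v <= M * Rabs w -> Rabs v <= M * wb.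
Proof. intros; pose proof (Rabs_pos w); nra. Qed.

Let MU1' r (Hr : 0 <= r <= 1) := speed_wb _ _ Hw1 (MU1 r Hr).
Let MV1' r (Hr : 0 <= r <= 1) := speed_wb _ _ Hw1 (MV1 r Hr).
Let MU2' r (Hr : 0 <= r <= 1) := speed_wb _ _ Hw2 (MU2 r Hr).
Let MV2' r (Hr : 0 <= r <= 1) := speed_wb _ _ Hw2 (MV2 r Hr).

(** The geodesics start O(lam) apart and meet at time 1, so [boundary_bound] keeps their gap of
    order [lam] even if they are much longer than the arc. The condition 64 M^3 wb <= 1 says that
    its [eps], here 8 M^3 wb, is at most 1/8. *)
Lemma gap_bound r : 0 <= r <= 1 ->
  Rabs (X2 r - X1 r) + Rabs (Y2 r - Y1 r)
  + Rabs (U2 r - U1 r) + Rabs (V2 r - V1 r) <= 8 * (M * lam).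
Proof.
intros Hr.
pose proof wb_ge0 as Hwb0; pose proof Mwb_small.
assert (HM3 : 0 <= M ^ 3) by (apply pow_le; lra).
apply Rle_trans with (4 * (Rabs (X2 0 - X1 0) + Rabs (Y2 0 - Y1 0))).
2: { rewrite X10, X20, Y10, Y20; destruct (arc_C0 t); lra. }
assert (Hacc : forall B, qbounded_lip M B -> forall r, 0 <= r <= 1 ->
  Rabs (- ev B (X2 r) (Y2 r) (U2 r) (V2 r) (U2 r) (V2 r)
        - - ev B (X1 r) (Y1 r) (U1 r) (V1 r) (U1 r) (V1 r))
  <= 8 * M ^ 3 * wb * (Rabs (X2 r - X1 r) + Rabs (Y2 r - Y1 r)
      + Rabs (U2 r - U1 r) + Rabs (V2 r - V1 r))).
{ intros B HB r' Hr'.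
  pose proof (Rabs_pos (X2 r' - X1 r')); pose proof (Rabs_pos (Y2 r' - Y1 r')).
  pose proof (Rabs_pos (U2 r' - U1 r')); pose proof (Rabs_pos (V2 r' - V1 r')).
  set (e := Rabs (X2 r' - X1 r') + Rabs (Y2 r' - Y1 r')).
  set (e' := Rabs (U2 r' - U1 r') + Rabs (V2 r' - V1 r')).
  apply Rle_trans with (8 * M * (e * (M * wb) ^ 2 + (M * wb) * e')).
  - replace (- ev B (X2 r') (Y2 r') (U2 r') (V2 r') (U2 r') (V2 r')
        - - ev B (X1 r') (Y1 r') (U1 r') (V1 r') (U1 r') (V1 r')) with
      (- (ev B (X2 r') (Y2 r') (U2 r') (V2 r') (U2 r') (V2 r')
        - ev B (X1 r') (Y1 r') (U1 r') (V1 r') (U1 r') (V1 r'))) by ring.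
    rewrite Rabs_Ropp.
    apply ev_vel_diff_bound; unfold e, e'; try lra; auto.
  - replace (e + Rabs (U2 r' - U1 r') + Rabs (V2 r' - V1 r')) with (e + e')
      by (unfold e'; ring).
    assert (0 <= e) by (unfold e; lra); assert (0 <= e') by (unfold e'; lra).
    assert (wb <= 1) by nra.
    assert (T1 : M ^ 3 * wb * (wb * e) <= M ^ 3 * wb * (1 * e)).
    { apply Rmult_le_compat_l; [apply Rmult_le_pos; lra|].
      apply Rmult_le_compat_r; lra. }
    assert (T2 : M ^ 2 * (wb * e') <= M ^ 3 * (wb * e')).
    { apply Rmult_le_compat_r; [nra|]; apply Rle_pow; auto; lia. }
    lra. }
apply (boundary_bound (fun r => X2 r - X1 r) (fun r => Y2 r - Y1 r)
  (fun r => U2 r - U1 r) (fun r => V2 r - V1 r)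
  (fun r => - ev B1 (X2 r) (Y2 r) (U2 r) (V2 r) (U2 r) (V2 r)
            - - ev B1 (X1 r) (Y1 r) (U1 r) (V1 r) (U1 r) (V1 r))
  (fun r => - ev B2 (X2 r) (Y2 r) (U2 r) (V2 r) (U2 r) (V2 r)
            - - ev B2 (X1 r) (Y1 r) (U1 r) (V1 r) (U1 r) (V1 r))
  (8 * M ^ 3 * wb)); try (intros; apply Hacc; auto; fail); auto; try lra.
- split; [apply Rmult_le_pos; lra | lra].
- intros r' Hr'; apply is_derive_Rminus; [apply G2|apply G1]; auto.
- intros r' Hr'; apply is_derive_Rminus; [apply G2|apply G1]; auto.
- intros r' Hr'; apply is_derive_Rminus; [apply G2|apply G1]; auto.
- intros r' Hr'; apply is_derive_Rminus; [apply G2|apply G1]; auto.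
Qed.

Lemma X1_bound r : 0 <= r <= 1 ->
  Rabs (X1 r - x s) <= M * wb /\ Rabs (Y1 r - y s) <= M * wb.
Proof.
intros Hr; rewrite <- X10, <- Y10.
exact (geodesic_C0 B1 B2 X1 Y1 U1 V1 (M * wb) G1 MU1' MV1' r Hr).
Qed.

Lemma X2_bound r : 0 <= r <= 1 ->
  Rabs (X2 r - x s) <= 2 * (M * wb) /\ Rabs (Y2 r - y s) <= 2 * (M * wb).
Proof.
intros Hr.
destruct (geodesic_C0 B1 B2 X2 Y2 U2 V2 (M * wb) G2 MU2' MV2' r Hr) as [H1 H2].
destruct (arc_C0 t ltac:(lra)) as [H3 H4].
assert (M * lam <= M * wb) by (apply Rmult_le_compat_l; lra).
rewrite X20 in H1; rewrite Y20 in H2.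
split.
- replace (X2 r - x s) with ((X2 r - x t) + (x t - x s)) by ring.
  eapply Rle_trans; [apply Rabs_plus_le; eassumption|]; lra.
- replace (Y2 r - y s) with ((Y2 r - y t) + (y t - y s)) by ring.
  eapply Rle_trans; [apply Rabs_plus_le; eassumption|]; lra.
Qed.

(** The difference of the [Y]-coordinates of the two geodesics vanishes at time
    1, and by [gap_bound] it is affine up to [O(lam wb^2)]. *)
Lemma closing_gap (B : qfield) (z w Z1 W1 Z2 W2 : R -> R) :
  qbounded_lip M B ->
  (forall r, 0 <= r <= 1 -> is_derive Z1 r (W1 r)) ->
  (forall r, 0 <= r <= 1 -> is_derive Z2 r (W2 r)) ->
  (forall r, 0 <= r <= 1 -> is_derive W1 r
     (- ev B (X1 r) (Y1 r) (U1 r) (V1 r) (U1 r) (V1 r))) ->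
  (forall r, 0 <= r <= 1 -> is_derive W2 r
     (- ev B (X2 r) (Y2 r) (U2 r) (V2 r) (U2 r) (V2 r))) ->
  Z1 0 = z s -> Z2 0 = z t -> W1 0 = w1 * w s -> W2 0 = w2 * w t ->
  Z1 1 = Z2 1 ->
  Rabs (coord B (x s) (y s) (z s) (x t) (y t) (z t)
        + w2 * coord' B (x s) (y s) (x t) (y t) (p t) (q t) (w t)
        - w1 * w s)
  <= 1344 * M ^ 5 * lam * wb ^ 2.
Proof.
intros HB HZ1 HZ2 HW1 HW2 Z10 Z20 W10 W20 Z12.
pose proof Mwb_small; pose proof wb_ge0; pose proof lam_ge0.
set (D := fun r => coord B (x s) (y s) (z s) (X2 r) (Y2 r) (Z2 r)
  - coord B (x s) (y s) (z s) (X1 r) (Y1 r) (Z1 r)).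
set (D1 := fun r => coord' B (x s) (y s) (X2 r) (Y2 r) (U2 r) (V2 r) (W2 r)
  - coord' B (x s) (y s) (X1 r) (Y1 r) (U1 r) (V1 r) (W1 r)).
set (D2 := fun r => residue B1 B2 B (x s) (y s) (X2 r) (Y2 r) (U2 r) (V2 r)
  - residue B1 B2 B (x s) (y s) (X1 r) (Y1 r) (U1 r) (V1 r)).
assert (HT := unit_taylor2 D D1 D2 (1344 * M ^ 5 * lam * wb ^ 2)).
replace (coord B (x s) (y s) (z s) (x t) (y t) (z t)
        + w2 * coord' B (x s) (y s) (x t) (y t) (p t) (q t) (w t)
        - w1 * w s) with (- (D 1 - D 0 - 1 * D1 0)).
2: { unfold D, D1; rewrite X12, Y12, Z12, X10, Y10, Z10, X20, Y20, Z20,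
       U10, V10, W10, U20, V20, W20; unfold coord, coord', ev; field. }
rewrite Rabs_Ropp; apply HT; try lra.
- intros r Hr; apply is_derive_Rminus.
  + exact (proj1 (geodesic_coord B1 B2 X2 Y2 U2 V2 G2 B (x s) (y s) (z s)
      Z2 W2 HZ2 HW2 r Hr)).
  + exact (proj1 (geodesic_coord B1 B2 X1 Y1 U1 V1 G1 B (x s) (y s) (z s)
      Z1 W1 HZ1 HW1 r Hr)).
- intros r Hr; apply is_derive_Rminus.
  + exact (proj2 (geodesic_coord B1 B2 X2 Y2 U2 V2 G2 B (x s) (y s) (z s)
      Z2 W2 HZ2 HW2 r Hr)).
  + exact (proj2 (geodesic_coord B1 B2 X1 Y1 U1 V1 G1 B (x s) (y s) (z s)
      Z1 W1 HZ1 HW1 r Hr)).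
- intros r Hr.
  pose proof (gap_bound r Hr).
  pose proof (Rabs_pos (X2 r - X1 r)); pose proof (Rabs_pos (Y2 r - Y1 r)).
  pose proof (Rabs_pos (U2 r - U1 r)); pose proof (Rabs_pos (V2 r - V1 r)).
  destruct (X1_bound r Hr), (X2_bound r Hr).
  assert (0 <= M * wb) by nra.
  apply Rle_trans with (56 * M ^ 2 * ((M * wb) ^ 2 * (8 * (M * lam))
    + (2 * (M * wb)) * (M * wb) * (8 * (M * lam)))).
  + apply residue_diff_bound; auto; try lra.
  + right; ring.
Qed.

Let err := 1464 * M ^ 5 * (lam * wb * (wb + eta)).

(** One coordinate of the vector relation (lam + w2 - w1) T + (lam^2 / 2 + w2 lam) a = O([err]) at
    A, obtained by inserting the expansion of the arc into [closing_gap]. As T and a are orthogonal,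
    pairing with their dual covectors separates the two coefficients. The constant is 1464 = 1344 +
    60 + 60. *)
Lemma closing_component (B : qfield) (z w az Z1 W1 Z2 W2 : R -> R) :
  qbounded_lip M B ->
  (forall r, s <= r <= t -> is_derive z r (sg r * w r)) ->
  (forall r, s <= r <= t -> is_derive w r
     (sg r * (- ev B (x r) (y r) (p r) (q r) (p r) (q r) + az r))) ->
  (forall r, s <= r <= t -> Rabs (az r - az s) <= eta) ->
  (forall r, 0 <= r <= 1 -> is_derive Z1 r (W1 r)) ->
  (forall r, 0 <= r <= 1 -> is_derive Z2 r (W2 r)) ->
  (forall r, 0 <= r <= 1 -> is_derive W1 r
     (- ev B (X1 r) (Y1 r) (U1 r) (V1 r) (U1 r) (V1 r))) ->
  (forall r, 0 <= r <= 1 -> is_derive W2 r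
     (- ev B (X2 r) (Y2 r) (U2 r) (V2 r) (U2 r) (V2 r))) ->
  Z1 0 = z s -> Z2 0 = z t -> W1 0 = w1 * w s -> W2 0 = w2 * w t ->
  Z1 1 = Z2 1 ->
  Rabs ((lam + w2 - w1) * w s + (lam ^ 2 / 2 + w2 * lam) * az s) <= err.
Proof.
intros HB Hz Hw Oz HZ1 HZ2 HW1 HW2 Z10 Z20 W10 W20 Z12.
assert (H1 := closing_gap B z w Z1 W1 Z2 W2 HB HZ1 HZ2 HW1 HW2 Z10 Z20 W10 W20
  Z12).
destruct (arc_coord B z w az HB Hz Hw Oz) as [H2 H3].
set (c := coord B (x s) (y s) (z s) (x t) (y t) (z t)) in *.
set (c' := coord' B (x s) (y s) (x t) (y t) (p t) (q t) (w t)) in *.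
replace ((lam + w2 - w1) * w s + (lam ^ 2 / 2 + w2 * lam) * az s) with
  ((c + w2 * c' - w1 * w s) - (c - lam * w s - lam ^ 2 / 2 * az s)
   - w2 * (c' - w s - lam * az s)) by ring.
pose proof wb_ge0; pose proof lam_ge0; pose proof eta_ge0.
apply Rle_trans with (1344 * M ^ 5 * lam * wb ^ 2
  + 60 * M ^ 5 * (lam + eta) * lam ^ 2
  + wb * (60 * M ^ 5 * (lam + eta) * lam)).
{ apply Rabs_minus_le; [apply Rabs_minus_le; auto|apply Rabs_mult_le; auto]. }
assert (HM5 : 0 <= M ^ 5) by (apply pow_le; lra).
assert (T1 : lam * wb ^ 2 <= lam * wb * (wb + eta)).
{ replace (lam * wb ^ 2) with (lam * wb * wb) by ring.
  apply Rmult_le_compat_l; [nra|lra]. }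
assert (T2 : (lam + eta) * lam ^ 2 <= lam * wb * (wb + eta)).
{ replace ((lam + eta) * lam ^ 2) with (lam * (lam * (lam + eta))) by ring.
  rewrite Rmult_assoc; apply Rmult_le_compat_l; auto.
  apply Rmult_le_compat; lra. }
assert (T3 : wb * ((lam + eta) * lam) <= lam * wb * (wb + eta)).
{ replace (wb * ((lam + eta) * lam)) with (lam * wb * (lam + eta)) by ring.
  apply Rmult_le_compat_l; [nra|lra]. }
apply (Rmult_le_compat_l (M ^ 5)) in T1, T2, T3; auto.
unfold err; lra.
Qed.

Lemma closing_x :
  Rabs ((lam + w2 - w1) * p s + (lam ^ 2 / 2 + w2 * lam) * a1 s) <= err.
Proof.
apply (closing_component B1 x p a1 X1 U1 X2 U2); auto;
  intros; apply G1 || apply G2; auto.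
Qed.

Lemma closing_y :
  Rabs ((lam + w2 - w1) * q s + (lam ^ 2 / 2 + w2 * lam) * a2 s) <= err.
Proof.
apply (closing_component B2 y q a2 Y1 V1 Y2 V2); auto;
  intros; apply G1 || apply G2; auto.
Qed.

Lemma tangential_gap : Rabs (lam + w2 - w1) <= 2 * M * err.
Proof.
replace (lam + w2 - w1) with
  (P s * ((lam + w2 - w1) * p s + (lam ^ 2 / 2 + w2 * lam) * a1 s)
   + Q s * ((lam + w2 - w1) * q s + (lam ^ 2 / 2 + w2 * lam) * a2 s)).
- replace (2 * M * err) with (M * err + M * err) by ring.
  apply Rabs_plus_le; apply Rabs_mult_le; auto using closing_x, closing_y.
  + apply MP; lra.
  + apply MQ; lra.
- assert (H := Pa s ltac:(lra)).
  transitivity ((lam + w2 - w1) * (P s * p s + Q s * q s)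
    + (lam ^ 2 / 2 + w2 * lam) * (P s * a1 s + Q s * a2 s)); [ring|].
  rewrite Pp, H; ring.
Qed.

(** Pairing with the dual of a gives [k2] times this quantity; the lower bound 1 <= M k2 on the
    curvature allows the division. *)
Lemma normal_gap : Rabs (lam * (lam / 2 + w2)) <= 2 * M ^ 2 * err.
Proof.
assert (Hk : 0 < k2) by nra.
assert (H : Rabs (k2 * (lam * (lam / 2 + w2))) <= 2 * M * err).
{ replace (k2 * (lam * (lam / 2 + w2))) with
    (b1 s * ((lam + w2 - w1) * p s + (lam ^ 2 / 2 + w2 * lam) * a1 s)
     + b2 s * ((lam + w2 - w1) * q s + (lam ^ 2 / 2 + w2 * lam) * a2 s)).
  - replace (2 * M * err) with (M * err + M * err) by ring.
    apply Rabs_plus_le; apply Rabs_mult_le; auto using closing_x, closing_y.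
    + apply Mb1; lra.
    + apply Mb2; lra.
  - transitivity ((lam + w2 - w1) * (b1 s * p s + b2 s * q s)
      + (lam ^ 2 / 2 + w2 * lam) * (b1 s * a1 s + b2 s * a2 s)); [ring|].
    rewrite bp, ba; field. }
rewrite Rabs_mult, (Rabs_pos_eq k2) in H by lra.
pose proof (Rabs_pos (lam * (lam / 2 + w2))) as H0.
apply (Rmult_le_compat_l M) in H; [|lra].
apply (Rmult_le_compat_r _ _ _ H0) in Hk2.
lra.
Qed.

End Closing.

Hypotheses (Hlam : 0 < lam) (Hwl : 64 * M ^ 3 * lam <= 1)
  (Hww1 : 64 * M ^ 3 * Rabs w1 <= 1) (Hww2 : 64 * M ^ 3 * Rabs w2 <= 1)
  (Hsl : 11712 * M ^ 7 * (lam + eta) <= 1)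
  (Hsw1 : 11712 * M ^ 7 * (Rabs w1 + eta) <= 1)
  (Hsw2 : 11712 * M ^ 7 * (Rabs w2 + eta) <= 1).

Lemma closing_estimates wb : lam <= wb -> Rabs w1 <= wb -> Rabs w2 <= wb ->
  64 * M ^ 3 * wb <= 1 ->
  Rabs (lam + w2 - w1) <= 2928 * M ^ 6 * (lam * wb * (wb + eta)) /\
  Rabs (lam / 2 + w2) <= 2928 * M ^ 7 * (wb * (wb + eta)).
Proof.
intros H1 H2 H3 H4.
assert (T := tangential_gap wb H1 H2 H3 H4).
assert (N := normal_gap wb H1 H2 H3 H4).
cbv zeta in T, N; split.
- eapply Rle_trans; [exact T|]; right; ring.
- rewrite Rabs_mult, (Rabs_pos_eq lam) in N by lra.
  apply Rmult_le_reg_l with lam; auto.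
  eapply Rle_trans; [exact N|]; right; ring.
Qed.

(** A bootstrap. As 11712 = 4 * 2928, the errors in the closing estimates are at most lam / 4 and wb
    / 4. If the maximum [wb] is attained by |w1|, then wb <= 3 lam / 4 + wb / 4; if by |w2|, then wb
    <= lam / 2 + wb / 4. In all cases wb <= lam. *)
Lemma meeting_times_bound : Rabs w1 <= lam /\ Rabs w2 <= lam.
Proof.
pose proof eta_ge0.
set (wb := Rmax lam (Rmax (Rabs w1) (Rabs w2))).
assert (Hwb : lam <= wb /\ Rabs w1 <= wb /\ Rabs w2 <= wb /\
  (wb = lam \/ wb = Rabs w1 \/ wb = Rabs w2)).
{ unfold wb, Rmax; destruct (Rle_dec (Rabs w1) (Rabs w2));
    match goal with |- context [Rle_dec ?u ?v] => destruct (Rle_dec u v) end;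
    repeat split; auto; lra. }
destruct Hwb as [L0 [L1 [L2 Hor]]].
assert (S1 : 64 * M ^ 3 * wb <= 1)
  by (destruct Hor as [E|[E|E]]; rewrite E; assumption).
assert (S2 : 11712 * M ^ 7 * (wb + eta) <= 1)
  by (destruct Hor as [E|[E|E]]; rewrite E; assumption).
destruct (closing_estimates wb L0 L1 L2 S1) as [T N].
assert (W : 0 < wb) by lra.
assert (HM6 : M ^ 6 <= M ^ 7) by (apply Rle_pow; auto; lia).
assert (HM60 : 0 <= M ^ 6) by (apply pow_le; lra).
assert (N' : Rabs (lam / 2 + w2) <= wb / 4).
{ eapply Rle_trans; [exact N|].
  apply (Rmult_le_compat_l wb) in S2; lra. }
assert (T' : Rabs (lam + w2 - w1) <= lam / 4).
{ eapply Rle_trans; [exact T|].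
  assert (wb <= 1).
  { assert (1 <= M ^ 3) by (apply pow_R1_Rle; auto); nra. }
  assert (Z : M ^ 6 * (wb + eta) <= M ^ 7 * (wb + eta))
    by (apply Rmult_le_compat_r; lra).
  assert (Z' : 2928 * (M ^ 6 * (wb + eta)) * (lam * wb) <= 1 / 4 * (lam * 1)).
  { apply Rmult_le_compat; nra. }
  lra. }
apply Rabs_le_between in N'; apply Rabs_le_between in T'.
assert (wb <= lam).
{ destruct Hor as [E|[E|E]]; [lra| |].
  - assert (Rabs w1 <= 3 * lam / 4 + wb / 4) by (apply Rabs_le; lra); lra.
  - assert (Rabs w2 <= lam / 2 + wb / 4) by (apply Rabs_le; lra); lra. }
lra.
Qed.

(** The height of C is computed from A and from B. Up to [phi], the height at B is lam - k2 lam^3 /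
    6 and its slope there 1 - k2 lam^2 / 2, so equating both values gives w1 - w2 - lam = - k2 lam^3
    / 6 - w2 k2 lam^2 / 2, where w2 is close to - lam / 2. The terms phi(w1) and phi(lam + w2), of
    order lam^3 each, cancel up to a smaller error because their arguments are close. *)
Lemma string_defect :
  Rabs (Rabs w1 + Rabs w2 - lam - k2 * lam ^ 3 / 12)
  <= 350000 * M ^ 12 * (lam + eta) * lam ^ 3.
Proof.
destruct meeting_times_bound as [L1 L2].
pose proof eta_ge0.
destruct (closing_estimates lam (Rle_refl _) L1 L2 Hwl) as [T N].
destruct (twice_primitive ref_acc ref_acc_continuous)
  as [phi [phi1 [Hphi [Hphi1 [phi0 phi10]]]]].
destruct (arc_height phi phi1 Hphi Hphi1 phi0 phi10) as [E3 E4].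
assert (Hl1 := lam_le1).
assert (HMl : 2 * (M * lam) <= 1) by (apply Mwb_small; auto; lra).
assert (HM3 : 0 <= M ^ 3) by (apply pow_le; lra).
assert (H0 : 0 <= 5 * M ^ 3 * lam ^ 2) by (apply Rmult_le_pos; nra).
destruct (arc_C1 t ltac:(lra)) as [V3 V4].
destruct (arc_C2 t ltac:(lra)) as [V5 V6].
assert (E1 : Rabs (height (X1 1) (Y1 1) - phi w1 - w1) <= 4704 * M ^ 8 * lam ^ 4).
{ assert (E := geodesic_height phi phi1 Hphi Hphi1 X1 Y1 U1 V1 0 w1 G1 HMl).
  rewrite X10, Y10, U10, V10, Rplus_0_l, phi0, phi10 in E.
  replace (height (x s) (y s)) with 0 in E
    by (unfold height, coord, ev; field).
  replace (height' (x s) (y s) (w1 * p s) (w1 * q s)) with w1 in E.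
  2: { transitivity (w1 * (P s * p s + Q s * q s)); [rewrite Pp; ring|].
       unfold height', coord', ev; ring. }
  replace (height (X1 1) (Y1 1) - phi w1 - w1) with
    (height (X1 1) (Y1 1) - phi w1 - (0 - 0) - (w1 - w1 * 0)) by ring.
  assert (B : forall r, 0 <= r <= 1 ->
    Rabs (X1 r - x s) <= M * lam /\ Rabs (Y1 r - y s) <= M * lam)
    by (intros; eapply X1_bound; eauto; lra).
  assert (0 <= M * lam) by nra.
  apply E; auto; try lra; try (intros r Hr; specialize (B r Hr); lra);
    try (intros r Hr; apply Rle_trans with (M * Rabs w1); auto;
      apply Rmult_le_compat_l; lra);
    match goal with |- Rabs ?u <= _ => replace u with 0 by ring end;
    rewrite Rabs_R0; exact H0. }
assert (E2 : Rabs (height (X1 1) (Y1 1) - phi (lam + w2)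
    - (height (x t) (y t) - phi lam)
    - w2 * (height' (x t) (y t) (p t) (q t) - phi1 lam))
  <= 4704 * M ^ 8 * lam ^ 4).
{ assert (E := geodesic_height phi phi1 Hphi Hphi1 X2 Y2 U2 V2 lam w2 G2 HMl).
  rewrite X20, Y20, U20, V20, <- X12, <- Y12 in E.
  replace (height' (x t) (y t) (w2 * p t) (w2 * q t)) with
    (w2 * height' (x t) (y t) (p t) (q t)) in E
    by (unfold height', coord', ev; ring).
  rewrite Rmult_minus_distr_l.
  assert (B : forall r, 0 <= r <= 1 ->
    Rabs (X2 r - x s) <= 2 * (M * lam) /\ Rabs (Y2 r - y s) <= 2 * (M * lam))
    by (intros; eapply X2_bound; eauto; lra).
  apply E; auto; try lra; try (intros r Hr; specialize (B r Hr); lra);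
    try (intros r Hr; apply Rle_trans with (M * Rabs w2); auto;
      apply Rmult_le_compat_l; lra).
  - replace (w2 * p t - w2 * p s) with (w2 * (p t - p s)) by ring.
    replace (5 * M ^ 3 * lam ^ 2) with (lam * (5 * M ^ 3 * lam)) by ring.
    apply Rabs_mult_le; auto.
  - replace (w2 * q t - w2 * q s) with (w2 * (q t - q s)) by ring.
    replace (5 * M ^ 3 * lam ^ 2) with (lam * (5 * M ^ 3 * lam)) by ring.
    apply Rabs_mult_le; auto. }
set (hC := height (X1 1) (Y1 1)) in *.
set (hB := height (x t) (y t)) in *.
set (hB' := height' (x t) (y t) (p t) (q t)) in *.
clearbody hC hB hB'.
assert (HM7 : M ^ 6 <= M ^ 7) by (apply Rle_pow; auto; lia).
assert (HM60 : 0 <= M ^ 6) by (apply pow_le; lra).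
assert (Hll : 2928 * M ^ 7 * (lam * (lam + eta)) <= lam / 4).
{ apply (Rmult_le_compat_l lam) in Hsl; lra. }
assert (Hll' : 2928 * M ^ 6 * (lam * lam * (lam + eta)) <= lam / 4).
{ assert (Z : M ^ 6 * (lam + eta) <= M ^ 7 * (lam + eta))
    by (apply Rmult_le_compat_r; lra).
  assert (Z' : 2928 * (M ^ 6 * (lam + eta)) * (lam * lam) <= 1 / 4 * (lam * 1)).
  { apply Rmult_le_compat; nra. }
  lra. }
assert (T' := Rle_trans _ _ _ T Hll'); assert (N' := Rle_trans _ _ _ N Hll).
apply Rabs_le_between in T'; apply Rabs_le_between in N'.
(* Errors below lam / 4 fix the signs w1 >= 0 > w2: the point C lies ahead of A and behind B. *)
rewrite (Rabs_pos_eq w1) by lra; rewrite (Rabs_left w2) by lra.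
assert (E5 : Rabs (phi (lam + w2) - phi w1)
  <= 112 * M ^ 6 * lam ^ 2 * (2928 * M ^ 6 * (lam * lam * (lam + eta)))).
{ eapply Rle_trans; [apply (phi_lip phi phi1 Hphi Hphi1 phi10); auto|].
  - apply Rabs_le; lra.
  - apply Rmult_le_compat_l; [|exact T].
    apply Rmult_le_pos; nra. }
assert (Hk : Rabs k2 <= M * M + M * M).
{ rewrite <- ba; apply Rabs_plus_le; apply Rabs_mult_le;
    first [apply Mb1 | apply Mb2 | apply Ma1 | apply Ma2]; lra. }
replace (w1 + - w2 - lam - k2 * lam ^ 3 / 12) with
  (- (hC - phi w1 - w1)
   + (hC - phi (lam + w2) - (hB - phi lam) - w2 * (hB' - phi1 lam))
   + (hB - phi lam + k2 * lam ^ 3 / 6 - lam)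
   + w2 * (hB' - phi1 lam + k2 * lam ^ 2 / 2 - 1)
   + (phi (lam + w2) - phi w1)
   - k2 * (lam ^ 2 / 2 * (lam / 2 + w2))) by field.
(* 350000 majorizes 2 * 4704 + 2 * 1300 + 112 * 2928 + 2928. *)
apply Rle_trans with
  (4704 * M ^ 8 * lam ^ 4 + 4704 * M ^ 8 * lam ^ 4
   + 1300 * M ^ 8 * (lam * (lam + eta)) * lam ^ 2
   + lam * (1300 * M ^ 8 * (lam * (lam + eta)) * lam)
   + 112 * M ^ 6 * lam ^ 2 * (2928 * M ^ 6 * (lam * lam * (lam + eta)))
   + (M * M + M * M) * (lam ^ 2 / 2 * (2928 * M ^ 7 * (lam * (lam + eta))))).
{ apply Rabs_minus_le; [repeat apply Rabs_plus_le|]; auto.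
  - rewrite Rabs_Ropp; auto.
  - apply Rabs_mult_le; auto.
  - apply Rabs_mult_le; auto; apply Rabs_mult_le; auto.
    rewrite Rabs_pos_eq; nra. }
assert (L3 : 0 <= lam ^ 3) by (apply pow_le; lra).
assert (L4 : 0 <= lam * lam ^ 3) by (apply Rmult_le_pos; lra).
assert (L5 : 0 <= eta * lam ^ 3) by (apply Rmult_le_pos; lra).
assert (Q8 : M ^ 8 <= M ^ 12) by (apply Rle_pow; auto; lia).
assert (Q9 : M ^ 9 <= M ^ 12) by (apply Rle_pow; auto; lia).
assert (Q0 : 0 <= M ^ 12) by (apply pow_le; lra).
assert (R1 := Rmult_le_compat_r _ _ _ L4 Q8).
assert (R2 := Rmult_le_compat_r _ _ _ L5 Q8).
assert (R3 := Rmult_le_compat_r _ _ _ L4 Q9).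
assert (R4 := Rmult_le_compat_r _ _ _ L5 Q9).
assert (R5 := Rmult_le_pos _ _ Q0 L4).
assert (R6 := Rmult_le_pos _ _ Q0 L5).
assert (R7 := Rmult_le_compat_r _ _ _ R5 Hl1).
assert (R8 := Rmult_le_compat_r _ _ _ R6 Hl1).
lra.
Qed.

End Arc.

(** * Differentiability of planar functions *)

Lemma locally_R (t : R) (P : R -> Prop) :
  locally t P <-> exists e, 0 < e /\ forall r, Rabs (r - t) < e -> P r.
Proof.
split.
- intros [e He]; exists e; split; [apply cond_pos|]; intros r Hr; apply He, Hr.
- intros [e [He H]]; exists (mkposreal e He); intros r Hr; apply H, Hr.
Qed.

Lemma continuous_R (f : R -> R) (t : R) :
  continuous f t <-> forall eps, 0 < eps -> exists e, 0 < e /\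
    forall r, Rabs (r - t) < e -> Rabs (f r - f t) < eps.
Proof.
split.
- intros H eps Heps.
  apply (locally_R t (fun r => Rabs (f r - f t) < eps)).
  exact (proj1 (filterlim_locally f (f t)) H (mkposreal eps Heps)).
- intros H; apply filterlim_locally; intros eps.
  apply (locally_R t (fun r => ball (f t) eps (f r))).
  apply H, cond_pos.
Qed.

Lemma locally_2d_2d (P : R -> R -> Prop) (x y : R) :
  locally_2d P x y -> locally_2d (fun u v => locally_2d P u v) x y.
Proof.
intros [e He]; exists (pos_div_2 e); simpl; intros u v Hu Hv.
exists (pos_div_2 e); simpl; intros u' v' Hu' Hv'; apply He.
- replace (u' - x) with ((u' - u) + (u - x)) by ring.
  eapply Rle_lt_trans; [apply Rabs_triang|]; lra.
- replace (v' - y) with ((v' - v) + (v - y)) by ring.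
  eapply Rle_lt_trans; [apply Rabs_triang|]; lra.
Qed.

Lemma locally_2d_mono (P Q : R -> R -> Prop) (x y : R) :
  (forall u v, P u v -> Q u v) -> locally_2d P x y -> locally_2d Q x y.
Proof. intros H [e He]; exists e; auto. Qed.

Lemma locally_2d_curve (P : R -> R -> Prop) (x y : R -> R) (t : R) :
  continuous x t -> continuous y t -> locally_2d P (x t) (y t) ->
  locally t (fun r => P (x r) (y r)).
Proof.
intros Hx Hy [e He].
destruct (proj1 (continuous_R x t) Hx e (cond_pos e)) as [e1 [He1 H1]].
destruct (proj1 (continuous_R y t) Hy e (cond_pos e)) as [e2 [He2 H2]].
apply locally_R; exists (Rmin e1 e2); split; [apply Rmin_pos; auto|].
intros r Hr; apply He; [apply H1|apply H2]; eapply Rlt_le_trans; eauto.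
- apply Rmin_l.
- apply Rmin_r.
Qed.

Lemma continuous_2d_comp (f : R -> R -> R) (x y : R -> R) (t : R) :
  continuity_2d_pt f (x t) (y t) -> continuous x t -> continuous y t ->
  continuous (fun r => f (x r) (y r)) t.
Proof.
intros Hf Hx Hy; apply continuous_R; intros eps Heps; apply locally_R.
exact (locally_2d_curve _ x y t Hx Hy (Hf (mkposreal eps Heps))).
Qed.

Lemma is_derive_comp_2d (f : R -> R -> R) (x y : R -> R) (t x' y' : R) :
  locally_2d (ex_diff_n f 1) (x t) (y t) ->
  is_derive x t x' -> is_derive y t y' ->
  is_derive (fun r => f (x r) (y r)) t
    (du f (x t) (y t) * x' + dv f (x t) (y t) * y').
Proof.
intros Hf Hx Hy; apply is_derive_Reals.
apply derivable_pt_lim_comp_2d; [|apply is_derive_Reals; auto ..].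
apply filterdiff_differentiable_pt_lim.
assert (H0 := locally_2d_singleton _ _ _ Hf); simpl in H0.
destruct H0 as [_ [_ [E2 [[C1 _] _]]]].
eapply filterdiff_ext_lin.
- apply (is_derive_filterdiff f (x t) (y t) (du f) (dv f (x t) (y t))).
  + apply (proj1 (locally_2d_locally
      (fun u v => is_derive (fun z => f z v) u (du f u v)) (x t) (y t))).
    revert Hf; apply locally_2d_mono; intros u v [_ [Huv _]].
    apply Derive_correct, Huv.
  + apply Derive_correct, E2.
  + apply (proj1 (continuity_2d_pt_filterlim (du f) (x t) (y t))), C1.
- intros [u v]; reflexivity.
Qed.

(** Continuity of the derivative is asked at [t] only. This is what [curve_Cn] and [ex_diff_n] give
    at one point, and it is stable under the operations that build the frame of the arc. *)
Definition C1_at (f : R -> R) (t : R) : Prop :=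
  locally t (fun r => ex_derive f r) /\ continuous (Derive f) t.

Lemma C1_at_ex_derive f t : C1_at f t -> ex_derive f t.
Proof. intros [H _]; exact (locally_singleton _ _ H). Qed.

Lemma C1_at_continuous f t : C1_at f t -> continuous f t.
Proof.
intros H; apply (ex_derive_continuous (V := R_NormedModule) f).
apply C1_at_ex_derive, H.
Qed.

Lemma C1_at_intro (f f' : R -> R) t :
  locally t (fun r => is_derive f r (f' r)) -> continuous f' t -> C1_at f t.
Proof.
intros H C; split.
- revert H; apply filter_imp; intros r Hr; eexists; eauto.
- apply (continuous_ext_loc _ f'); auto.
  revert H; apply filter_imp; intros r Hr; symmetry.
  apply is_derive_unique, Hr.
Qed.

Lemma C1_at_ext f g t : locally t (fun r => f r = g r) -> C1_at f t -> C1_at g t.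
Proof.
intros He [H C]; apply C1_at_intro with (Derive f); auto.
apply locally_locally in He.
generalize (filter_and _ _ He H); apply filter_imp; intros r [H1 H2].
apply (is_derive_ext_loc f); auto; apply Derive_correct, H2.
Qed.

Lemma continuous_Rplus (f g : R -> R) t :
  continuous f t -> continuous g t -> continuous (fun r => f r + g r) t.
Proof. intros; apply (continuous_plus (V := R_NormedModule)); auto. Qed.

Lemma continuous_Rmult (f g : R -> R) t :
  continuous f t -> continuous g t -> continuous (fun r => f r * g r) t.
Proof. intros; apply (continuous_mult (K := R_AbsRing)); auto. Qed.

Lemma continuous_Rinv (f : R -> R) t :
  continuous f t -> f t <> 0 -> continuous (fun r => / f r) t.
Proof. intros; apply continuous_Rinv_comp; auto. Qed.

Lemma C1_at_plus f g t : C1_at f t -> C1_at g t -> C1_at (fun r => f r + g r) t.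
Proof.
intros [Hf Cf] [Hg Cg].
apply C1_at_intro with (fun r => Derive f r + Derive g r).
- generalize (filter_and _ _ Hf Hg); apply filter_imp; intros r [H1 H2].
  apply Derive_correct in H1; apply Derive_correct in H2.
  revert H1 H2; generalize (Derive f r) (Derive g r); intros; solve_derive.
- apply continuous_Rplus; auto.
Qed.

Lemma C1_at_mult f g t : C1_at f t -> C1_at g t -> C1_at (fun r => f r * g r) t.
Proof.
intros Hf Hg.
assert (Cf := C1_at_continuous _ _ Hf); assert (Cg := C1_at_continuous _ _ Hg).
destruct Hf as [Hf Df], Hg as [Hg Dg].
apply C1_at_intro with (fun r => Derive f r * g r + f r * Derive g r).
- generalize (filter_and _ _ Hf Hg); apply filter_imp; intros r [H1 H2].
  apply Derive_correct in H1; apply Derive_correct in H2.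
  revert H1 H2; generalize (Derive f r) (Derive g r); intros; solve_derive.
- apply continuous_Rplus; apply continuous_Rmult; auto.
Qed.

Lemma C1_at_const c t : C1_at (fun _ => c) t.
Proof.
apply C1_at_intro with (fun _ => 0).
- apply filter_forall; intros;
    apply (is_derive_const (K := R_AbsRing) (V := R_NormedModule)).
- apply continuous_const.
Qed.

Lemma continuous_nonzero (f : R -> R) t : continuous f t -> f t <> 0 ->
  locally t (fun r => f r <> 0).
Proof.
intros Hf Ht; apply locally_R.
destruct (proj1 (continuous_R f t) Hf (Rabs (f t))) as [e [He H]].
{ apply Rabs_pos_lt, Ht. }
exists e; split; auto; intros r Hr E; specialize (H r Hr).
rewrite E, Rminus_0_l, Rabs_Ropp in H; lra.
Qed.

Lemma continuous_positive (f : R -> R) t : continuous f t -> 0 < f t ->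
  locally t (fun r => 0 < f r).
Proof.
intros Hf Ht; apply locally_R.
destruct (proj1 (continuous_R f t) Hf (f t) Ht) as [e [He H]].
exists e; split; auto; intros r Hr; specialize (H r Hr).
apply Rabs_lt_between in H; lra.
Qed.

Lemma C1_at_inv f t : C1_at f t -> f t <> 0 -> C1_at (fun r => / f r) t.
Proof.
intros Hf Ht.
assert (Cf := C1_at_continuous _ _ Hf).
destruct Hf as [Hf Df].
apply C1_at_intro with (fun r => - 1 * Derive f r * / (f r * f r)).
- generalize (filter_and _ _ Hf (continuous_nonzero f t Cf Ht)).
  apply filter_imp; intros r [H1 H2].
  apply Derive_correct in H1.
  revert H1; generalize (Derive f r); intros; solve_derive; auto; field; auto.
- apply continuous_Rmult;
    [apply continuous_Rmult; [apply continuous_const|auto]|].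
  apply continuous_Rinv; [apply continuous_Rmult; auto|].
  intros E; apply Rmult_integral in E; tauto.
Qed.

Lemma C1_at_sqrt f t : C1_at f t -> 0 < f t -> C1_at (fun r => sqrt (f r)) t.
Proof.
intros Hf Ht.
assert (Cf := C1_at_continuous _ _ Hf).
destruct Hf as [Hf Df].
apply C1_at_intro with (fun r => Derive f r * / (2 * sqrt (f r))).
- generalize (filter_and _ _ Hf (continuous_positive f t Cf Ht)).
  apply filter_imp; intros r [H1 H2].
  apply is_derive_sqrt; auto; apply Derive_correct, H1.
- apply continuous_Rmult; auto.
  apply continuous_Rinv.
  + apply continuous_Rmult; [apply continuous_const|].
    apply continuous_sqrt_comp; auto.
  + assert (0 < sqrt (f t)) by (apply sqrt_lt_R0; auto); lra.
Qed.

Lemma C1_at_comp_2d f x y t :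
  locally_2d (ex_diff_n f 1) (x t) (y t) -> C1_at x t -> C1_at y t ->
  C1_at (fun r => f (x r) (y r)) t.
Proof.
intros Hf Hx Hy.
assert (Cx := C1_at_continuous _ _ Hx); assert (Cy := C1_at_continuous _ _ Hy).
destruct Hx as [Hx Dx], Hy as [Hy Dy].
apply C1_at_intro with (fun r => du f (x r) (y r) * Derive x r
  + dv f (x r) (y r) * Derive y r).
- assert (H := locally_2d_curve _ x y t Cx Cy (locally_2d_2d _ _ _ Hf)).
  generalize (filter_and _ _ H (filter_and _ _ Hx Hy)).
  apply filter_imp; intros r [H1 [H2 H3]].
  apply is_derive_comp_2d; auto; apply Derive_correct; auto.
- assert (H0 := locally_2d_singleton _ _ _ Hf); simpl in H0.
  destruct H0 as [_ [_ [_ [[C1 _] [C2 _]]]]].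
  apply continuous_Rplus; apply continuous_Rmult; auto;
    apply continuous_2d_comp; auto.
Qed.

(** * Locally Lipschitz functions *)

Definition loc_lip (f : R -> R -> R) (u0 v0 : R) : Prop :=
  exists M r, 0 < r /\ (forall u v, Rabs (u - u0) <= r -> Rabs (v - v0) <= r ->
    Rabs (f u v) <= M) /\
  forall u v u' v', Rabs (u - u0) <= r -> Rabs (v - v0) <= r ->
    Rabs (u' - u0) <= r -> Rabs (v' - v0) <= r ->
    Rabs (f u v - f u' v') <= M * (Rabs (u - u') + Rabs (v - v')).

Lemma loc_lip_const c u0 v0 : loc_lip (fun _ _ => c) u0 v0.
Proof.
exists (Rabs c), 1; split; [lra|]; split; intros; [lra|].
rewrite Rminus_diag, Rabs_R0.
apply Rmult_le_pos; [|apply Rplus_le_le_0_compat]; apply Rabs_pos.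
Qed.

Lemma loc_lip_plus f g u0 v0 : loc_lip f u0 v0 -> loc_lip g u0 v0 ->
  loc_lip (fun u v => f u v + g u v) u0 v0.
Proof.
intros [M [r [Hr [Hf Lf]]]] [M' [r' [Hr' [Hg Lg]]]].
pose proof (Rmin_l r r'); pose proof (Rmin_r r r').
exists (M + M'), (Rmin r r'); split; [apply Rmin_pos; auto|]; split.
- intros u v Hu Hv; apply Rabs_plus_le; [apply Hf|apply Hg]; lra.
- intros u v u' v' Hu Hv Hu' Hv'.
  replace (f u v + g u v - (f u' v' + g u' v')) with
    ((f u v - f u' v') + (g u v - g u' v')) by ring.
  rewrite Rmult_plus_distr_r.
  apply Rabs_plus_le; [apply Lf|apply Lg]; lra.
Qed.

Lemma loc_lip_mult f g u0 v0 : loc_lip f u0 v0 -> loc_lip g u0 v0 ->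
  loc_lip (fun u v => f u v * g u v) u0 v0.
Proof.
intros [M [r [Hr [Hf Lf]]]] [M' [r' [Hr' [Hg Lg]]]].
pose proof (Rmin_l r r'); pose proof (Rmin_r r r').
assert (HM : 0 <= M).
{ apply (Rabs_nonneg_bound (f u0 v0)), Hf; rewrite Rminus_diag, Rabs_R0; lra. }
assert (HM' : 0 <= M').
{ apply (Rabs_nonneg_bound (g u0 v0)), Hg; rewrite Rminus_diag, Rabs_R0; lra. }
exists (2 * (M * M')), (Rmin r r'); split; [apply Rmin_pos; auto|]; split.
- intros u v Hu Hv; apply Rle_trans with (M * M'); [|nra].
  apply Rabs_mult_le; [apply Hf|apply Hg]; lra.
- intros u v u' v' Hu Hv Hu' Hv'.
  replace (f u v * g u v - f u' v' * g u' v') with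
    (f u v * (g u v - g u' v') + (f u v - f u' v') * g u' v') by ring.
  set (D := Rabs (u - u') + Rabs (v - v')).
  replace (2 * (M * M') * D) with (M * (M' * D) + M * D * M') by ring.
  apply Rabs_plus_le; apply Rabs_mult_le;
    first [apply Hf | apply Hg | apply Lf | apply Lg]; lra.
Qed.

Lemma loc_lip_inv f u0 v0 : loc_lip f u0 v0 -> f u0 v0 <> 0 ->
  loc_lip (fun u v => / f u v) u0 v0.
Proof.
intros [M [r [Hr [Hf Lf]]]] Hnz.
assert (HM : 0 <= M).
{ apply (Rabs_nonneg_bound (f u0 v0)), Hf; rewrite Rminus_diag, Rabs_R0; lra. }
set (m := Rabs (f u0 v0)); assert (Hm : 0 < m) by (apply Rabs_pos_lt, Hnz).
(* On this box [f] differs from its central value by at most 2 M r' <= m / 2, so it stays at least m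
   / 2 in absolute value. *)
set (r' := Rmin r (m / (4 * (M + 1)))).
assert (Hr' : 0 < r') by (apply Rmin_pos; auto; apply Rdiv_lt_0_compat; lra).
assert (r' <= r) by apply Rmin_l.
assert (Hr4 : 4 * (M + 1) * r' <= m).
{ apply Rle_trans with (4 * (M + 1) * (m / (4 * (M + 1)))).
  - apply Rmult_le_compat_l; [lra|apply Rmin_r].
  - right; field; lra. }
assert (Hlow : forall u v, Rabs (u - u0) <= r' -> Rabs (v - v0) <= r' ->
  m / 2 <= Rabs (f u v)).
{ intros u v Hu Hv.
  assert (H1 : Rabs (f u v - f u0 v0) <= M * (Rabs (u - u0) + Rabs (v - v0))).
  { apply Lf; rewrite ?Rminus_diag, ?Rabs_R0; lra. }
  assert (H2 : m <= Rabs (f u v) + Rabs (f u v - f u0 v0)).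
  { unfold m; replace (f u0 v0) with (f u v - (f u v - f u0 v0)) at 1 by ring.
    apply Rabs_minus_le; lra. }
  assert (M * (Rabs (u - u0) + Rabs (v - v0)) <= M * (r' + r'))
    by (apply Rmult_le_compat_l; lra).
  nra. }
exists (2 / m + 4 * M / (m * m)), r'; split; auto.
assert (Hmm : 0 < m * m) by nra.
assert (0 <= 4 * M / (m * m)) by (apply Rle_mult_inv_pos; lra).
assert (0 < 2 / m) by (apply Rdiv_lt_0_compat; lra).
assert (Hinv : forall u v, Rabs (u - u0) <= r' -> Rabs (v - v0) <= r' ->
  f u v <> 0 /\ Rabs (/ f u v) <= 2 / m).
{ intros u v Hu Hv; assert (H3 := Hlow u v Hu Hv).
  assert (Hn : f u v <> 0) by (intros E; rewrite E, Rabs_R0 in H3; lra).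
  split; auto; rewrite Rabs_inv.
  replace (2 / m) with (/ (m / 2)) by (field; lra).
  apply Rinv_le_contravar; lra. }
split.
- intros u v Hu Hv; destruct (Hinv u v Hu Hv); lra.
- intros u v u' v' Hu Hv Hu' Hv'.
  destruct (Hinv u v Hu Hv) as [N1 B1], (Hinv u' v' Hu' Hv') as [N2 B2].
  replace (/ f u v - / f u' v') with
    (- ((f u v - f u' v') * (/ f u v * / f u' v'))) by (field; auto).
  rewrite Rabs_Ropp.
  set (D := Rabs (u - u') + Rabs (v - v')).
  assert (0 <= D) by (apply Rplus_le_le_0_compat; apply Rabs_pos).
  apply Rle_trans with (M * D * (2 / m * (2 / m))).
  + apply Rabs_mult_le; [apply Lf; lra|apply Rabs_mult_le; auto].
  + replace (M * D * (2 / m * (2 / m))) with (4 * M / (m * m) * D)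
      by (field; lra).
    apply Rmult_le_compat_r; lra.
Qed.

(** Continuity of the partial derivatives at the centre bounds them on a box by their central values
    plus 1; the mean value theorem is then applied to one coordinate at a time. *)
Lemma loc_lip_C1 f u0 v0 : locally_2d (ex_diff_n f 1) u0 v0 -> loc_lip f u0 v0.
Proof.
intros H.
assert (H0 := locally_2d_singleton _ _ _ H); simpl in H0.
destruct H0 as [C0 [_ [_ [[C1 _] [C2 _]]]]].
destruct H as [e0 He0].
destruct (C0 (mkposreal 1 Rlt_0_1)) as [e3 He3]; simpl in He3.
destruct (C1 (mkposreal 1 Rlt_0_1)) as [e1 He1]; simpl in He1.
destruct (C2 (mkposreal 1 Rlt_0_1)) as [e2 He2]; simpl in He2.
set (e := Rmin (Rmin e0 e3) (Rmin e1 e2)).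
assert (He : 0 < e) by (repeat apply Rmin_pos; apply cond_pos).
assert (L0 : e <= e0)
  by (eapply Rle_trans; [apply Rmin_l|apply Rmin_l]).
assert (L3 : e <= e3)
  by (eapply Rle_trans; [apply Rmin_l|apply Rmin_r]).
assert (L1 : e <= e1)
  by (eapply Rle_trans; [apply Rmin_r|apply Rmin_l]).
assert (L2 : e <= e2)
  by (eapply Rle_trans; [apply Rmin_r|apply Rmin_r]).
set (M := Rabs (f u0 v0) + Rabs (du f u0 v0) + Rabs (dv f u0 v0) + 1).
pose proof (Rabs_pos (f u0 v0)); pose proof (Rabs_pos (du f u0 v0)).
pose proof (Rabs_pos (dv f u0 v0)).
assert (near : forall h h0 : R, Rabs (h - h0) < 1 -> Rabs h0 + 1 <= M ->
  Rabs h <= M).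
{ intros h h0 Hh HM; replace h with ((h - h0) + h0) by ring.
  eapply Rle_trans; [apply Rabs_triang|]; lra. }
exists M, (e / 2); split; [lra|]; split.
- intros u v Hu Hv; apply near with (f u0 v0); [apply He3; lra|unfold M; lra].
- intros u v u' v' Hu Hv Hu' Hv'.
  assert (between : forall a b c z : R, Rmin a b <= z <= Rmax a b ->
    Rabs (a - c) <= e / 2 -> Rabs (b - c) <= e / 2 -> Rabs (z - c) < e).
  { intros a b c z Hz Ha Hb.
    apply Rabs_le_between in Ha; apply Rabs_le_between in Hb.
    unfold Rmin, Rmax in Hz; destruct (Rle_dec a b); apply Rabs_lt_between; lra. }
  replace (f u v - f u' v') with ((f u v - f u' v) + (f u' v - f u' v')) by ring.
  rewrite Rmult_plus_distr_l; apply Rabs_plus_le.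
  + destruct (MVT_gen (fun z => f z v) u' u (fun z => du f z v)) as [z [Hz E]].
    * intros z Hz; apply Derive_correct.
      apply (He0 z v); [|lra].
      apply Rlt_le_trans with e; auto.
      apply (between u' u); auto; lra.
    * intros z Hz; apply continuity_pt_filterlim.
      apply (ex_derive_continuous (V := R_NormedModule) (fun z => f z v)).
      apply (He0 z v); [|lra].
      apply Rlt_le_trans with e; auto.
      apply (between u' u); auto; lra.
    * rewrite E; apply Rabs_mult_le; [|lra].
      apply near with (du f u0 v0); [|unfold M; lra].
      apply He1; [|lra].
      apply Rlt_le_trans with e; auto.
      apply (between u' u); auto.
  + destruct (MVT_gen (fun z => f u' z) v' v (fun z => dv f u' z))
      as [z [Hz E]].
    * intros z Hz; apply Derive_correct.
      apply (He0 u' z); [lra|].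
      apply Rlt_le_trans with e; auto.
      apply (between v' v); auto; lra.
    * intros z Hz; apply continuity_pt_filterlim.
      apply (ex_derive_continuous (V := R_NormedModule) (fun z => f u' z)).
      apply (He0 u' z); [lra|].
      apply Rlt_le_trans with e; auto.
      apply (between v' v); auto; lra.
    * rewrite E; apply Rabs_mult_le; [|lra].
      apply near with (dv f u0 v0); [|unfold M; lra].
      apply He2; [lra|].
      apply Rlt_le_trans with e; auto.
      apply (between v' v); auto.
Qed.

Definition clamp (c r u : R) : R := Rmax (c - r) (Rmin (c + r) u).

Lemma clamp_in c r u : 0 <= r -> Rabs (clamp c r u - c) <= r.
Proof.
intros Hr; unfold clamp, Rmax, Rmin; apply Rabs_le.
destruct (Rle_dec (c + r) u); destruct (Rle_dec (c - r) _); lra.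
Qed.

Lemma clamp_lip c r u u' : Rabs (clamp c r u - clamp c r u') <= Rabs (u - u').
Proof.
assert (H := Rle_abs (u - u')); assert (H' := Rle_abs (- (u - u'))).
rewrite Rabs_Ropp in H'.
unfold clamp, Rmax, Rmin; apply Rabs_le.
destruct (Rle_dec (c + r) u), (Rle_dec (c + r) u');
  repeat destruct (Rle_dec (c - r) _); lra.
Qed.

Lemma clamp_id c r u : Rabs (u - c) <= r -> clamp c r u = u.
Proof.
intros H; apply Rabs_le_between in H; unfold clamp.
rewrite Rmin_right, Rmax_right; lra.
Qed.

(** Clamping the coordinates to a box makes the connection globally bounded and
    Lipschitz without changing it on the box. *)
Definition clamp2 (u0 v0 r : R) (f : R -> R -> R) (u v : R) : R :=
  f (clamp u0 r u) (clamp v0 r v).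

(** Stated for all larger [M] and all smaller [r], so that one constant and one box can serve the
    six Christoffel symbols together. *)
Lemma loc_lip_clamp f u0 v0 : loc_lip f u0 v0 -> exists M0 r0, 0 < r0 /\
  forall M r, M0 <= M -> 0 < r <= r0 -> bounded_lip M (clamp2 u0 v0 r f).
Proof.
intros [M0 [r0 [Hr0 [Hf Lf]]]]; exists M0, r0; split; auto.
intros M r HM Hr.
assert (Hin : forall c u, Rabs (clamp c r u - c) <= r0).
{ intros c u; eapply Rle_trans; [apply clamp_in|]; lra. }
assert (HM0 : 0 <= M0).
{ apply (Rabs_nonneg_bound (f u0 v0)), Hf; rewrite Rminus_diag, Rabs_R0; lra. }
split; unfold clamp2.
- intros u v; apply Rle_trans with M0; auto.
- intros u v u' v'; eapply Rle_trans; [apply Lf; auto|].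
  pose proof (clamp_lip u0 r u u'); pose proof (clamp_lip v0 r v v').
  apply Rmult_le_compat; try lra.
  apply Rplus_le_le_0_compat; apply Rabs_pos.
Qed.

(** * Metric and Levi-Civita connection in a chart *)

Section Surface.
Variables (S : surface) (g : metric S).

Lemma cimg_point (i : chart S) (p : point S) :
  cdom i p -> cimg S i (cx i p) (cy i p).
Proof. intros H; unfold cimg, in_image; rewrite cinvK; auto. Qed.

Lemma cimg_open (i : chart S) u v : cimg S i u v -> locally_2d (cimg S i) u v.
Proof.
intros H; generalize (overlap_open S i i H (proj1 H)).
apply locally_2d_mono; tauto.
Qed.

Lemma metric_C1 (i : chart S) u v : cimg S i u v ->
  locally_2d (ex_diff_n (gE g i) 1) u v /\
  locally_2d (ex_diff_n (gF g i) 1) u v /\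
  locally_2d (ex_diff_n (gG g i) 1) u v.
Proof.
intros H; apply cimg_open in H.
repeat split; revert H; apply locally_2d_mono; intros u' v' H;
  destruct (metric_C3 g H) as [? [? ?]];
  apply (ex_diff_n_m 3); auto; lia.
Qed.

Lemma metric_loc_lip (i : chart S) u v : cimg S i u v ->
  forall f, f = gE g i \/ f = gF g i \/ f = gG g i ->
  loc_lip f u v /\ loc_lip (du f) u v /\ loc_lip (dv f) u v.
Proof.
intros H f Hf; apply cimg_open in H.
assert (H3 : locally_2d (ex_diff_n f 3) u v).
{ revert H; apply locally_2d_mono; intros u' v' H.
  destruct (metric_C3 g H) as [? [? ?]].
  destruct Hf as [-> | [-> | ->]]; auto. }
repeat split; apply loc_lip_C1; revert H3; apply locally_2d_mono;
  intros u' v' H3.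
- eapply ex_diff_n_m; [|exact H3]; lia.
- apply ex_diff_n_deriv_aux1 in H3; eapply ex_diff_n_m; [|exact H3]; lia.
- apply ex_diff_n_deriv_aux2 in H3; eapply ex_diff_n_m; [|exact H3]; lia.
Qed.

Definition conn1 (i : chart S) : qfield :=
  QField (chr1_11 (gE g i) (gF g i) (gG g i))
         (chr1_12 (gE g i) (gF g i) (gG g i))
         (chr1_22 (gE g i) (gF g i) (gG g i)).
Definition conn2 (i : chart S) : qfield :=
  QField (chr2_11 (gE g i) (gF g i) (gG g i))
         (chr2_12 (gE g i) (gF g i) (gG g i))
         (chr2_22 (gE g i) (gF g i) (gG g i)).

Lemma conn_loc_lip (i : chart S) u v : cimg S i u v ->
  forall B, B = conn1 i \/ B = conn2 i ->
  loc_lip (qa B) u v /\ loc_lip (qb B) u v /\ loc_lip (qc B) u v.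
Proof.
intros H.
destruct (metric_loc_lip i u v H (gE g i)) as [E [Eu Ev]]; auto.
destruct (metric_loc_lip i u v H (gF g i)) as [F [Fu Fv]]; auto.
destruct (metric_loc_lip i u v H (gG g i)) as [G [Gu Gv]]; auto.
destruct (metric_pos g H) as [_ Hdet].
assert (Hm : forall f h, loc_lip f u v -> loc_lip h u v ->
  loc_lip (fun u v => f u v - h u v) u v).
{ intros f h Hf Hh.
  assert (K := loc_lip_plus f (fun u v => -1 * h u v) u v Hf
    (loc_lip_mult (fun _ _ => -1) h u v (loc_lip_const _ _ _) Hh)).
  destruct K as [M [r [Hr [K1 K2]]]]; exists M, r; split; auto.
  split.
  - intros u' v' **; replace (f u' v' - h u' v') with (f u' v' + -1 * h u' v')
      by ring; auto.
  - intros u1 v1 u2 v2 **; replace (f u1 v1 - h u1 v1 - (f u2 v2 - h u2 v2))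
      with (f u1 v1 + -1 * h u1 v1 - (f u2 v2 + -1 * h u2 v2)) by ring; auto. }
assert (D : loc_lip (fun u v => 2 * detg (gE g i) (gF g i) (gG g i) u v) u v).
{ apply loc_lip_mult; [apply loc_lip_const|].
  unfold detg; apply Hm; [apply loc_lip_mult; auto|].
  apply loc_lip_mult; [auto|apply loc_lip_mult; auto using loc_lip_const]. }
assert (D' : loc_lip (fun u v => / (2 * detg (gE g i) (gF g i) (gG g i) u v)) u v).
{ apply loc_lip_inv; auto; unfold detg; lra. }
intros B [-> | ->]; repeat split; simpl;
  unfold chr1_11, chr1_12, chr1_22, chr2_11, chr2_12, chr2_22;
  (apply loc_lip_mult; [|exact D']);
  repeat first [assumption | apply loc_lip_const | apply Hm
               | apply loc_lip_plus | apply loc_lip_mult].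
Qed.

Lemma cov1E (i : chart S) c V W t : cov1 g i c V W t =
  Derive V t + ev (conn1 i) (cx i (c t)) (cy i (c t))
    (velx S i c t) (vely S i c t) (V t) (W t).
Proof. unfold cov1, ev; simpl; ring. Qed.

Lemma cov2E (i : chart S) c V W t : cov2 g i c V W t =
  Derive W t + ev (conn2 i) (cx i (c t)) (cy i (c t))
    (velx S i c t) (vely S i c t) (V t) (W t).
Proof. unfold cov2, ev; simpl; ring. Qed.

(** Lowering of the index: [flat1] and [flat2] are the components of the covector <(a, b), .>. *)
Definition flat1 (i : chart S) (u v a b : R) : R := gE g i u v * a + gF g i u v * b.
Definition flat2 (i : chart S) (u v a b : R) : R := gF g i u v * a + gG g i u v * b.
Definition gquad (i : chart S) (u v a b : R) : R :=
  quad (gE g i u v) (gF g i u v) (gG g i u v) a b.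

Lemma gquadE i u v a b : gquad i u v a b = flat1 i u v a b * a + flat2 i u v a b * b.
Proof. unfold gquad, quad, flat1, flat2; ring. Qed.

Lemma gquad_ge0 (i : chart S) u v a b : cimg S i u v -> 0 <= gquad i u v a b.
Proof.
intros H; destruct (metric_pos g H) as [HE HD].
unfold gquad, quad; set (E := gE g i u v) in *; set (F := gF g i u v) in *.
set (G := gG g i u v) in *.
replace (E * a ^ 2 + 2 * F * a * b + G * b ^ 2) with
  (((E * a + F * b) ^ 2 + (E * G - F ^ 2) * b ^ 2) / E) by (field; lra).
apply Rle_mult_inv_pos; auto.
assert (0 <= b ^ 2) by apply pow2_ge_0.
assert (0 <= (E * a + F * b) ^ 2) by apply pow2_ge_0; nra.
Qed.

Section FlatDerive.
Variables (i : chart S) (x y V W : R -> R) (t x' y' V' W' : R).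
Hypotheses (Hxy : cimg S i (x t) (y t))
  (Hx : is_derive x t x') (Hy : is_derive y t y')
  (HV : is_derive V t V') (HW : is_derive W t W').
Let c1 := V' + ev (conn1 i) (x t) (y t) x' y' (V t) (W t).
Let c2 := W' + ev (conn2 i) (x t) (y t) x' y' (V t) (W t).
Let P := flat1 i (x t) (y t) (V t) (W t).
Let Q := flat2 i (x t) (y t) (V t) (W t).

(** Compatibility of the connection with the metric: lowering the index commutes with covariant
    differentiation, [c1] and [c2] being the components of the covariant derivative of (V, W). In
    coordinates it is an identity between the Christoffel formulas, left to [field]. *)
Lemma flat1_derive :
  is_derive (fun r => flat1 i (x r) (y r) (V r) (W r)) t
    (P * ev (conn1 i) (x t) (y t) x' y' 1 0
     + Q * ev (conn2 i) (x t) (y t) x' y' 1 0 + flat1 i (x t) (y t) c1 c2).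
Proof.
destruct (metric_C1 i _ _ Hxy) as [CE [CF CG]].
assert (DE := is_derive_comp_2d _ x y t x' y' CE Hx Hy).
assert (DF := is_derive_comp_2d _ x y t x' y' CF Hx Hy).
destruct (metric_pos g Hxy) as [_ Hdet].
unfold flat1.
set (e := fun r => gE g i (x r) (y r)) in *.
set (f := fun r => gF g i (x r) (y r)) in *.
change (is_derive (fun r => e r * V r + f r * W r) t
  (P * ev (conn1 i) (x t) (y t) x' y' 1 0
     + Q * ev (conn2 i) (x t) (y t) x' y' 1 0 + (e t * c1 + f t * c2))).
solve_derive.
unfold P, Q, flat1, flat2, c1, c2, e, f, ev; simpl.
unfold chr1_11, chr1_12, chr1_22, chr2_11, chr2_12, chr2_22, detg.
field; simpl in Hdet; lra.
Qed.

Lemma flat2_derive :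
  is_derive (fun r => flat2 i (x r) (y r) (V r) (W r)) t
    (P * ev (conn1 i) (x t) (y t) x' y' 0 1
     + Q * ev (conn2 i) (x t) (y t) x' y' 0 1 + flat2 i (x t) (y t) c1 c2).
Proof.
destruct (metric_C1 i _ _ Hxy) as [CE [CF CG]].
assert (DF := is_derive_comp_2d _ x y t x' y' CF Hx Hy).
assert (DG := is_derive_comp_2d _ x y t x' y' CG Hx Hy).
destruct (metric_pos g Hxy) as [_ Hdet].
unfold flat2.
set (e := fun r => gF g i (x r) (y r)) in *.
set (f := fun r => gG g i (x r) (y r)) in *.
change (is_derive (fun r => e r * V r + f r * W r) t
  (P * ev (conn1 i) (x t) (y t) x' y' 0 1
     + Q * ev (conn2 i) (x t) (y t) x' y' 0 1 + (e t * c1 + f t * c2))).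
solve_derive.
unfold P, Q, flat1, flat2, c1, c2, e, f, ev; simpl.
unfold chr1_11, chr1_12, chr1_22, chr2_11, chr2_12, chr2_22, detg.
field; simpl in Hdet; lra.
Qed.

Lemma gquad_derive :
  is_derive (fun r => gquad i (x r) (y r) (V r) (W r)) t
    (2 * (P * c1 + Q * c2)).
Proof.
assert (D1 := flat1_derive); assert (D2 := flat2_derive).
apply (is_derive_ext (fun r => flat1 i (x r) (y r) (V r) (W r) * V r
  + flat2 i (x r) (y r) (V r) (W r) * W r)).
{ intros; rewrite gquadE; reflexivity. }
set (e := fun r => flat1 i (x r) (y r) (V r) (W r)) in *.
set (f := fun r => flat2 i (x r) (y r) (V r) (W r)) in *.
change (is_derive (fun r => e r * V r + f r * W r) t
  (2 * (P * c1 + Q * c2))).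
solve_derive.
change (e t) with P; change (f t) with Q.
unfold P, Q, c1, c2, flat1, flat2, ev; ring.
Qed.

End FlatDerive.

(** ** Curves in charts *)

Lemma locally_between (a b t : R) : a < t < b -> locally t (fun r => a < r < b).
Proof.
intros H; apply locally_R; exists (Rmin (t - a) (b - t)); split.
- apply Rmin_pos; lra.
- intros r Hr; assert (H1 := Rmin_l (t - a) (b - t)).
  assert (H2 := Rmin_r (t - a) (b - t)); apply Rabs_lt_between in Hr; lra.
Qed.

Section Curve.
Variables (n : nat) (a b : R) (c : R -> point S).
Hypotheses (Hn : (1 <= n)%nat) (Hc : curve_Cn S n a b c).
Variables (i : chart S) (t : R).
Hypotheses (Ht : a < t < b) (Hi : cdom i (c t)).

Lemma curve_dom : locally t (fun r => a < r < b /\ cdom i (c r)).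
Proof.
apply filter_and; [apply locally_between, Ht|]; apply (Hc t Ht i Hi).
Qed.

Lemma curve_derive : is_derive (fun r => cx i (c r)) t (velx S i c t) /\
  is_derive (fun r => cy i (c r)) t (vely S i c t).
Proof.
destruct (Hc t Ht i Hi) as [_ H].
split; apply Derive_correct.
- apply (proj1 (H _ (or_introl eq_refl)) 1%nat Hn).
- apply (proj1 (H _ (or_intror eq_refl)) 1%nat Hn).
Qed.

Lemma curve_derive2 : (2 <= n)%nat ->
  is_derive (velx S i c) t (Derive (velx S i c) t) /\
  is_derive (vely S i c) t (Derive (vely S i c) t).
Proof.
intros Hn2; destruct (Hc t Ht i Hi) as [_ H].
split; apply Derive_correct.
- apply (proj1 (H _ (or_introl eq_refl)) 2%nat Hn2).
- apply (proj1 (H _ (or_intror eq_refl)) 2%nat Hn2).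
Qed.

End Curve.

(** The differential of the transition map relates the velocities in two
    charts, so that [metric_compat] makes the speed intrinsic. *)
Lemma speed_chart n a b c i t : (1 <= n)%nat -> curve_Cn S n a b c ->
  a < t < b -> cdom i (c t) -> speed g c t = speed_in g i c t.
Proof.
intros Hn Hc Ht Hi.
set (j := chart_at (c t)); assert (Hj : cdom j (c t)) by apply chart_atP.
destruct (curve_derive n a b c Hn Hc j t Ht Hj) as [Dx Dy].
set (X := fun u v => cx i (cinv j u v)); set (Y := fun u v => cy i (cinv j u v)).
assert (Hinv : cinv j (cx j (c t)) (cy j (c t)) = c t) by (apply cinvK; auto).
assert (Hov := overlap_open S j i (cimg_point j (c t) Hj)).
rewrite Hinv in Hov; specialize (Hov Hi).
assert (HX : locally_2d (ex_diff_n X 1) (cx j (c t)) (cy j (c t))).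
{ revert Hov; apply locally_2d_mono; intros u v [H1 H2].
  apply (ex_diff_n_m 4); [lia|]; apply (transition_C4 S j i H1 H2). }
assert (HY : locally_2d (ex_diff_n Y 1) (cx j (c t)) (cy j (c t))).
{ revert Hov; apply locally_2d_mono; intros u v [H1 H2].
  apply (ex_diff_n_m 4); [lia|]; apply (transition_C4 S j i H1 H2). }
assert (DX := is_derive_comp_2d X _ _ t _ _ HX Dx Dy).
assert (DY := is_derive_comp_2d Y _ _ t _ _ HY Dx Dy).
assert (HL : locally t (fun r => cinv j (cx j (c r)) (cy j (c r)) = c r)).
{ generalize (curve_dom n a b c Hc j t Ht Hj); apply filter_imp.
  intros r [_ Hr]; apply cinvK, Hr. }
assert (EX : velx S i c t = du X (cx j (c t)) (cy j (c t)) * velx S j c t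
  + dv X (cx j (c t)) (cy j (c t)) * vely S j c t).
{ apply is_derive_unique; eapply is_derive_ext_loc; [|exact DX].
  revert HL; apply filter_imp; intros r Hr; unfold X; rewrite Hr; reflexivity. }
assert (EY : vely S i c t = du Y (cx j (c t)) (cy j (c t)) * velx S j c t
  + dv Y (cx j (c t)) (cy j (c t)) * vely S j c t).
{ apply is_derive_unique; eapply is_derive_ext_loc; [|exact DY].
  revert HL; apply filter_imp; intros r Hr; unfold Y; rewrite Hr; reflexivity. }
unfold speed, speed_in, norm_in; fold j; f_equal.
assert (Hi' : cdom i (cinv j (cx j (c t)) (cy j (c t)))) by (rewrite Hinv; auto).
assert (K := metric_compat g i (cimg_point j (c t) Hj) Hi'
  (velx S j c t) (vely S j c t)).
cbv zeta in K; fold X Y in K; rewrite K, <- EX, <- EY.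
unfold X, Y; rewrite Hinv; reflexivity.
Qed.

Lemma speed_sqr n a b c i t : (1 <= n)%nat -> curve_Cn S n a b c ->
  a < t < b -> cdom i (c t) ->
  speed g c t ^ 2 = gquad i (cx i (c t)) (cy i (c t)) (velx S i c t) (vely S i c t).
Proof.
intros Hn Hc Ht Hi; rewrite (speed_chart n a b c i t); auto.
unfold speed_in, norm_in; apply pow2_sqrt, gquad_ge0, cimg_point, Hi.
Qed.

Lemma speed_ge0 c t : 0 <= speed g c t.
Proof. apply sqrt_pos. Qed.

Lemma geodesic_acc l r c i t : geodesic g l r c -> l < t < r -> cdom i (c t) ->
  is_derive (velx S i c) t (- ev (conn1 i) (cx i (c t)) (cy i (c t))
    (velx S i c t) (vely S i c t) (velx S i c t) (vely S i c t)) /\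
  is_derive (vely S i c) t (- ev (conn2 i) (cx i (c t)) (cy i (c t))
    (velx S i c t) (vely S i c t) (velx S i c t) (vely S i c t)).
Proof.
intros [Hc Hg] Ht Hi.
destruct (curve_derive2 2 l r c Hc i t Ht Hi (le_n _)) as [D1 D2].
destruct (Hg t Ht i Hi) as [E1 E2]; rewrite cov1E in E1; rewrite cov2E in E2.
split.
- replace (- _) with (Derive (velx S i c) t) by lra; auto.
- replace (- _) with (Derive (vely S i c) t) by lra; auto.
Qed.

(** The derivative of <V, V> is 2 <V, nabla V> = 0. The chart is chosen afresh at each time, since
    the geodesic need not lie in a single one. *)
Lemma geodesic_speed l r c t t' : geodesic g l r c ->
  l < t < r -> l < t' < r -> speed g c t = speed g c t'.
Proof.
intros Hg Ht Ht'.
assert (Hlt : forall t t', l < t -> t < t' -> t' < r ->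
  speed g c t = speed g c t').
{ clear t t' Ht Ht'; intros t t' Ht Htt Ht'.
  assert (E : speed g c t ^ 2 = speed g c t' ^ 2).
  { apply (eq_is_derive (fun t => speed g c t ^ 2)); auto.
    intros s Hs; assert (Hs' : l < s < r) by lra.
    set (i := chart_at (c s)); assert (Hi : cdom i (c s)) by apply chart_atP.
    destruct (curve_derive 2 l r c ltac:(lia) (proj1 Hg) i s Hs' Hi) as [D1 D2].
    destruct (geodesic_acc l r c i s Hg Hs' Hi) as [D3 D4].
    apply (is_derive_ext_loc (fun s => gquad i (cx i (c s)) (cy i (c s))
      (velx S i c s) (vely S i c s))).
    - generalize (curve_dom 2 l r c (proj1 Hg) i s Hs' Hi); apply filter_imp.
      intros s' [H1 H2]; symmetry;
      eapply speed_sqr with (n := 2%nat) (a := l) (b := r); auto.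
      apply Hg.
    - assert (D := gquad_derive i _ _ _ _ s _ _ _ _ (cimg_point i _ Hi) D1 D2 D3 D4).
      cbv beta in D.
      match type of D with is_derive _ _ ?u =>
        replace u with (@zero R_NormedModule) in D end; auto.
      unfold zero; simpl; ring. }
  rewrite <- (sqrt_pow2 (speed g c t)), <- (sqrt_pow2 (speed g c t'))
    by apply speed_ge0; congruence. }
destruct (Rtotal_order t t') as [H | [-> | H]]; auto.
- apply Hlt; lra.
- symmetry; apply Hlt; lra.
Qed.

Lemma geodesic_arclength l r c w : geodesic g l r c ->
  l < 0 < r -> l < w < r -> arclength g c 0 w = Rabs w * speed g c 0.
Proof.
intros Hg H0 Hw; unfold arclength.
rewrite (RInt_ext _ (fun _ => speed g c 0)).
- rewrite RInt_const; unfold scal; simpl; unfold mult; simpl.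
  rewrite Rabs_mult, (Rabs_pos_eq (speed g c 0)) by apply speed_ge0.
  rewrite Rminus_0_r; reflexivity.
- intros x Hx; apply (geodesic_speed l r); auto.
  unfold Rmin, Rmax in Hx; destruct (Rle_dec 0 w); lra.
Qed.

End Surface.

(** * Real induction *)

Lemma real_induction (P : R -> Prop) (a b : R) : P a ->
  (forall x, a <= x < b -> (forall y, a <= y <= x -> P y) ->
     exists e, 0 < e /\ forall y, x < y < x + e -> y <= b -> P y) ->
  (forall x, a < x <= b -> (forall y, a <= y < x -> P y) -> P x) ->
  forall x, a <= x <= b -> P x.
Proof.
intros Pa Hopen Hclosed x Hx.
set (E := fun x => a <= x <= b /\ forall y, a <= y <= x -> P y).
assert (Ea : E a).
{ split; [lra|]; intros y Hy; replace y with a by lra; exact Pa. }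
destruct (completeness E) as [m [Hub Hlub]].
{ exists b; intros z [Hz _]; lra. }
{ exists a; exact Ea. }
assert (Ham : a <= m) by (apply Hub, Ea).
assert (Hmb : m <= b) by (apply Hlub; intros z [Hz _]; lra).
assert (Hlt : forall y, a <= y < m -> P y).
{ intros y Hy; apply NNPP; intros Hn.
  assert (m <= y); [|lra].
  apply Hlub; intros z [Hz1 Hz2].
  destruct (Rle_or_lt z y) as [|Hyz]; auto.
  exfalso; apply Hn, Hz2; lra. }
assert (Hm : forall y, a <= y <= m -> P y).
{ intros y Hy; destruct (Rlt_or_le y m); [apply Hlt; lra|].
  replace y with m by lra; destruct (Rle_lt_or_eq_dec a m Ham) as [H'|H'].
  - apply Hclosed; auto; lra.
  - rewrite <- H'; exact Pa. }
destruct (Rle_lt_or_eq_dec m b Hmb) as [Hlt'|Heq]; [|apply Hm; lra].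
destruct (Hopen m ltac:(lra) Hm) as [e [He Hstep]].
set (z := Rmin b (m + e / 2)).
assert (Hz : m < z) by (apply Rmin_glb_lt; lra).
assert (Hz2 : z <= m + e / 2) by apply Rmin_r.
assert (Hz3 : z <= b) by apply Rmin_l.
assert (z <= m); [|lra].
apply Hub; split; [lra|]; intros y Hy.
destruct (Rle_or_lt y m); [apply Hm; lra|apply Hstep; lra].
Qed.

(** X(y) + D y is nondecreasing and bounded, so its supremum provides the left limit. *)
Lemma lipschitz_left_limit (X : R -> R) (x D : R) : 0 <= D -> 0 < x ->
  (forall y y', 0 <= y < x -> 0 <= y' < x ->
     Rabs (X y - X y') <= D * Rabs (y - y')) ->
  exists L, forall y, 0 <= y < x -> Rabs (X y - L) <= D * (x - y).
Proof.
intros HD Hx HL.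
assert (Hle : forall y y', 0 <= y < x -> 0 <= y' < x -> y <= y' ->
  - (D * (y' - y)) <= X y' - X y <= D * (y' - y)).
{ intros y y' Hy Hy' H; specialize (HL y' y Hy' Hy).
  rewrite (Rabs_pos_eq (y' - y)) in HL by lra; apply Rabs_le_between; auto. }
set (E := fun v => exists y, 0 <= y < x /\ v = X y + D * y).
destruct (completeness E) as [m [Hub Hlub]].
{ exists (X 0 + 2 * D * x); intros v [y [Hy ->]].
  specialize (Hle 0 y ltac:(lra) Hy ltac:(lra)); nra. }
{ exists (X 0 + D * 0), 0; split; [lra|auto]. }
exists (m - D * x); intros y Hy.
assert (H1 : X y + D * y <= m) by (apply Hub; exists y; auto).
assert (H2 : m <= X y - D * y + 2 * D * x).
{ apply Hlub; intros v [z [Hz ->]]; destruct (Rle_or_lt y z).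
  - specialize (Hle y z Hy Hz ltac:(lra)); nra.
  - specialize (Hle z y Hz Hy ltac:(lra)); nra. }
apply Rabs_le; lra.
Qed.

(** * Short geodesics stay in a coordinate box *)

Definition qclamp (u0 v0 r : R) (B : qfield) : qfield :=
  QField (clamp2 u0 v0 r (qa B)) (clamp2 u0 v0 r (qb B)) (clamp2 u0 v0 r (qc B)).

Lemma ev_qclamp u0 v0 r B x y v1 v2 w1 w2 :
  Rabs (x - u0) <= r -> Rabs (y - v0) <= r ->
  ev (qclamp u0 v0 r B) x y v1 v2 w1 w2 = ev B x y v1 v2 w1 w2.
Proof.
intros Hx Hy; unfold ev, qclamp, clamp2; simpl; rewrite !clamp_id; auto.
Qed.

Section Trap.
Variables (S : surface) (g : metric S) (i : chart S) (u0 v0 rad M : R).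
Hypotheses (Hrad : 0 < rad) (HM : 0 <= M)
  (Hbox : forall u v, Rabs (u - u0) <= rad -> Rabs (v - v0) <= rad ->
     cimg S i u v)
  (Hnorm : forall u v a b, Rabs (u - u0) <= rad -> Rabs (v - v0) <= rad ->
     Rabs a <= M * sqrt (gquad S g i u v a b) /\
     Rabs b <= M * sqrt (gquad S g i u v a b)).

Section Geodesic.
Variables (l r w : R) (c : R -> point S).
Hypotheses (H0 : l < 0 < r) (Hw : l < w < r) (Hg : geodesic g l r c)
  (Hi : cdom i (c 0))
  (Hu : Rabs (cx i (c 0) - u0) <= rad / 2)
  (Hv : Rabs (cy i (c 0) - v0) <= rad / 2)
  (HD : M * (Rabs w * speed g c 0) < rad / 2).

Let D := M * (Rabs w * speed g c 0).
Let X (t : R) := cx i (c (w * t)).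
Let Y (t : R) := cy i (c (w * t)).

Lemma scaled_between t : 0 <= t <= 1 -> l < w * t < r.
Proof.
intros Ht; split.
- destruct (Rle_or_lt 0 w); nra.
- destruct (Rle_or_lt 0 w); nra.
Qed.

Lemma scaled_derive t : 0 <= t <= 1 -> cdom i (c (w * t)) ->
  is_derive X t (w * velx S i c (w * t)) /\
  is_derive Y t (w * vely S i c (w * t)) /\
  is_derive (fun t => w * velx S i c (w * t)) t
    (- ev (conn1 S g i) (X t) (Y t) (w * velx S i c (w * t))
         (w * vely S i c (w * t)) (w * velx S i c (w * t))
         (w * vely S i c (w * t))) /\
  is_derive (fun t => w * vely S i c (w * t)) t
    (- ev (conn2 S g i) (X t) (Y t) (w * velx S i c (w * t))
         (w * vely S i c (w * t)) (w * velx S i c (w * t))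
         (w * vely S i c (w * t))).
Proof.
intros Ht Hd; assert (Hb := scaled_between t Ht).
destruct (curve_derive S 2 l r c ltac:(lia) (proj1 Hg) i _ Hb Hd) as [D1 D2].
destruct (geodesic_acc S g l r c i _ Hg Hb Hd) as [D3 D4].
assert (Hlin : is_derive (fun t => w * t) t w) by (auto_derive; auto; ring).
assert (Hcomp : forall (f : R -> R) (f' : R), is_derive f (w * t) f' ->
  is_derive (fun t => f (w * t)) t (w * f')).
{ intros f f' Hf; apply (is_derive_comp f (fun t => w * t) t f' w Hf Hlin). }
assert (Hscal : forall (f : R -> R) (f' : R), is_derive f t f' ->
  is_derive (fun t => w * f t) t (w * f')).
{ intros f f' Hf; solve_derive. }
split; [apply (Hcomp (fun t => cx i (c t))), D1|].
split; [apply (Hcomp (fun t => cy i (c t))), D2|].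
split.
- apply Hcomp, Hscal in D3.
  match type of D3 with is_derive _ _ ?u =>
    match goal with |- is_derive _ _ ?v => replace v with u end end; auto.
  unfold X, Y, ev; ring.
- apply Hcomp, Hscal in D4.
  match type of D4 with is_derive _ _ ?u =>
    match goal with |- is_derive _ _ ?v => replace v with u end end; auto.
  unfold X, Y, ev; ring.
Qed.

Lemma scaled_vel_bound t : 0 <= t <= 1 -> cdom i (c (w * t)) ->
  Rabs (X t - u0) <= rad -> Rabs (Y t - v0) <= rad ->
  Rabs (w * velx S i c (w * t)) <= D /\ Rabs (w * vely S i c (w * t)) <= D.
Proof.
intros Ht Hd HX HY; assert (Hb := scaled_between t Ht).
destruct (Hnorm (X t) (Y t) (velx S i c (w * t)) (vely S i c (w * t)) HX HY)
  as [N1 N2].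
assert (Es : sqrt (gquad S g i (X t) (Y t) (velx S i c (w * t))
  (vely S i c (w * t))) = speed g c 0).
{ unfold X, Y.
  rewrite <- (speed_sqr S g 2 l r) by (auto; apply Hg).
  rewrite sqrt_pow2 by apply speed_ge0.
  apply (geodesic_speed S g l r); auto. }
rewrite Es in N1, N2; unfold D.
replace (M * (Rabs w * speed g c 0)) with (Rabs w * (M * speed g c 0)) by ring.
split; apply Rabs_mult_le; auto; lra.
Qed.

(** The linear bounds belong to the invariant: as D < rad / 2 and the start lies in the half box,
    they keep the coordinates strictly inside the box, which leaves room to continue. *)
Let inside (t : R) : Prop :=
  cdom i (c (w * t)) /\ Rabs (X t - X 0) <= D * t /\ Rabs (Y t - Y 0) <= D * t.

Lemma D_ge0 : 0 <= D.
Proof.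
unfold D; pose proof (Rabs_pos w); pose proof (speed_ge0 S g c 0).
repeat apply Rmult_le_pos; auto.
Qed.

Lemma X0_box : Rabs (X 0 - u0) <= rad / 2 /\ Rabs (Y 0 - v0) <= rad / 2.
Proof. unfold X, Y; rewrite Rmult_0_r; auto. Qed.

Lemma inside_box t : 0 <= t <= 1 -> inside t ->
  Rabs (X t - u0) <= rad / 2 + D * t /\ Rabs (Y t - v0) <= rad / 2 + D * t.
Proof.
intros Ht [_ [I1 I2]]; destruct X0_box; split.
- replace (X t - u0) with ((X 0 - u0) + (X t - X 0)) by ring.
  apply Rabs_plus_le; auto.
- replace (Y t - v0) with ((Y 0 - v0) + (Y t - Y 0)) by ring.
  apply Rabs_plus_le; auto.
Qed.

Lemma D_small t : 0 <= t <= 1 -> rad / 2 + D * t < rad.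
Proof. intros Ht; pose proof D_ge0; unfold D in *; nra. Qed.

Lemma Lipschitz_while_inside t t' : 0 <= t -> t <= t' -> t' <= 1 ->
  (forall y, t <= y <= t' -> cdom i (c (w * y)) /\
     Rabs (X y - u0) <= rad /\ Rabs (Y y - v0) <= rad) ->
  Rabs (X t' - X t) <= D * (t' - t) /\ Rabs (Y t' - Y t) <= D * (t' - t).
Proof.
intros Ht Htt Ht' Hin.
assert (HD1 : forall y, t <= y <= t' -> is_derive X y (w * velx S i c (w * y)) /\
  is_derive Y y (w * vely S i c (w * y)) /\
  Rabs (w * velx S i c (w * y)) <= D /\ Rabs (w * vely S i c (w * y)) <= D).
{ intros y Hy; destruct (Hin y Hy) as [I1 [I2 I3]].
  destruct (scaled_derive y ltac:(lra) I1) as [D1 [D2 _]].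
  destruct (scaled_vel_bound y ltac:(lra) I1 I2 I3); auto. }
split.
- apply (taylor1 t t' (fun _ => 1) (fun r => r)) with
    (F1 := fun y => w * velx S i c (w * y)); try lra.
  + intros; lra.
  + intros; apply (is_derive_id (K := R_AbsRing)).
  + intros y Hy; rewrite Rmult_1_l; apply HD1, Hy.
  + intros y Hy; apply HD1, Hy.
- apply (taylor1 t t' (fun _ => 1) (fun r => r)) with
    (F1 := fun y => w * vely S i c (w * y)); try lra.
  + intros; lra.
  + intros; apply (is_derive_id (K := R_AbsRing)).
  + intros y Hy; rewrite Rmult_1_l; apply HD1, Hy.
  + intros y Hy; apply HD1, Hy.
Qed.

(** The chart [j] is arbitrary because, besides [i], a chart around the point just reached is needed
    while that point is not yet known to lie in the domain of [i]. *)
Lemma scaled_locally t j (eps : R) : 0 <= t <= 1 -> cdom j (c (w * t)) ->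
  0 < eps -> exists e, 0 < e /\ forall y, Rabs (y - t) < e ->
  cdom j (c (w * y)) /\ Rabs (cx j (c (w * y)) - cx j (c (w * t))) < eps /\
  Rabs (cy j (c (w * y)) - cy j (c (w * t))) < eps.
Proof.
intros Ht Hd Heps; assert (Hb := scaled_between t Ht).
destruct (curve_derive S 2 l r c ltac:(lia) (proj1 Hg) j _ Hb Hd) as [D1 D2].
assert (C1 : continuous (fun t => cx j (c t)) (w * t)).
{ apply (ex_derive_continuous (V := R_NormedModule) (fun t => cx j (c t))).
  eexists; eauto. }
assert (C2 : continuous (fun t => cy j (c t)) (w * t)).
{ apply (ex_derive_continuous (V := R_NormedModule) (fun t => cy j (c t))).
  eexists; eauto. }
assert (C3 := curve_dom S 2 l r c (proj1 Hg) j _ Hb Hd).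
apply continuous_R with (eps := eps) in C1; auto.
apply continuous_R with (eps := eps) in C2; auto.
apply locally_R in C3.
destruct C1 as [e1 [P1 Q1]], C2 as [e2 [P2 Q2]], C3 as [e3 [P3 Q3]].
assert (Hw1 : 0 < Rabs w + 1) by (pose proof (Rabs_pos w); lra).
set (e := Rmin e1 (Rmin e2 e3)).
assert (He : 0 < e) by (repeat apply Rmin_pos; auto).
assert (L1 : e <= e1) by apply Rmin_l.
assert (L2 : e <= e2) by (eapply Rle_trans; [apply Rmin_r|apply Rmin_l]).
assert (L3 : e <= e3) by (eapply Rle_trans; [apply Rmin_r|apply Rmin_r]).
exists (e / (Rabs w + 1)); split; [apply Rdiv_lt_0_compat; auto|].
intros y Hy.
assert (Hwy : Rabs (w * y - w * t) < e).
{ rewrite <- Rmult_minus_distr_l, Rabs_mult.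
  apply Rle_lt_trans with ((Rabs w + 1) * Rabs (y - t)).
  - pose proof (Rabs_pos (y - t)); nra.
  - apply Rmult_lt_reg_l with (/ (Rabs w + 1)); [apply Rinv_0_lt_compat; auto|].
    rewrite <- Rmult_assoc, Rinv_l, Rmult_1_l by lra; unfold Rdiv in Hy; lra. }
split; [apply Q3; lra|split; [apply Q1|apply Q2]; lra].
Qed.

(** The limit point of the geodesic in the coordinate box must be the point it
    reaches, because the surface is Hausdorff. *)
Lemma geodesic_inside t : 0 <= t <= 1 -> inside t.
Proof.
pose proof D_ge0.
revert t; apply real_induction.
- unfold inside; rewrite Rmult_0_r, !Rminus_diag, Rabs_R0; repeat split; auto; lra.
- intros x Hx Hin.
  assert (Ix := Hin x ltac:(lra)).
  destruct (inside_box x ltac:(lra) Ix) as [B1 B2].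
  assert (Ds := D_small x ltac:(lra)).
  destruct (scaled_locally x i (rad - (rad / 2 + D * x)) ltac:(lra) (proj1 Ix)
    ltac:(lra)) as [e [He Hloc]].
  exists e; split; auto; intros y Hy Hy1.
  assert (Hbx : forall z, x <= z <= y -> cdom i (c (w * z)) /\
    Rabs (X z - u0) <= rad /\ Rabs (Y z - v0) <= rad).
  { intros z Hz; destruct (Hloc z) as [L1 [L2 L3]].
    { apply Rabs_lt_between; lra. }
    split; auto; split.
    - replace (X z - u0) with ((X z - X x) + (X x - u0)) by ring.
      apply Rle_trans with ((rad - (rad / 2 + D * x)) + (rad / 2 + D * x));
        [apply Rabs_plus_le; auto; apply Rlt_le, L2|lra].
    - replace (Y z - v0) with ((Y z - Y x) + (Y x - v0)) by ring.
      apply Rle_trans with ((rad - (rad / 2 + D * x)) + (rad / 2 + D * x));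
        [apply Rabs_plus_le; auto; apply Rlt_le, L3|lra]. }
  destruct (Lipschitz_while_inside x y ltac:(lra) ltac:(lra) ltac:(lra) Hbx)
    as [L1 L2].
  destruct Ix as [_ [I1 I2]].
  split; [apply Hbx; lra|]; split.
  + replace (X y - X 0) with ((X y - X x) + (X x - X 0)) by ring.
    replace (D * y) with (D * (y - x) + D * x) by ring.
    apply Rabs_plus_le; auto.
  + replace (Y y - Y 0) with ((Y y - Y x) + (Y x - Y 0)) by ring.
    replace (D * y) with (D * (y - x) + D * x) by ring.
    apply Rabs_plus_le; auto.
- intros x Hx Hin.
  assert (Hbx : forall z, 0 <= z < x -> cdom i (c (w * z)) /\
    Rabs (X z - u0) <= rad /\ Rabs (Y z - v0) <= rad).
  { intros z Hz; assert (Iz := Hin z Hz).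
    destruct (inside_box z ltac:(lra) Iz).
    assert (Ds := D_small z ltac:(lra)).
    split; [apply Iz|lra]. }
  assert (HLip : forall y y', 0 <= y < x -> 0 <= y' < x -> y <= y' ->
    Rabs (X y' - X y) <= D * (y' - y) /\ Rabs (Y y' - Y y) <= D * (y' - y)).
  { intros y y' Hy Hy' Hyy; apply Lipschitz_while_inside; try lra.
    intros z Hz; apply Hbx; lra. }
  assert (sym : forall f : R -> R, (forall y y', 0 <= y < x -> 0 <= y' < x ->
    y <= y' -> Rabs (f y' - f y) <= D * (y' - y)) -> forall y y', 0 <= y < x ->
    0 <= y' < x -> Rabs (f y - f y') <= D * Rabs (y - y')).
  { intros f Hf y y' Hy Hy'; destruct (Rle_or_lt y y').
    - rewrite Rabs_minus_sym, (Rabs_minus_sym y), (Rabs_pos_eq (y' - y)) by lra.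
      apply Hf; lra.
    - rewrite (Rabs_pos_eq (y - y')) by lra; apply Hf; lra. }
  destruct (lipschitz_left_limit X x D) as [u Hul]; auto; try lra.
  { apply sym; intros; apply HLip; auto. }
  destruct (lipschitz_left_limit Y x D) as [v Hvl]; auto; try lra.
  { apply sym; intros; apply HLip; auto. }
  assert (Ds := D_small x ltac:(lra)).
  destruct X0_box as [B1 B2].
  assert (HLu : Rabs (u - X 0) <= D * x /\ Rabs (v - Y 0) <= D * x).
  { specialize (Hul 0 ltac:(lra)); specialize (Hvl 0 ltac:(lra)).
    rewrite Rabs_minus_sym, Rminus_0_r in Hul.
    rewrite Rabs_minus_sym, Rminus_0_r in Hvl; auto. }
  assert (Hq : cimg S i u v).
  { apply Hbox.
    - replace (u - u0) with ((X 0 - u0) + (u - X 0)) by ring.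
      eapply Rle_trans; [apply Rabs_plus_le; [exact B1|apply HLu]|lra].
    - replace (v - v0) with ((Y 0 - v0) + (v - Y 0)) by ring.
      eapply Rle_trans; [apply Rabs_plus_le; [exact B2|apply HLu]|lra]. }
  destruct Hq as [Q1 [Q2 Q3]].
  assert (Heq : c (w * x) = cinv i u v).
  { apply NNPP; intros Hne.
    assert (Hj := chart_atP S (c (w * x))); set (j := chart_at (c (w * x))) in *.
    destruct (hausdorff S j i Hj Q1 Hne) as [e He].
    destruct (scaled_locally x j e ltac:(lra) Hj (cond_pos e)) as [e' [He' Hloc]].
    (* The point at time x - h lies in both separating neighbourhoods: h < e' puts it in the one
       around c(w x), and D h < e in the one around the limit point. *)
    set (h := Rmin (x / 2) (Rmin (e' / 2) (e / (2 * (D + 1))))).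
    assert (Hh : 0 < h).
    { pose proof (cond_pos e); repeat apply Rmin_pos; try lra.
      apply Rdiv_lt_0_compat; lra. }
    assert (Hh1 : h <= x / 2) by apply Rmin_l.
    assert (Hh2 : h <= e' / 2)
      by (eapply Rle_trans; [apply Rmin_r|apply Rmin_l]).
    assert (Hh3 : h <= e / (2 * (D + 1)))
      by (eapply Rle_trans; [apply Rmin_r|apply Rmin_r]).
    assert (Hh4 : D * h < e).
    { assert (h * (2 * (D + 1)) <= e).
      { apply (Rmult_le_compat_r (2 * (D + 1))) in Hh3; [|lra].
        replace (e / (2 * (D + 1)) * (2 * (D + 1))) with (pos e) in Hh3
          by (field; lra); auto. }
      nra. }
    destruct (Hloc (x - h)) as [L1 [L2 L3]].
    { apply Rabs_lt_between; lra. }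
    destruct (Hin (x - h)) as [L4 _]; [lra|].
    specialize (Hul (x - h) ltac:(lra)); specialize (Hvl (x - h) ltac:(lra)).
    replace (x - (x - h)) with h in Hul, Hvl by ring.
    unfold X, Y in Hul, Hvl.
    apply (He (c (w * (x - h)))); auto.
    - rewrite Q2; lra.
    - rewrite Q3; lra. }
  unfold inside, X at 1, Y at 1; rewrite Heq, Q2, Q3; auto.
Qed.

Lemma scaled_unit_geodesic :
  unit_geodesic (qclamp u0 v0 rad (conn1 S g i)) (qclamp u0 v0 rad (conn2 S g i))
    X Y (fun t => w * velx S i c (w * t)) (fun t => w * vely S i c (w * t)) /\
  (forall t, 0 <= t <= 1 -> cdom i (c (w * t)) /\
    Rabs (w * velx S i c (w * t)) <= D /\ Rabs (w * vely S i c (w * t)) <= D).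
Proof.
assert (Hall : forall t, 0 <= t <= 1 -> cdom i (c (w * t)) /\
  Rabs (X t - u0) <= rad /\ Rabs (Y t - v0) <= rad).
{ intros t Ht; assert (It := geodesic_inside t Ht).
  destruct (inside_box t Ht It); assert (Ds := D_small t Ht).
  split; [apply It|lra]. }
split.
- intros t Ht; destruct (Hall t Ht) as [I1 [I2 I3]].
  rewrite !ev_qclamp by auto; apply scaled_derive; auto.
- intros t Ht; destruct (Hall t Ht) as [I1 [I2 I3]].
  split; auto; apply scaled_vel_bound; auto.
Qed.

End Geodesic.

(** The velocity of the tangent geodesic is known only up to the factor [k]. Multiplying its end
    parameter by [k] and by the speed of [gam] gives the signed length relative to the oriented unit
    tangent, whose absolute value is [d]. *)
Lemma tangent_geodesic_scaled (gam : R -> point S) (s d : R) (C : point S) :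
  on_tangent_geodesic g gam s C d -> cdom i (gam s) ->
  Rabs (cx i (gam s) - u0) <= rad / 2 -> Rabs (cy i (gam s) - v0) <= rad / 2 ->
  M * d < rad / 2 -> speed_in g i gam s <> 0 ->
  exists (X Y U V : R -> R) (w : R),
    unit_geodesic (qclamp u0 v0 rad (conn1 S g i))
      (qclamp u0 v0 rad (conn2 S g i)) X Y U V /\
    X 0 = cx i (gam s) /\ Y 0 = cy i (gam s) /\
    U 0 = w * (velx S i gam s / speed_in g i gam s) /\
    V 0 = w * (vely S i gam s / speed_in g i gam s) /\
    (forall t, 0 <= t <= 1 -> Rabs (U t) <= M * Rabs w /\
       Rabs (V t) <= M * Rabs w) /\
    X 1 = cx i C /\ Y 1 = cy i C /\ Rabs w = d.
Proof.
intros [c [l [r [w [H0 [Hw [Hg [Hc0 [[k [Hk Hkv]] [HcC Hd]]]]]]]]]] Hi Hu Hv HD Hsp.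
destruct (Hkv i Hi) as [Kx Ky].
rewrite (geodesic_arclength S g l r c w Hg H0 Hw) in Hd.
assert (Hi0 : cdom i (c 0)) by (rewrite Hc0; auto).
assert (Hspeed : speed g c 0 = Rabs k * speed_in g i gam s).
{ rewrite (speed_chart S g 2 l r c i 0) by (auto; apply Hg).
  unfold speed_in, norm_in; rewrite Kx, Ky, Hc0.
  replace (quad _ _ _ (k * velx S i gam s) (k * vely S i gam s)) with
    (k ^ 2 * quad (gE g i (cx i (gam s)) (cy i (gam s)))
      (gF g i (cx i (gam s)) (cy i (gam s)))
      (gG g i (cx i (gam s)) (cy i (gam s))) (velx S i gam s) (vely S i gam s))
    by (unfold quad; ring).
  rewrite sqrt_mult_alt by apply pow2_ge_0.
  rewrite <- (pow2_abs k), sqrt_pow2 by apply Rabs_pos; reflexivity. }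
assert (Hwk : Rabs (w * (k * speed_in g i gam s)) = d).
{ rewrite Hd, Hspeed, !Rabs_mult.
  rewrite (Rabs_pos_eq (speed_in g i gam s)) by apply sqrt_pos; ring. }
destruct (scaled_unit_geodesic l r w c H0 Hw Hg Hi0) as [G1 G2].
{ rewrite Hc0; auto. }
{ rewrite Hc0; auto. }
{ rewrite <- Hd; auto. }
exists (fun t => cx i (c (w * t))), (fun t => cy i (c (w * t))),
  (fun t => w * velx S i c (w * t)), (fun t => w * vely S i c (w * t)),
  (w * (k * speed_in g i gam s)).
split; [exact G1|].
rewrite !Rmult_0_r, !Rmult_1_r, Kx, Ky, Hc0, HcC, Hwk.
repeat split; auto.
- field; auto.
- field; auto.
- rewrite Hd; apply G2; auto.
- rewrite Hd; apply G2; auto.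
Qed.

End Trap.

(** Completing the square, E q = (E G - F^2) b^2 + (E a + F b)^2, so that b^2 <= E q / (E G - F^2),
    and symmetrically for a with G; these two quotients are locally bounded. *)
Lemma gquad_controls (S : surface) (g : metric S) (i : chart S) u0 v0 :
  cimg S i u0 v0 ->
  exists K r, 0 < r /\ forall M u v a b, 1 <= M -> K <= M ->
    Rabs (u - u0) <= r -> Rabs (v - v0) <= r -> cimg S i u v ->
    Rabs a <= M * sqrt (gquad S g i u v a b) /\
    Rabs b <= M * sqrt (gquad S g i u v a b).
Proof.
intros H.
destruct (metric_loc_lip S g i _ _ H (gE g i)) as [E _]; auto.
destruct (metric_loc_lip S g i _ _ H (gF g i)) as [F _]; auto.
destruct (metric_loc_lip S g i _ _ H (gG g i)) as [G _]; auto.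
destruct (metric_pos g H) as [_ Hdet].
assert (D : loc_lip (fun u v => / (gE g i u v * gG g i u v
  + -1 * (gF g i u v * gF g i u v))) u0 v0).
{ apply loc_lip_inv; [|lra].
  apply loc_lip_plus; [apply loc_lip_mult; auto|].
  apply loc_lip_mult; [apply loc_lip_const|apply loc_lip_mult; auto]. }
destruct (loc_lip_mult _ _ _ _ E D) as [K1 [r1 [Hr1 [B1 _]]]].
destruct (loc_lip_mult _ _ _ _ G D) as [K2 [r2 [Hr2 [B2 _]]]].
pose proof (Rmin_l r1 r2); pose proof (Rmin_r r1 r2).
exists (Rmax K1 K2), (Rmin r1 r2); split; [apply Rmin_pos; auto|].
intros M u v a b HM HK Hu Hv Huv.
assert (K1 <= M) by (eapply Rle_trans; [apply Rmax_l|eauto]).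
assert (K2 <= M) by (eapply Rle_trans; [apply Rmax_r|eauto]).
specialize (B1 u v ltac:(lra) ltac:(lra)).
specialize (B2 u v ltac:(lra) ltac:(lra)).
apply Rabs_le_between in B1; apply Rabs_le_between in B2.
assert (Hq := gquad_ge0 S g i u v a b Huv).
destruct (metric_pos g Huv) as [HE HD].
set (e := gE g i u v) in *; set (f := gF g i u v) in *.
set (h := gG g i u v) in *; set (q := gquad S g i u v a b) in *.
set (d := e * h + -1 * (f * f)) in *.
assert (Hd : 0 < d) by (unfold d; lra).
assert (Hh : 0 < h) by (unfold d in Hd; nra).
assert (E1 : b ^ 2 <= M * q).
{ apply Rle_trans with (e * / d * q).
  - apply Rmult_le_reg_l with d; auto.
    replace (d * (e * / d * q)) with (d * b ^ 2 + (e * a + f * b) ^ 2).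
    + pose proof (pow2_ge_0 (e * a + f * b)); lra.
    + unfold q, gquad, quad; fold e f h.
      replace (d * (e * / d * _)) with
        (e * (e * a ^ 2 + 2 * f * a * b + h * b ^ 2)) by (field; lra).
      unfold d; ring.
  - apply Rmult_le_compat_r; lra. }
assert (E2 : a ^ 2 <= M * q).
{ apply Rle_trans with (h * / d * q).
  - apply Rmult_le_reg_l with d; auto.
    replace (d * (h * / d * q)) with (d * a ^ 2 + (f * a + h * b) ^ 2).
    + pose proof (pow2_ge_0 (f * a + h * b)); lra.
    + unfold q, gquad, quad; fold e f h.
      replace (d * (h * / d * _)) with
        (h * (e * a ^ 2 + 2 * f * a * b + h * b ^ 2)) by (field; lra).
      unfold d; ring.
  - apply Rmult_le_compat_r; lra. }
assert (Hfin : forall z, z ^ 2 <= M * q -> Rabs z <= M * sqrt q).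
{ intros z Hz; rewrite <- (sqrt_pow2 M) by lra.
  rewrite <- sqrt_mult_alt by apply pow2_ge_0.
  rewrite <- (sqrt_pow2 (Rabs z)), pow2_abs by apply Rabs_pos.
  apply sqrt_le_1_alt; nra. }
auto.
Qed.

(** * The arc near one of its points *)

Section LocalArc.
Variables (S : surface) (g : metric S) (a b : R) (gam : R -> point S).
Hypothesis (Hgam : regular_curve g 3 a b gam).
Variable i : chart S.

Let x (r : R) := cx i (gam r).
Let y (r : R) := cy i (gam r).
Let vx := velx S i gam.
Let vy := vely S i gam.
Let sg := speed_in g i gam.
Let p (r : R) := vx r / sg r.
Let q (r : R) := vy r / sg r.
Let P (r : R) := flat1 S g i (x r) (y r) (p r) (q r).
Let Q (r : R) := flat2 S g i (x r) (y r) (p r) (q r).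
Let a1 (r : R) := cov1 g i gam p q r / sg r.
Let a2 (r : R) := cov2 g i gam p q r / sg r.
Let b1 (r : R) := flat1 S g i (x r) (y r) (a1 r) (a2 r).
Let b2 (r : R) := flat2 S g i (x r) (y r) (a1 r) (a2 r).

Section AtTime.
Variable r : R.
Hypotheses (Hr : a < r < b) (Hi : cdom i (gam r)).

Lemma arc_cimg : cimg S i (x r) (y r).
Proof. apply cimg_point, Hi. Qed.

Lemma arc_speed : speed g gam r = sg r.
Proof. apply (speed_chart S g 3 a b); auto; apply Hgam. Qed.

Lemma sg_pos : 0 < sg r.
Proof. rewrite <- arc_speed; apply Hgam, Hr. Qed.

Lemma sg_gquad : sg r = sqrt (gquad S g i (x r) (y r) (vx r) (vy r)).
Proof. reflexivity. Qed.

Lemma gquad_pos : 0 < gquad S g i (x r) (y r) (vx r) (vy r).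
Proof.
assert (H := sg_pos); rewrite sg_gquad in H.
apply Rnot_le_lt; intros Hn; rewrite sqrt_neg_0 in H; lra.
Qed.

Lemma velocity_derive : is_derive x r (vx r) /\ is_derive y r (vy r).
Proof. apply (curve_derive S 3 a b); auto; apply Hgam. Qed.

Lemma velocity_derive2 :
  is_derive vx r (Derive vx r) /\ is_derive vy r (Derive vy r).
Proof. apply (curve_derive2 S 3 a b); auto; apply Hgam. Qed.

Lemma tangent_ex_derive : ex_derive p r /\ ex_derive q r.
Proof.
destruct velocity_derive as [D1 D2], velocity_derive2 as [D3 D4].
assert (Dq := gquad_derive S g i x y vx vy r _ _ _ _ arc_cimg D1 D2 D3 D4).
apply is_derive_sqrt in Dq; [|exact gquad_pos].
assert (Hs : ex_derive sg r) by (eexists; exact Dq).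
pose proof sg_pos.
split; apply ex_derive_div; auto; try lra; eexists; eauto.
Qed.

Lemma velocityE : vx r = sg r * p r /\ vy r = sg r * q r.
Proof. pose proof sg_pos; unfold p, q; split; field; lra. Qed.

Lemma position_derive :
  is_derive x r (sg r * p r) /\ is_derive y r (sg r * q r).
Proof. destruct velocityE as [<- <-]; apply velocity_derive. Qed.

Lemma tangent_derive :
  is_derive p r (sg r * (- ev (conn1 S g i) (x r) (y r) (p r) (q r) (p r) (q r)
    + a1 r)) /\
  is_derive q r (sg r * (- ev (conn2 S g i) (x r) (y r) (p r) (q r) (p r) (q r)
    + a2 r)).
Proof.
destruct tangent_ex_derive as [E1 E2]; apply Derive_correct in E1, E2.
destruct velocityE as [V1 V2]; pose proof sg_pos.
split.
- replace (sg r * _) with (Derive p r); auto.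
  unfold a1; rewrite cov1E; fold x y vx vy (x r) (y r).
  change (cx i (gam r)) with (x r); change (cy i (gam r)) with (y r).
  change (velx S i gam r) with (vx r); change (vely S i gam r) with (vy r).
  rewrite V1, V2; unfold ev; field; lra.
- replace (sg r * _) with (Derive q r); auto.
  unfold a2; rewrite cov2E.
  change (cx i (gam r)) with (x r); change (cy i (gam r)) with (y r).
  change (velx S i gam r) with (vx r); change (vely S i gam r) with (vy r).
  rewrite V1, V2; unfold ev; field; lra.
Qed.

Lemma cotangent_derive :
  is_derive P r (sg r * (P r * ev (conn1 S g i) (x r) (y r) (p r) (q r) 1 0
    + Q r * ev (conn2 S g i) (x r) (y r) (p r) (q r) 1 0 + b1 r)) /\
  is_derive Q r (sg r * (P r * ev (conn1 S g i) (x r) (y r) (p r) (q r) 0 1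
    + Q r * ev (conn2 S g i) (x r) (y r) (p r) (q r) 0 1 + b2 r)).
Proof.
destruct position_derive as [D1 D2], tangent_derive as [D3 D4].
assert (K1 := flat1_derive S g i x y p q r _ _ _ _ arc_cimg D1 D2 D3 D4).
assert (K2 := flat2_derive S g i x y p q r _ _ _ _ arc_cimg D1 D2 D3 D4).
split.
- replace (sg r * _) with
    (flat1 S g i (x r) (y r) (p r) (q r)
     * ev (conn1 S g i) (x r) (y r) (sg r * p r) (sg r * q r) 1 0
     + flat2 S g i (x r) (y r) (p r) (q r)
       * ev (conn2 S g i) (x r) (y r) (sg r * p r) (sg r * q r) 1 0
     + flat1 S g i (x r) (y r)
        (sg r * (- ev (conn1 S g i) (x r) (y r) (p r) (q r) (p r) (q r) + a1 r)
         + ev (conn1 S g i) (x r) (y r) (sg r * p r) (sg r * q r) (p r) (q r))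
        (sg r * (- ev (conn2 S g i) (x r) (y r) (p r) (q r) (p r) (q r) + a2 r)
         + ev (conn2 S g i) (x r) (y r) (sg r * p r) (sg r * q r) (p r) (q r)));
    [exact K1|].
  unfold b1, P, Q, flat1, flat2, ev; ring.
- replace (sg r * _) with
    (flat1 S g i (x r) (y r) (p r) (q r)
     * ev (conn1 S g i) (x r) (y r) (sg r * p r) (sg r * q r) 0 1
     + flat2 S g i (x r) (y r) (p r) (q r)
       * ev (conn2 S g i) (x r) (y r) (sg r * p r) (sg r * q r) 0 1
     + flat2 S g i (x r) (y r)
        (sg r * (- ev (conn1 S g i) (x r) (y r) (p r) (q r) (p r) (q r) + a1 r)
         + ev (conn1 S g i) (x r) (y r) (sg r * p r) (sg r * q r) (p r) (q r))
        (sg r * (- ev (conn2 S g i) (x r) (y r) (p r) (q r) (p r) (q r) + a2 r)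
         + ev (conn2 S g i) (x r) (y r) (sg r * p r) (sg r * q r) (p r) (q r)));
    [exact K2|].
  unfold b2, P, Q, flat1, flat2, ev; ring.
Qed.

Lemma unit_tangent : P r * p r + Q r * q r = 1.
Proof.
unfold P, Q; rewrite <- gquadE.
assert (Hp := sg_pos); assert (Hq := gquad_pos).
assert (E : sg r * sg r = gquad S g i (x r) (y r) (vx r) (vy r)).
{ rewrite sg_gquad; apply sqrt_sqrt; lra. }
apply Rmult_eq_reg_l with (sg r * sg r); [|nra].
rewrite Rmult_1_r, E at 1.
rewrite E; rewrite <- E at 1.
destruct velocityE as [V1 V2]; rewrite V1, V2; unfold gquad, quad; ring.
Qed.

Lemma curvature_sqr kappa : geodesic_curvature g a b gam kappa ->
  b1 r * a1 r + b2 r * a2 r = kappa r ^ 2.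
Proof.
intros Hk; rewrite (Hk r Hr i Hi); unfold b1, b2; rewrite <- gquadE.
unfold curvature_in; fold sg; fold vx vy.
change (fun s => vx s / sg s) with p; change (fun s => vy s / sg s) with q.
pose proof sg_pos.
unfold norm_in; fold (sg r).
match goal with |- _ = (sqrt ?u / _) ^ 2 =>
  replace ((sqrt u / sg r) ^ 2) with (sqrt u ^ 2 / sg r ^ 2) by (field; lra);
  rewrite (pow2_sqrt u) by (apply (gquad_ge0 S g i), arc_cimg; auto)
end.
change (cx i (gam r)) with (x r); change (cy i (gam r)) with (y r).
unfold a1, a2, gquad, quad; field; lra.
Qed.

Lemma flat_sym u v : b1 r * u + b2 r * v
  = flat1 S g i (x r) (y r) u v * a1 r + flat2 S g i (x r) (y r) u v * a2 r.
Proof. unfold b1, b2, flat1, flat2; ring. Qed.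

End AtTime.

(** The relation <T, T> = 1 holds at all nearby times, and the derivative of its left side is 2 sg
    <T, a>. *)
Lemma acceleration_normal r : a < r < b -> cdom i (gam r) ->
  P r * a1 r + Q r * a2 r = 0.
Proof.
intros Hr Hi.
destruct (position_derive r Hr Hi) as [D1 D2].
destruct (tangent_derive r Hr Hi) as [D3 D4].
assert (K := gquad_derive S g i x y p q r _ _ _ _ (arc_cimg r Hi) D1 D2 D3 D4).
assert (K' : is_derive (fun r => gquad S g i (x r) (y r) (p r) (q r)) r 0).
{ apply (is_derive_ext_loc (fun _ => 1)).
  - generalize (curve_dom S 3 a b gam (proj1 Hgam) i r Hr Hi); apply filter_imp.
    intros r' [H1 H2]; rewrite gquadE; symmetry; apply unit_tangent; auto.
  - apply (is_derive_const (K := R_AbsRing) (V := R_NormedModule)). }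
assert (E := is_derive_unique _ _ _ K); rewrite (is_derive_unique _ _ _ K') in E.
pose proof (sg_pos r Hr Hi).
assert (E' : 2 * sg r * (P r * a1 r + Q r * a2 r) = 0).
{ rewrite E; unfold P, Q, flat1, flat2, ev; ring. }
apply Rmult_integral in E'; destruct E'; lra.
Qed.

Lemma acceleration_normal' r : a < r < b -> cdom i (gam r) ->
  b1 r * p r + b2 r * q r = 0.
Proof. intros Hr Hi; rewrite flat_sym; apply acceleration_normal; auto. Qed.

Section Continuity.
Variable s0 : R.
Hypotheses (Hs0 : a < s0 < b) (Hi0 : cdom i (gam s0)).

Lemma locally_good : locally s0 (fun r => a < r < b /\ cdom i (gam r)).
Proof. apply (curve_dom S 3); auto; apply Hgam. Qed.

Lemma velocity_C1 : C1_at vx s0 /\ C1_at vy s0.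
Proof.
assert (L := locally_good).
destruct (proj1 Hgam s0 Hs0 i Hi0) as [_ H].
assert (K : forall f, ex_derive_n f 3 s0 -> continuous (Derive (Derive f)) s0).
{ intros f Hf; apply (ex_derive_continuous (V := R_NormedModule)
    (Derive (Derive f))); exact Hf. }
split.
- apply C1_at_intro with (Derive vx).
  + revert L; apply filter_imp; intros r [H1 H2].
    exact (proj1 (velocity_derive2 r H1 H2)).
  + apply (K x), (proj1 (H x (or_introl eq_refl)) 3%nat); lia.
- apply C1_at_intro with (Derive vy).
  + revert L; apply filter_imp; intros r [H1 H2].
    exact (proj2 (velocity_derive2 r H1 H2)).
  + apply (K y), (proj1 (H y (or_intror eq_refl)) 3%nat); lia.
Qed.

Lemma position_C1 : C1_at x s0 /\ C1_at y s0.
Proof.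
assert (L := locally_good); destruct velocity_C1 as [C1 C2].
split.
- apply C1_at_intro with vx; [|apply C1_at_continuous, C1].
  revert L; apply filter_imp; intros r [H1 H2].
    exact (proj1 (velocity_derive r H1 H2)).
- apply C1_at_intro with vy; [|apply C1_at_continuous, C2].
  revert L; apply filter_imp; intros r [H1 H2].
    exact (proj2 (velocity_derive r H1 H2)).
Qed.

Lemma metric_along_C1 : C1_at (fun r => gE g i (x r) (y r)) s0 /\
  C1_at (fun r => gF g i (x r) (y r)) s0 /\
  C1_at (fun r => gG g i (x r) (y r)) s0.
Proof.
destruct position_C1 as [C1 C2].
destruct (metric_C1 S g i _ _ (arc_cimg s0 Hi0)) as [H1 [H2 H3]].
repeat split; try (apply C1_at_comp_2d; auto).
Qed.

Lemma sg_C1 : C1_at sg s0.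
Proof.
destruct velocity_C1 as [V1 V2], metric_along_C1 as [CE [CF CG]].
apply (C1_at_sqrt (fun r => gquad S g i (x r) (y r) (vx r) (vy r)));
  [|apply gquad_pos; auto].
apply C1_at_ext with (fun r => gE g i (x r) (y r) * (vx r * vx r)
  + 2 * (gF g i (x r) (y r) * (vx r * vy r))
  + gG g i (x r) (y r) * (vy r * vy r)).
- apply filter_forall; intros r; unfold gquad, quad; ring.
- apply C1_at_plus; [apply C1_at_plus|]; auto using C1_at_mult, C1_at_const.
Qed.

Lemma tangent_C1 : C1_at p s0 /\ C1_at q s0.
Proof.
destruct velocity_C1 as [V1 V2]; assert (Hs := sg_C1).
assert (sg s0 <> 0) by (apply Rgt_not_eq, sg_pos; auto).
split; apply C1_at_mult; auto; apply C1_at_inv; auto.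
Qed.

Lemma conn_continuous B : B = conn1 S g i \/ B = conn2 S g i ->
  continuous (fun r => ev B (x r) (y r) (vx r) (vy r) (p r) (q r)) s0.
Proof.
intros HB.
destruct (conn_loc_lip S g i _ _ (arc_cimg s0 Hi0) B HB) as [L1 [L2 L3]].
destruct velocity_C1 as [V1 V2], tangent_C1 as [T1 T2], position_C1 as [X1 X2].
apply C1_at_continuous in V1, V2, T1, T2, X1, X2.
assert (K : forall f, loc_lip f (x s0) (y s0) ->
  continuous (fun r => f (x r) (y r)) s0).
{ intros f [M [r [Hr [Hb Hf]]]]; apply continuous_2d_comp; auto.
  intros e.
  assert (HM : 0 <= M).
  { apply (Rabs_nonneg_bound (f (x s0) (y s0))), Hb;
      rewrite Rminus_diag, Rabs_R0; lra. }
  assert (He : 0 < Rmin r (e / (2 * (M + 1)))).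
  { apply Rmin_pos; auto; apply Rdiv_lt_0_compat; [apply cond_pos|lra]. }
  exists (mkposreal _ He); simpl; intros u v Hu Hv.
  assert (R1 := Rmin_l r (e / (2 * (M + 1)))).
  assert (R2 := Rmin_r r (e / (2 * (M + 1)))).
  apply Rle_lt_trans with (M * (Rabs (u - x s0) + Rabs (v - y s0))).
  - apply Hf; rewrite ?Rminus_diag, ?Rabs_R0; lra.
  - set (d := Rmin r (e / (2 * (M + 1)))) in *.
    assert (d * (2 * (M + 1)) <= e).
    { apply (Rmult_le_compat_r (2 * (M + 1))) in R2; [|lra].
      replace (e / (2 * (M + 1)) * (2 * (M + 1))) with (pos e) in R2
        by (field; lra); auto. }
    assert (M * (Rabs (u - x s0) + Rabs (v - y s0)) <= M * (d + d))
      by (apply Rmult_le_compat_l; lra).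
    nra. }
unfold ev.
apply continuous_Rplus; [apply continuous_Rplus|];
  (apply continuous_Rmult; [apply K; assumption|]);
  auto using continuous_Rmult, continuous_Rplus.
Qed.

Lemma acceleration_continuous : continuous a1 s0 /\ continuous a2 s0.
Proof.
destruct tangent_C1 as [[_ T1] [_ T2]].
assert (Hs := C1_at_continuous _ _ sg_C1).
assert (Hs0' : sg s0 <> 0) by (apply Rgt_not_eq, sg_pos; auto).
assert (Hinv := continuous_Rinv sg s0 Hs Hs0').
split; apply continuous_Rmult; try exact Hinv.
- apply (continuous_ext (fun r => Derive p r
    + ev (conn1 S g i) (x r) (y r) (vx r) (vy r) (p r) (q r))).
  { intros r; rewrite cov1E; reflexivity. }
  apply continuous_Rplus; auto; apply conn_continuous; auto.
- apply (continuous_ext (fun r => Derive q r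
    + ev (conn2 S g i) (x r) (y r) (vx r) (vy r) (p r) (q r))).
  { intros r; rewrite cov2E; reflexivity. }
  apply continuous_Rplus; auto; apply conn_continuous; auto.
Qed.

Lemma flat_continuous u v : continuous u s0 -> continuous v s0 ->
  continuous (fun r => flat1 S g i (x r) (y r) (u r) (v r)) s0 /\
  continuous (fun r => flat2 S g i (x r) (y r) (u r) (v r)) s0.
Proof.
intros Hu Hv; destruct metric_along_C1 as [CE [CF CG]].
apply C1_at_continuous in CE, CF, CG.
split; apply continuous_Rplus; apply continuous_Rmult; auto.
Qed.

Lemma frame_continuous : forall f,
  f = p \/ f = q \/ f = P \/ f = Q \/ f = a1 \/ f = a2 \/ f = b1 \/ f = b2 ->
  continuous f s0.
Proof.
destruct tangent_C1 as [T1 T2]; apply C1_at_continuous in T1, T2.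
destruct acceleration_continuous as [A1 A2].
destruct (flat_continuous p q T1 T2) as [F1 F2].
destruct (flat_continuous a1 a2 A1 A2) as [F3 F4].
intros f; intuition (subst; assumption).
Qed.

End Continuity.
End LocalArc.

(** * Arc length of gamma *)

Lemma speed_continuous (S : surface) (g : metric S) a b gam r :
  regular_curve g 3 a b gam -> a < r < b -> continuous (speed g gam) r.
Proof.
intros Hgam Hr; set (i := chart_at (gam r)).
assert (Hi : cdom i (gam r)) by apply chart_atP.
apply (continuous_ext_loc _ (speed_in g i gam)).
- generalize (curve_dom S 3 a b gam (proj1 Hgam) i r Hr Hi); apply filter_imp.
  intros r' [H1 H2]; symmetry; apply (arc_speed S g a b gam Hgam i r' H1 H2).
- apply C1_at_continuous, (sg_C1 S g a b gam Hgam i r Hr Hi).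
Qed.

Lemma speed_ex_RInt (S : surface) (g : metric S) a b gam s t :
  regular_curve g 3 a b gam -> a < s < b -> a < t < b ->
  ex_RInt (speed g gam) s t.
Proof.
intros Hgam Hs Ht; apply (ex_RInt_continuous (V := R_CompleteNormedModule)).
intros r Hr; apply (speed_continuous S g a b); auto.
unfold Rmin, Rmax in Hr; destruct (Rle_dec s t); lra.
Qed.

Lemma arclength_RInt (S : surface) (g : metric S) a b gam s t :
  regular_curve g 3 a b gam -> a < s -> s <= t -> t < b ->
  arclength g gam s t = RInt (speed g gam) s t.
Proof.
intros Hgam Hs Hst Ht; unfold arclength; apply Rabs_pos_eq.
apply RInt_ge_0; auto.
- apply (speed_ex_RInt S g a b); auto; lra.
- intros; apply speed_ge0.
Qed.

(** Used backwards: a short arc cannot cross an interval on which the speed is at least [k], so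
    closeness in arc length gives closeness of parameters. *)
Lemma arclength_lower (S : surface) (g : metric S) a b gam s m t k :
  regular_curve g 3 a b gam -> a < s -> s <= m -> m <= t -> t < b ->
  (forall r, s < r < m -> k <= speed g gam r) ->
  k * (m - s) <= arclength g gam s t.
Proof.
intros Hgam Hs Hsm Hmt Ht Hk.
assert (E1 : ex_RInt (speed g gam) s m)
  by (apply (speed_ex_RInt S g a b); auto; lra).
assert (E2 : ex_RInt (speed g gam) m t)
  by (apply (speed_ex_RInt S g a b); auto; lra).
rewrite (arclength_RInt S g a b) by (auto; lra).
rewrite <- (RInt_Chasles _ _ _ _ E1 E2); unfold plus; simpl.
assert (0 <= RInt (speed g gam) m t).
{ apply RInt_ge_0; auto; intros; apply speed_ge0. }
assert (RInt (fun _ => k) s m <= RInt (speed g gam) s m).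
{ apply RInt_le; auto; apply ex_RInt_const. }
rewrite RInt_const in H0; unfold scal in H0; simpl in H0; unfold mult in H0.
simpl in H0; lra.
Qed.

Lemma arclength_pos (S : surface) (g : metric S) a b gam s t :
  regular_curve g 3 a b gam -> a < s -> s < t -> t < b ->
  0 < arclength g gam s t.
Proof.
intros Hgam Hs Hst Ht; rewrite (arclength_RInt S g a b) by (auto; lra).
apply RInt_gt_0; auto.
- intros r Hr; apply Hgam; lra.
- intros r Hr; apply (speed_continuous S g a b); auto; lra.
Qed.

Lemma arclength_derive (S : surface) (g : metric S) a b gam s r :
  regular_curve g 3 a b gam -> a < s < b -> a < r < b ->
  is_derive (fun r => RInt (speed g gam) s r) r (speed g gam r).
Proof.
intros Hgam Hs Hr; apply is_derive_RInt with (a := s).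
- generalize (locally_between a b r Hr); apply filter_imp; intros r' Hr'.
  apply (RInt_correct (V := R_CompleteNormedModule)).
  apply (speed_ex_RInt S g a b); auto.
- apply (speed_continuous S g a b); auto.
Qed.

(** * Choice of the constants and the estimate near one point *)

Lemma qclamp_lip (B : qfield) u0 v0 :
  loc_lip (qa B) u0 v0 -> loc_lip (qb B) u0 v0 -> loc_lip (qc B) u0 v0 ->
  exists M0 r0, 0 < r0 /\ forall M r, M0 <= M -> 0 < r <= r0 ->
    qbounded_lip M (qclamp u0 v0 r B).
Proof.
intros H1 H2 H3.
destruct (loc_lip_clamp _ _ _ H1) as [M1 [r1 [P1 Q1]]].
destruct (loc_lip_clamp _ _ _ H2) as [M2 [r2 [P2 Q2]]].
destruct (loc_lip_clamp _ _ _ H3) as [M3 [r3 [P3 Q3]]].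
pose proof (Rmin_l r1 (Rmin r2 r3)); pose proof (Rmin_r r1 (Rmin r2 r3)).
pose proof (Rmin_l r2 r3); pose proof (Rmin_r r2 r3).
pose proof (Rmax_l M1 (Rmax M2 M3)); pose proof (Rmax_r M1 (Rmax M2 M3)).
pose proof (Rmax_l M2 M3); pose proof (Rmax_r M2 M3).
exists (Rmax M1 (Rmax M2 M3)), (Rmin r1 (Rmin r2 r3)).
split; [repeat apply Rmin_pos; auto|].
intros M r HM Hr; split; [apply Q1; lra|split; [apply Q2|apply Q3]; lra].
Qed.

Lemma near_bound (f : R -> R) s0 M : continuous f s0 -> Rabs (f s0) + 1 <= M ->
  locally s0 (fun r => Rabs (f r) <= M).
Proof.
intros Hf HM; apply locally_R.
destruct (proj1 (continuous_R f s0) Hf 1 Rlt_0_1) as [e [He H]].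
exists e; split; auto; intros r Hr; specialize (H r Hr).
replace (f r) with ((f r - f s0) + f s0) by ring.
eapply Rle_trans; [apply Rabs_triang|]; lra.
Qed.

Lemma near_osc (f : R -> R) s0 eta : continuous f s0 -> 0 < eta ->
  locally s0 (fun r => Rabs (f r - f s0) <= eta / 2).
Proof.
intros Hf He; apply locally_R.
destruct (proj1 (continuous_R f s0) Hf (eta / 2)) as [e [He' H]]; [lra|].
exists e; split; auto; intros r Hr; apply Rlt_le, H, Hr.
Qed.

(** The last clause says that the tangent segments are not longer than the arc,
    which makes it possible to shrink [delta] afterwards. *)
Lemma local_string (S : surface) (g : metric S) (a b : R) (gam : R -> point S)
    (kappa : R -> R) (s0 : R) :
  regular_curve g 3 a b gam -> geodesic_curvature g a b gam kappa ->
  a < s0 < b -> 0 < kappa s0 ->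
  forall eps, 0 < eps -> exists delta, 0 < delta /\
  forall s t q0, Rabs (s - s0) < delta -> s < t < b ->
  string_L g delta gam s t q0 ->
  delta <= kappa s ^ 2 /\
  Rabs (q0 - kappa s ^ 2 * arclength g gam s t ^ 3 / 12)
    <= eps * (kappa s ^ 2 * arclength g gam s t ^ 3) /\
  forall delta', arclength g gam s t < delta' -> string_L g delta' gam s t q0.
Proof.
intros Hgam Hkappa Hs0 Hk0 eps Heps.
set (i := chart_at (gam s0)); assert (Hi0 : cdom i (gam s0)) by apply chart_atP.
set (x := fun r => cx i (gam r)); set (y := fun r => cy i (gam r)).
set (sg := speed_in g i gam).
set (p := fun r => velx S i gam r / sg r).
set (q := fun r => vely S i gam r / sg r).
set (P := fun r => flat1 S g i (x r) (y r) (p r) (q r)).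
set (Q := fun r => flat2 S g i (x r) (y r) (p r) (q r)).
set (a1 := fun r => cov1 g i gam p q r / sg r).
set (a2 := fun r => cov2 g i gam p q r / sg r).
set (b1 := fun r => flat1 S g i (x r) (y r) (a1 r) (a2 r)).
set (b2 := fun r => flat2 S g i (x r) (y r) (a1 r) (a2 r)).
assert (Cf := frame_continuous S g a b gam Hgam i s0 Hs0 Hi0).
cbv zeta in Cf; fold x y sg in Cf; fold p q in Cf; fold a1 a2 P Q in Cf.
fold b1 b2 in Cf.
assert (Cp := Cf p ltac:(tauto)); assert (Cq := Cf q ltac:(tauto)).
assert (CP := Cf P ltac:(tauto)); assert (CQ := Cf Q ltac:(tauto)).
assert (Ca1 := Cf a1 ltac:(tauto)); assert (Ca2 := Cf a2 ltac:(tauto)).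
assert (Cb1 := Cf b1 ltac:(tauto)); assert (Cb2 := Cf b2 ltac:(tauto)).
clear Cf.
assert (Cs : continuous sg s0)
  by (apply C1_at_continuous, (sg_C1 S g a b gam Hgam i s0 Hs0 Hi0)).
destruct (position_C1 S g a b gam Hgam i s0 Hs0 Hi0) as [Cx Cy].
apply C1_at_continuous in Cx, Cy; fold x in Cx; fold y in Cy.
set (u0 := x s0) in *; set (v0 := y s0) in *.
assert (Hc0 : cimg S i u0 v0) by apply (cimg_point S i _ Hi0).
destruct (conn_loc_lip S g i u0 v0 Hc0 (conn1 S g i)) as [L1 [L2 L3]]; auto.
destruct (qclamp_lip _ _ _ L1 L2 L3) as [M1 [r1 [Hr1 HB1]]]; clear L1 L2 L3.
destruct (conn_loc_lip S g i u0 v0 Hc0 (conn2 S g i)) as [L1 [L2 L3]]; auto.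
destruct (qclamp_lip _ _ _ L1 L2 L3) as [M2 [r2 [Hr2 HB2]]]; clear L1 L2 L3.
destruct (gquad_controls S g i u0 v0 Hc0) as [M3 [r3 [Hr3 Hnorm]]].
destruct (cimg_open S i u0 v0 Hc0) as [r4 Hr4].
set (rad := Rmin (Rmin r1 r2) (Rmin r3 (r4 / 2))).
assert (Hrad : 0 < rad).
{ pose proof (cond_pos r4); repeat apply Rmin_pos; lra. }
assert (rad <= r1) by (eapply Rle_trans; [apply Rmin_l|apply Rmin_l]).
assert (rad <= r2) by (eapply Rle_trans; [apply Rmin_l|apply Rmin_r]).
assert (rad <= r3) by (eapply Rle_trans; [apply Rmin_r|apply Rmin_l]).
assert (rad <= r4 / 2) by (eapply Rle_trans; [apply Rmin_r|apply Rmin_r]).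
assert (Hkk : 0 < kappa s0 ^ 2) by (apply pow_lt; auto).
(* The entry 2 / kappa(s0)^2 gives 1 <= M kappa^2 near [s0], where kappa^2 is at least kappa(s0)^2 /
   2; each added 1 leaves room for the variation of a frame function. *)
set (M := 1 + Rabs M1 + Rabs M2 + Rabs M3 + 2 / kappa s0 ^ 2
  + (Rabs (p s0) + 1) + (Rabs (q s0) + 1) + (Rabs (P s0) + 1)
  + (Rabs (Q s0) + 1) + (Rabs (a1 s0) + 1) + (Rabs (a2 s0) + 1)
  + (Rabs (b1 s0) + 1) + (Rabs (b2 s0) + 1)).
assert (Hk2pos : 0 < 2 / kappa s0 ^ 2) by (apply Rdiv_lt_0_compat; lra).
assert (HMall : 1 <= M /\ M1 <= M /\ M2 <= M /\ M3 <= M /\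
  2 / kappa s0 ^ 2 <= M /\ Rabs (p s0) + 1 <= M /\ Rabs (q s0) + 1 <= M /\
  Rabs (P s0) + 1 <= M /\ Rabs (Q s0) + 1 <= M /\ Rabs (a1 s0) + 1 <= M /\
  Rabs (a2 s0) + 1 <= M /\ Rabs (b1 s0) + 1 <= M /\ Rabs (b2 s0) + 1 <= M).
{ pose proof (Rle_abs M1); pose proof (Rle_abs M2); pose proof (Rle_abs M3).
  pose proof (Rabs_pos M1); pose proof (Rabs_pos M2); pose proof (Rabs_pos M3).
  pose proof (Rabs_pos (p s0)); pose proof (Rabs_pos (q s0)).
  pose proof (Rabs_pos (P s0)); pose proof (Rabs_pos (Q s0)).
  pose proof (Rabs_pos (a1 s0)); pose proof (Rabs_pos (a2 s0)).
  pose proof (Rabs_pos (b1 s0)); pose proof (Rabs_pos (b2 s0)).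
  unfold M; repeat split; lra. }
clearbody M.
destruct HMall as
  [HM [HM1 [HM2 [HM3 [HMk [Np [Nq [NP [NQ [Na1 [Na2 [Nb1 Nb2]]]]]]]]]]]].
set (C1 := qclamp u0 v0 rad (conn1 S g i)).
set (C2 := qclamp u0 v0 rad (conn2 S g i)).
assert (HC1 : qbounded_lip M C1) by (apply HB1; lra).
assert (HC2 : qbounded_lip M C2) by (apply HB2; lra).
assert (Hbox : forall u v, Rabs (u - u0) <= rad -> Rabs (v - v0) <= rad ->
  cimg S i u v).
{ intros u v Hu Hv; pose proof (cond_pos r4); apply Hr4; lra. }
assert (Hctl : forall u v a b, Rabs (u - u0) <= rad -> Rabs (v - v0) <= rad ->
  Rabs a <= M * sqrt (gquad S g i u v a b) /\
  Rabs b <= M * sqrt (gquad S g i u v a b)).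
{ intros u v a' b' Hu Hv; apply Hnorm; auto; lra. }
(* The defect is estimated up to eps' lam^3, and 1 <= M kappa^2 turns this into eps kappa^2
   lam^3. *)
set (eps' := eps / M).
assert (Heps' : 0 < eps') by (apply Rdiv_lt_0_compat; lra).
set (K := 350000 * M ^ 12).
assert (HK : 0 < K) by (unfold K; apply Rmult_lt_0_compat; [lra|apply pow_lt; lra]).
assert (HM7 : 0 < 11712 * M ^ 7)
  by (apply Rmult_lt_0_compat; [lra|apply pow_lt; lra]).
assert (HM3' : 0 < 64 * M ^ 3)
  by (apply Rmult_lt_0_compat; [lra|apply pow_lt; lra]).
set (eta := Rmin (eps' / (2 * K)) (/ (2 * (11712 * M ^ 7)))).
assert (Heta : 0 < eta).
{ apply Rmin_pos; [apply Rdiv_lt_0_compat; lra|apply Rinv_0_lt_compat; lra]. }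
assert (He1 : K * eta <= eps' / 2).
{ apply Rle_trans with (K * (eps' / (2 * K)));
    [apply Rmult_le_compat_l; [lra|apply Rmin_l]|right; field; lra]. }
assert (He2 : 11712 * M ^ 7 * eta <= / 2).
{ apply Rle_trans with (11712 * M ^ 7 * (/ (2 * (11712 * M ^ 7))));
    [apply Rmult_le_compat_l; [lra|apply Rmin_r]|right; field; lra]. }
clearbody eta.
assert (Hsg0 : 0 < sg s0) by apply (sg_pos S g a b gam Hgam i s0 Hs0 Hi0).
assert (Cba : continuous (fun r => b1 r * a1 r + b2 r * a2 r) s0)
  by (apply continuous_Rplus; apply continuous_Rmult; auto).
assert (Hba0 := curvature_sqr S g a b gam Hgam i s0 Hs0 Hi0 kappa Hkappa).
cbv zeta in Hba0; fold x y sg in Hba0; fold p q in Hba0; fold a1 a2 in Hba0.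
change (b1 s0 * a1 s0 + b2 s0 * a2 s0 = kappa s0 ^ 2) in Hba0.
assert (HE : exists e, 0 < e /\ forall r, Rabs (r - s0) < e ->
  (a < r < b /\ cdom i (gam r)) /\
  (Rabs (p r) <= M /\ Rabs (q r) <= M /\ Rabs (P r) <= M /\ Rabs (Q r) <= M /\
   Rabs (a1 r) <= M /\ Rabs (a2 r) <= M /\ Rabs (b1 r) <= M /\
   Rabs (b2 r) <= M) /\
  (Rabs (a1 r - a1 s0) <= eta / 2 /\ Rabs (a2 r - a2 s0) <= eta / 2 /\
   Rabs (b1 r - b1 s0) <= eta / 2 /\ Rabs (b2 r - b2 s0) <= eta / 2) /\
  Rabs (x r - u0) <= rad / 2 /\ Rabs (y r - v0) <= rad / 2 /\
  Rabs (sg r - sg s0) <= sg s0 / 2 /\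
  Rabs (b1 r * a1 r + b2 r * a2 r - (b1 s0 * a1 s0 + b2 s0 * a2 s0))
    <= kappa s0 ^ 2 / 2).
{ apply locally_R; apply filter_and.
  { apply (curve_dom S 3 a b gam (proj1 Hgam) i s0 Hs0 Hi0). }
  repeat apply filter_and;
    first [apply near_bound; assumption
          | apply (near_osc (fun r => b1 r * a1 r + b2 r * a2 r)); assumption
          | apply near_osc; assumption]. }
destruct HE as [e [He HE]].
(* The first two entries confine the arc to the [e]-neighbourhood of [s0], the next two give the
   smallness conditions of the closing estimates, rad / (4 M) keeps the tangent geodesics in the
   box, and the last one makes K lam <= eps' / 2. *)
set (delta := Rmin (Rmin (e / 4) (e * sg s0 / 8)) (Rmin (/ (64 * M ^ 3))
  (Rmin (/ (2 * (11712 * M ^ 7))) (Rmin (rad / (4 * M)) (eps' / (2 * K)))))).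
assert (Hes : 0 < e * sg s0) by (apply Rmult_lt_0_compat; auto).
assert (Hdelta : 0 < delta).
{ unfold delta; repeat apply Rmin_pos; try lra;
    try (apply Rinv_0_lt_compat; lra); apply Rdiv_lt_0_compat; lra. }
assert (D1 : delta <= e / 4)
  by (eapply Rle_trans; [apply Rmin_l|apply Rmin_l]).
assert (D2 : delta <= e * sg s0 / 8)
  by (eapply Rle_trans; [apply Rmin_l|apply Rmin_r]).
assert (Dr : delta <= Rmin (/ (64 * M ^ 3))
  (Rmin (/ (2 * (11712 * M ^ 7))) (Rmin (rad / (4 * M)) (eps' / (2 * K)))))
  by apply Rmin_r.
clearbody delta.
assert (D3 : delta <= / (64 * M ^ 3))
  by (eapply Rle_trans; [exact Dr|apply Rmin_l]).
apply (fun h => Rle_trans _ _ _ h (Rmin_r _ _)) in Dr.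
assert (D4 : delta <= / (2 * (11712 * M ^ 7)))
  by (eapply Rle_trans; [exact Dr|apply Rmin_l]).
apply (fun h => Rle_trans _ _ _ h (Rmin_r _ _)) in Dr.
assert (D5 : delta <= rad / (4 * M))
  by (eapply Rle_trans; [exact Dr|apply Rmin_l]).
assert (D6 : delta <= eps' / (2 * K))
  by (eapply Rle_trans; [exact Dr|apply Rmin_r]).
clear Dr.
assert (D3' : 64 * M ^ 3 * delta <= 1).
{ apply Rle_trans with (64 * M ^ 3 * / (64 * M ^ 3));
    [apply Rmult_le_compat_l; lra|right; field; lra]. }
assert (D4' : 11712 * M ^ 7 * delta <= / 2).
{ apply Rle_trans with (11712 * M ^ 7 * / (2 * (11712 * M ^ 7)));
    [apply Rmult_le_compat_l; lra|right; field; lra]. }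
assert (D5' : M * delta <= rad / 4).
{ apply Rle_trans with (M * (rad / (4 * M)));
    [apply Rmult_le_compat_l; lra|right; field; lra]. }
assert (D6' : K * delta <= eps' / 2).
{ apply Rle_trans with (K * (eps' / (2 * K)));
    [apply Rmult_le_compat_l; lra|right; field; lra]. }
exists delta; split; auto.
intros s t q0 Hs Hst [Hlam [C [d1 [d2 [T1 [Hd1 [T2 [Hd2 Hq0]]]]]]]].
assert (Hse : Rabs (s - s0) < e) by lra.
apply Rabs_lt_between in Hs.
destruct (HE s Hse) as [[Hsab Hsi] _].
(* Otherwise the arc would run at speed at least sg(s0) / 2 over a parameter length of at least e /
   2, and its length would be at least 2 delta. *)
assert (Hte : t < s0 + 3 * e / 4).
{ apply Rnot_le_lt; intros Hle.
  assert (Hlow := arclength_lower S g a b gam s (s0 + 3 * e / 4) t (sg s0 / 2)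
    Hgam ltac:(lra) ltac:(lra) Hle ltac:(lra)).
  assert (sg s0 / 2 * (s0 + 3 * e / 4 - s) <= arclength g gam s t).
  { apply Hlow; intros r Hr.
    assert (Hre : Rabs (r - s0) < e) by (apply Rabs_lt_between; lra).
    destruct (HE r Hre) as [[G1 G2] [_ [_ [_ [_ [G3 _]]]]]].
    rewrite (arc_speed S g a b gam Hgam i r G1 G2); fold sg.
    apply Rabs_le_between in G3; lra. }
  assert (sg s0 / 2 * (e / 2) <= sg s0 / 2 * (s0 + 3 * e / 4 - s))
    by (apply Rmult_le_compat_l; lra).
  lra. }
assert (Hin : forall r, s <= r <= t -> Rabs (r - s0) < e).
{ intros r Hr; apply Rabs_lt_between; lra. }
assert (Hgood : forall r, s <= r <= t -> a < r < b /\ cdom i (gam r)).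
{ intros r Hr; apply HE, Hin, Hr. }
assert (Hxy : forall r, s <= r <= t ->
  Rabs (x r - u0) <= rad / 2 /\ Rabs (y r - v0) <= rad / 2).
{ intros r Hr; destruct (HE r (Hin r Hr)) as [_ [_ [_ [? [? _]]]]]; auto. }
assert (Hxy' : forall r, s <= r <= t ->
  Rabs (x r - u0) <= rad /\ Rabs (y r - v0) <= rad).
{ intros r Hr; destruct (Hxy r Hr); lra. }
assert (Hosc : forall f r, Rabs (f r - f s0) <= eta / 2 ->
  Rabs (f s - f s0) <= eta / 2 -> Rabs (f r - f s) <= eta).
{ intros f r H1' H2'; replace (f r - f s) with ((f r - f s0) - (f s - f s0))
    by ring.
  replace eta with (eta / 2 + eta / 2) by field; apply Rabs_minus_le; auto. }
destruct (HE s Hse) as [_ [_ [[Os1 [Os2 [Os3 Os4]]] [_ [_ [_ Hks]]]]]].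
set (rho := fun r : R => (RInt (speed g gam) s r : R)).
assert (Hrt : rho t = arclength g gam s t)
  by (symmetry; apply (arclength_RInt S g a b); auto; lra).
assert (Hlampos : 0 < rho t)
  by (rewrite Hrt; apply (arclength_pos S g a b); auto; lra).
assert (Hba := curvature_sqr S g a b gam Hgam i s Hsab Hsi kappa Hkappa).
change (b1 s * a1 s + b2 s * a2 s = kappa s ^ 2) in Hba.
assert (HMks : 1 <= M * kappa s ^ 2).
{ rewrite Hba, Hba0 in Hks; apply Rabs_le_between in Hks.
  apply Rle_trans with (2 / kappa s0 ^ 2 * (kappa s0 ^ 2 / 2)).
  - right; field; lra.
  - apply Rmult_le_compat; lra. }
assert (Hsgne : forall r, s <= r <= t -> sg r <> 0).
{ intros r Hr; destruct (Hgood r Hr) as [G1 G2].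
  apply Rgt_not_eq, (sg_pos S g a b gam Hgam i r G1 G2). }
destruct (tangent_geodesic_scaled S g i u0 v0 rad M ltac:(lra) Hbox Hctl
  gam s d1 C T1 Hsi (proj1 (Hxy s ltac:(lra))) (proj2 (Hxy s ltac:(lra))))
  as [X1 [Y1 [U1 [V1 [w1 [G1 [X10 [Y10 [U10 [V10 [MU1 [X1C [Y1C W1]]]]]]]]]]]]].
{ assert (M * d1 <= M * delta) by (apply Rmult_le_compat_l; lra); lra. }
{ apply Hsgne; lra. }
destruct (tangent_geodesic_scaled S g i u0 v0 rad M ltac:(lra) Hbox Hctl
  gam t d2 C T2 (proj2 (Hgood t ltac:(lra))) (proj1 (Hxy t ltac:(lra)))
  (proj2 (Hxy t ltac:(lra))))
  as [X2 [Y2 [U2 [V2 [w2 [G2 [X20 [Y20 [U20 [V20 [MU2 [X2C [Y2C W2]]]]]]]]]]]]].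
{ assert (M * d2 <= M * delta) by (apply Rmult_le_compat_l; lra); lra. }
{ apply Hsgne; lra. }
assert (Hsmall3 : forall z, z <= delta -> 64 * M ^ 3 * z <= 1).
{ intros z Hz; assert (64 * M ^ 3 * z <= 64 * M ^ 3 * delta)
    by (apply Rmult_le_compat_l; lra); lra. }
assert (Hsmall7 : forall z, z <= delta -> 11712 * M ^ 7 * (z + eta) <= 1).
{ intros z Hz; assert (11712 * M ^ 7 * z <= 11712 * M ^ 7 * delta)
    by (apply Rmult_le_compat_l; lra); lra. }
assert (Hsmall1 : M * rho t <= 1).
{ assert (64 * M ^ 3 * rho t <= 1) by (apply Hsmall3; lra).
  assert (M ^ 1 <= M ^ 3) by (apply Rle_pow; auto; lia).
  simpl (M ^ 1) in *; nra. }
assert (Hst' : s <= t) by lra.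
assert (Hsg : forall r, s <= r <= t -> 0 <= sg r)
  by (intros; apply sqrt_pos).
assert (Hrho : forall r, s <= r <= t -> is_derive rho r (sg r)).
{ intros r Hr; destruct (Hgood r Hr) as [Gr1 Gr2].
  unfold sg; rewrite <- (arc_speed S g a b gam Hgam i r Gr1 Gr2).
  apply (arclength_derive S g a b); auto. }
assert (Hrho0 : rho s = 0) by (unfold rho; rewrite RInt_point; reflexivity).
assert (Hdx : forall r, s <= r <= t -> is_derive x r (sg r * p r)).
{ intros r Hr; destruct (Hgood r Hr) as [Gr1 Gr2].
  exact (proj1 (position_derive S g a b gam Hgam i r Gr1 Gr2)). }
assert (Hdy : forall r, s <= r <= t -> is_derive y r (sg r * q r)).
{ intros r Hr; destruct (Hgood r Hr) as [Gr1 Gr2].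
  exact (proj2 (position_derive S g a b gam Hgam i r Gr1 Gr2)). }
assert (Hdp : forall r, s <= r <= t -> is_derive p r
  (sg r * (- ev C1 (x r) (y r) (p r) (q r) (p r) (q r) + a1 r))).
{ intros r Hr; destruct (Hgood r Hr) as [Gr1 Gr2], (Hxy' r Hr).
  unfold C1; rewrite ev_qclamp by auto.
  exact (proj1 (tangent_derive S g a b gam Hgam i r Gr1 Gr2)). }
assert (Hdq : forall r, s <= r <= t -> is_derive q r
  (sg r * (- ev C2 (x r) (y r) (p r) (q r) (p r) (q r) + a2 r))).
{ intros r Hr; destruct (Hgood r Hr) as [Gr1 Gr2], (Hxy' r Hr).
  unfold C2; rewrite ev_qclamp by auto.
  exact (proj2 (tangent_derive S g a b gam Hgam i r Gr1 Gr2)). }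
assert (HdP : forall r, s <= r <= t -> is_derive P r
  (sg r * (P r * ev C1 (x r) (y r) (p r) (q r) 1 0
           + Q r * ev C2 (x r) (y r) (p r) (q r) 1 0 + b1 r))).
{ intros r Hr; destruct (Hgood r Hr) as [Gr1 Gr2], (Hxy' r Hr).
  unfold C1, C2; rewrite !ev_qclamp by auto.
  exact (proj1 (cotangent_derive S g a b gam Hgam i r Gr1 Gr2)). }
assert (HdQ : forall r, s <= r <= t -> is_derive Q r
  (sg r * (P r * ev C1 (x r) (y r) (p r) (q r) 0 1
           + Q r * ev C2 (x r) (y r) (p r) (q r) 0 1 + b2 r))).
{ intros r Hr; destruct (Hgood r Hr) as [Gr1 Gr2], (Hxy' r Hr).
  unfold C1, C2; rewrite !ev_qclamp by auto.
  exact (proj2 (cotangent_derive S g a b gam Hgam i r Gr1 Gr2)). }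
assert (Mall : forall r, s <= r <= t ->
  Rabs (p r) <= M /\ Rabs (q r) <= M /\ Rabs (P r) <= M /\ Rabs (Q r) <= M /\
  Rabs (a1 r) <= M /\ Rabs (a2 r) <= M /\ Rabs (b1 r) <= M /\ Rabs (b2 r) <= M).
{ intros r Hr; apply HE, Hin, Hr. }
assert (Oall : forall r, s <= r <= t ->
  Rabs (a1 r - a1 s) <= eta /\ Rabs (a2 r - a2 s) <= eta /\
  Rabs (b1 r - b1 s) <= eta /\ Rabs (b2 r - b2 s) <= eta).
{ intros r Hr; destruct (HE r (Hin r Hr)) as [_ [_ [[? [? [? ?]]] _]]].
  repeat split; apply Hosc; auto. }
assert (HPa : forall r, s <= r <= t -> P r * a1 r + Q r * a2 r = 0).
{ intros r Hr; destruct (Hgood r Hr) as [Gr1 Gr2].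
  exact (acceleration_normal S g a b gam Hgam i r Gr1 Gr2). }
assert (HPp : P s * p s + Q s * q s = 1)
  by exact (unit_tangent S g a b gam Hgam i s Hsab Hsi).
assert (Hbp : b1 s * p s + b2 s * q s = 0)
  by exact (acceleration_normal' S g a b gam Hgam i s Hsab Hsi).
assert (X12 : X1 1 = X2 1) by congruence.
assert (Y12 : Y1 1 = Y2 1) by congruence.
pose proof (fun r Hr => proj1 (Mall r Hr)) as Mp.
pose proof (fun r Hr => proj1 (proj2 (Mall r Hr))) as Mq.
pose proof (fun r Hr => proj1 (proj2 (proj2 (Mall r Hr)))) as MP.
pose proof (fun r Hr => proj1 (proj2 (proj2 (proj2 (Mall r Hr))))) as MQ.
pose proof (fun r Hr => proj2 (proj2 (proj2 (proj2 (Mall r Hr))))) as Mab.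
pose proof (fun r Hr => proj1 (Mab r Hr)) as Ma1.
pose proof (fun r Hr => proj1 (proj2 (Mab r Hr))) as Ma2.
pose proof (fun r Hr => proj1 (proj2 (proj2 (Mab r Hr)))) as Mb1.
pose proof (fun r Hr => proj2 (proj2 (proj2 (Mab r Hr)))) as Mb2.
pose proof (fun r Hr => proj1 (Oall r Hr)) as Oa1.
pose proof (fun r Hr => proj1 (proj2 (Oall r Hr))) as Oa2.
pose proof (fun r Hr => proj1 (proj2 (proj2 (Oall r Hr)))) as Ob1.
pose proof (fun r Hr => proj2 (proj2 (proj2 (Oall r Hr)))) as Ob2.
pose proof (fun r Hr => proj1 (MU1 r Hr)) as MUx1.
pose proof (fun r Hr => proj2 (MU1 r Hr)) as MUy1.
pose proof (fun r Hr => proj1 (MU2 r Hr)) as MUx2.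
pose proof (fun r Hr => proj2 (MU2 r Hr)) as MUy2.
assert (Hl : rho t <= delta) by lra.
assert (Hl1 : Rabs w1 <= delta) by lra.
assert (Hl2 : Rabs w2 <= delta) by lra.
assert (Hb : Rabs w1 <= rho t /\ Rabs w2 <= rho t)
  by exact (meeting_times_bound M C1 C2 HM HC1 HC2 s t sg rho x y p q P Q
    a1 a2 b1 b2 (kappa s ^ 2) eta Hst' Hsg Hrho Hrho0 Hdx Hdy Hdp Hdq
    Mp Mq MP MQ Ma1 Ma2 Mb1 Mb2 Oa1 Oa2 HPa HPp Hbp Hba HMks
    Hsmall1 X1 Y1 U1 V1 X2 Y2 U2 V2 w1 w2 G1 G2 X10 Y10 U10 V10 X20 Y20 U20 V20
    MUx1 MUy1 MUx2 MUy2 X12 Y12 Hlampos (Hsmall3 _ Hl) (Hsmall3 _ Hl1)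
    (Hsmall3 _ Hl2) (Hsmall7 _ Hl) (Hsmall7 _ Hl1) (Hsmall7 _ Hl2)).
assert (Hd : Rabs (Rabs w1 + Rabs w2 - rho t - kappa s ^ 2 * rho t ^ 3 / 12)
  <= K * (rho t + eta) * rho t ^ 3)
  by exact (string_defect M C1 C2 HM HC1 HC2 s t sg rho x y p q P Q
    a1 a2 b1 b2 (kappa s ^ 2) eta Hst' Hsg Hrho Hrho0 Hdx Hdy Hdp Hdq HdP HdQ
    Mp Mq MP MQ Ma1 Ma2 Mb1 Mb2 Oa1 Oa2 Ob1 Ob2 HPa HPp Hbp Hba HMks
    Hsmall1 X1 Y1 U1 V1 X2 Y2 U2 V2 w1 w2 G1 G2 X10 Y10 U10 V10 X20 Y20 U20 V20
    MUx1 MUy1 MUx2 MUy2 X12 Y12 Hlampos (Hsmall3 _ Hl) (Hsmall3 _ Hl1)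
    (Hsmall3 _ Hl2) (Hsmall7 _ Hl) (Hsmall7 _ Hl1) (Hsmall7 _ Hl2)).
rewrite <- Hrt in *; rewrite W1, W2 in *.
split; [|split].
- apply Rmult_le_reg_l with M; [lra|].
  assert (M ^ 1 <= M ^ 3) by (apply Rle_pow; auto; lia).
  simpl (M ^ 1) in *; nra.
- rewrite Hq0; eapply Rle_trans; [exact Hd|].
  apply Rle_trans with (eps' * rho t ^ 3).
  + apply Rmult_le_compat_r; [apply pow_le; lra|].
    assert (K * rho t <= K * delta) by (apply Rmult_le_compat_l; lra); lra.
  + rewrite <- Rmult_assoc; apply Rmult_le_compat_r; [apply pow_le; lra|].
    replace eps with (eps' * M) by (unfold eps'; field; lra).
    rewrite Rmult_assoc, <- (Rmult_1_r eps') at 1.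
    apply Rmult_le_compat_l; lra.
- intros delta' Hdelta'; split; [rewrite <- Hrt; auto|].
  exists C, d1, d2; rewrite <- Hrt; repeat split; auto; lra.
Qed.

(** * Uniformity on the compact subarc and conclusion *)

Lemma uniform_on_compact (Q : R -> R -> Prop) (c d : R) :
  (forall e e' s, Q e s -> 0 < e' <= e -> Q e' s) ->
  (forall s0, c <= s0 <= d -> exists e, 0 < e /\
     forall s, Rabs (s - s0) < e -> Q e s) ->
  c <= d -> exists e, 0 < e /\ forall s, c <= s <= d -> Q e s.
Proof.
intros Hmono Hloc Hcd.
(* Compactness by real induction: since [Q] passes to smaller [e], the constant of the part already
   covered and that of a new neighbourhood are merged by taking their minimum. *)
apply (real_induction
  (fun x => exists e, 0 < e /\ forall s, c <= s <= x -> Q e s) c d); [| | |lra].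
- destruct (Hloc c ltac:(lra)) as [e [He H]]; exists e; split; auto.
  intros s Hs; apply H; replace (s - c) with 0 by lra; rewrite Rabs_R0; auto.
- intros x Hx Hin.
  destruct (Hin x ltac:(lra)) as [e1 [He1 H1]].
  destruct (Hloc x ltac:(lra)) as [e2 [He2 H2]].
  assert (Hm : 0 < Rmin e1 e2) by (apply Rmin_pos; auto).
  pose proof (Rmin_l e1 e2); pose proof (Rmin_r e1 e2).
  exists e2; split; auto; intros y Hy Hyd.
  exists (Rmin e1 e2); split; auto; intros s Hs.
  destruct (Rle_or_lt s x).
  + apply Hmono with e1; [apply H1|]; lra.
  + apply Hmono with e2; [apply H2, Rabs_lt_between|]; lra.
- intros x Hx Hin.
  destruct (Hloc x ltac:(lra)) as [e2 [He2 H2]].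
  set (y := Rmax c (x - e2 / 2)).
  assert (Hy : c <= y) by apply Rmax_l.
  assert (Hy' : x - e2 / 2 <= y) by apply Rmax_r.
  assert (Hyx : y < x) by (apply Rmax_lub_lt; lra).
  destruct (Hin y ltac:(lra)) as [e1 [He1 H1]].
  assert (Hm : 0 < Rmin e1 e2) by (apply Rmin_pos; auto).
  pose proof (Rmin_l e1 e2); pose proof (Rmin_r e1 e2).
  exists (Rmin e1 e2); split; auto; intros s Hs.
  destruct (Rle_or_lt s y).
  + apply Hmono with e1; [apply H1|]; lra.
  + apply Hmono with e2; [apply H2, Rabs_lt_between|]; lra.
Qed.

Lemma string_L_mono (S : surface) (g : metric S) gam e e' s t q : e' <= e ->
  string_L g e' gam s t q -> string_L g e gam s t q.
Proof.
intros He [H [C [d1 [d2 [H1 [H2 [H3 [H4 H5]]]]]]]]; split; [lra|].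
exists C, d1, d2; repeat split; auto; lra.
Qed.

Lemma uniform_string (S : surface) (g : metric S) (a b : R)
    (gam : R -> point S) (kappa : R -> R) (c d : R) :
  regular_curve g 3 a b gam -> geodesic_curvature g a b gam kappa ->
  (forall t, a < t < b -> 0 < kappa t) -> a < c -> c <= d -> d < b ->
  forall eps, 0 < eps -> exists delta, 0 < delta /\
  forall s, c <= s <= d -> forall t q0, s < t < b ->
  string_L g delta gam s t q0 ->
  delta <= kappa s ^ 2 /\
  Rabs (q0 - kappa s ^ 2 * arclength g gam s t ^ 3 / 12)
    <= eps * (kappa s ^ 2 * arclength g gam s t ^ 3) /\
  forall delta', arclength g gam s t < delta' -> string_L g delta' gam s t q0.
Proof.
intros Hgam Hkappa Hpos Hac Hcd Hdb eps Heps.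
apply uniform_on_compact; auto.
- intros e e' s HQ He t q0 Ht HL.
  destruct (HQ t q0 Ht (string_L_mono S g gam e e' s t q0 (proj2 He) HL))
    as [H1 H2]; split; [lra|auto].
- intros s0 Hs0.
  destruct (local_string S g a b gam kappa s0 Hgam Hkappa) with (eps := eps)
    as [delta [Hd H]]; auto; try lra.
  { apply Hpos; lra. }
  exists delta; split; auto.
Qed.

Lemma Rpower_two_thirds_cube (k : R) : 0 < k -> Rpower k (2 / 3) ^ 3 = k ^ 2.
Proof.
intros Hk.
rewrite <- (Rpower_pow 3) by apply exp_pos.
rewrite Rpower_mult, <- (Rpower_pow 2) by auto.
f_equal; simpl; field.
Qed.

Lemma Rabs_cube_root (r : R) : 0 < r -> Rabs (r - 1) <= Rabs (r ^ 3 - 1).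
Proof.
intros Hr.
replace (r ^ 3 - 1) with ((r - 1) * (r ^ 2 + r + 1)) by ring.
rewrite Rabs_mult, (Rabs_pos_eq (r ^ 2 + r + 1)) by nra.
pose proof (Rabs_pos (r - 1)); assert (0 < r ^ 2 + r) by nra; nra.
Qed.

(** With e <= 1/36 the two bounds give 2 u <= 4 v, and then |u - v| <= 12 e (u + v) <= 36 e v. *)
Lemma ratio_estimate (p u v e : R) : 0 < u -> 0 < v -> 0 < e <= / 36 ->
  Rabs (p - u / 12) <= e * u -> Rabs (p - v / 12) <= e * v ->
  Rabs (u / v - 1) <= 36 * e.
Proof.
intros Hu Hv He H1 H2.
apply Rabs_le_between in H1; apply Rabs_le_between in H2.
assert (Huv : u <= 2 * v) by nra.
assert (K : Rabs (u - v) <= 36 * e * v) by (apply Rabs_le; nra).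
replace (u / v - 1) with ((u - v) / v) by (field; lra).
unfold Rdiv; rewrite Rabs_mult, Rabs_inv, (Rabs_pos_eq v) by lra.
apply Rmult_le_reg_r with v; auto.
rewrite Rmult_assoc, Rinv_l, Rmult_1_r by lra; exact K.
Qed.

Theorem corollary1p18
  (S : surface) (g : metric S) (a b : R) (gam : R -> point S)
  (Hgam : regular_curve g 3 a b gam)
  (kappa : R -> R)
  (Hkappa : geodesic_curvature g a b gam kappa)
  (Hpos : forall t, a < t < b -> 0 < kappa t)
  (c d : R) (Hac : a < c) (Hcd : c <= d) (Hdb : d < b) :
  exists delta, 0 < delta /\
  forall T : R -> R -> R, string_family g delta a b gam T ->
  forall eps, 0 < eps ->
  exists p0, 0 < p0 /\
  forall p, 0 < p < p0 ->
  forall (A : R) (m : nat),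
    c <= A <= d -> c <= Nat.iter m (T p) A <= d ->
    Rabs
      ((Rpower (kappa A) (2 / 3) * arclength g gam A (T p A))
       / (Rpower (kappa (Nat.iter m (T p) A)) (2 / 3)
          * arclength g gam (Nat.iter m (T p) A) (Nat.iter (m + 1) (T p) A))
       - 1) < eps.
Proof.
(* [delta] has to be chosen before [T] and [eps]. The fixed precision 1/24 = 1/12 - 1/24 only serves
   to give p >= kappa^2 lam^3 / 24. *)
destruct (uniform_string S g a b gam kappa c d Hgam Hkappa Hpos Hac Hcd Hdb
  (/ 24)) as [delta [Hdelta Hunif]]; [lra|].
exists delta; split; auto.
intros T HT eps Heps.
set (e := Rmin (/ 36) (eps / 72)).
assert (He : 0 < e) by (apply Rmin_pos; lra).
assert (He1 : e <= / 36) by apply Rmin_l.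
assert (He2 : e <= eps / 72) by apply Rmin_r.
destruct (uniform_string S g a b gam kappa c d Hgam Hkappa Hpos Hac Hcd Hdb
  e He) as [delta2 [Hdelta2 Hunif2]].
destruct (HT c d Hac Hcd Hdb) as [p1 [Hp1 HTp]].
(* A step of length at least [delta2] would have p >= kappa^2 lam^3 / 24 >= delta delta2^3 / 24,
   using delta <= kappa^2. Below [p2] every step is therefore shorter than [delta2], and the
   estimate with precision [e] becomes available. *)
set (p2 := delta * delta2 ^ 3 / 24).
assert (Hp2 : 0 < p2).
{ apply Rdiv_lt_0_compat; [|lra]; apply Rmult_lt_0_compat; auto.
  apply pow_lt; auto. }
exists (Rmin p1 p2); split; [apply Rmin_pos; auto|].
intros p Hp A m HA HB.
assert (Hpp1 : p < p1) by (eapply Rlt_le_trans; [apply Hp|apply Rmin_l]).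
assert (Hpp2 : p < p2) by (eapply Rlt_le_trans; [apply Hp|apply Rmin_r]).
assert (key : forall s, c <= s <= d ->
  0 < kappa s /\ 0 < arclength g gam s (T p s) /\
  Rabs (p - kappa s ^ 2 * arclength g gam s (T p s) ^ 3 / 12)
  <= e * (kappa s ^ 2 * arclength g gam s (T p s) ^ 3)).
{ intros s Hs; destruct (HTp p ltac:(lra) s Hs) as [Ht HL].
  assert (Hk : 0 < kappa s) by (apply Hpos; lra).
  assert (Hlam : 0 < arclength g gam s (T p s))
    by (apply (arclength_pos S g a b); auto; lra).
  split; auto; split; auto.
  destruct (Hunif s Hs (T p s) p Ht HL) as [H1 [H2 H3]].
  apply Hunif2; auto; apply H3.
  set (lam := arclength g gam s (T p s)) in *.
  apply Rnot_le_lt; intros Hle.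
  assert (Hc3 : delta2 ^ 3 <= lam ^ 3) by (apply pow_incr; lra).
  assert (Hd3 : 0 < delta2 ^ 3) by (apply pow_lt; auto).
  assert (delta * delta2 ^ 3 <= kappa s ^ 2 * lam ^ 3)
    by (apply Rmult_le_compat; lra).
  apply Rabs_le_between in H2; unfold p2 in Hpp2; lra. }
replace (Nat.iter (m + 1) (T p) A) with (T p (Nat.iter m (T p) A))
  by (rewrite Nat.add_1_r; reflexivity).
set (B := Nat.iter m (T p) A) in *.
(* Only the two ends A and B of the orbit enter, each through the same bound; this is the uniformity
   in [m]. *)
destruct (key A HA) as [KA [LA EA]], (key B HB) as [KB [LB EB]].
set (la := arclength g gam A (T p A)) in *.
set (lb := arclength g gam B (T p B)) in *.
assert (RA := Rpower_two_thirds_cube _ KA).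
assert (RB := Rpower_two_thirds_cube _ KB).
assert (PA : 0 < Rpower (kappa A) (2 / 3)) by apply exp_pos.
assert (PB : 0 < Rpower (kappa B) (2 / 3)) by apply exp_pos.
set (ka := Rpower (kappa A) (2 / 3)) in *.
set (kb := Rpower (kappa B) (2 / 3)) in *.
(* Cubing a positive number does not bring it closer to 1, and it turns kappa^(2/3) lam into kappa^2
   lam^3, the quantity compared with 12 p. *)
eapply Rle_lt_trans; [apply Rabs_cube_root|].
{ apply Rdiv_lt_0_compat; apply Rmult_lt_0_compat; auto. }
replace ((ka * la / (kb * lb)) ^ 3) with
  (kappa A ^ 2 * la ^ 3 / (kappa B ^ 2 * lb ^ 3))
  by (rewrite <- RA, <- RB; field; lra).
apply Rle_lt_trans with (36 * e); [|lra].
apply (ratio_estimate p); auto;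
  apply Rmult_lt_0_compat; apply pow_lt; auto.
Qed.
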